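(* Let $u_0\in H^1(0,1)$, and for each $\varepsilon\in(0,1)$ let $u_0^\varepsilon\in H^1(0,1)$ satisfy $\|u_0^\varepsilon-u_0\|_{H^1(0,1)}\le\varepsilon$ and $u_0^\varepsilon(0)=u_0^\varepsilon(1)=0$. Let $\beta=\beta(\varepsilon)\in(0,1)$ with $\beta\to0$ as $\varepsilon\to0$, let $\mathbf{Q}_\varepsilon^\beta$ be perturbing operators with associated space $\mathbb{W}\subset L^2(0,1)$ and constant $C_0$, and assume that $\mathbf{P}_\varepsilon^\beta=\mathbf{Q}_\varepsilon^\beta+2\,\partial^2/\partial y^2$ are stabilized operators with constant $C_1$. Let $u\in C([0,1];\mathbb{W})$ be the unique (strong, i.e. $H^2((0,1)\times(0,1))$) solution of $$u_{xx}+u_{yy}=0\ \text{in }(0,1)\times(0,1),\quad u(x,0)=u(x,1)=0\ (x\in[0,1]),\quad u(0,y)=u_0(y),\ u_x(0,y)=0\ (y\in[0,1]),$$ and let $u_\beta^\varepsilon$ be the unique weak solution of $$\partial_x^2u_\beta^\varepsilon-\partial_y^2u_\beta^\varepsilon+\mathbf{P}_\varepsilon^\beta u_\beta^\varepsilon=0\ \text{in }(0,1)\times(0,1),\quad u_\beta^\varepsilon(x,0)=u_\beta^\varepsilon(x,1)=0,\quad u_\beta^\varepsilon(0,y)=u_0^\varepsilon(y),\ \partial_xu_\beta^\varepsilon(0,y)=0.$$ Assume $C_1<6/7$. (a) If $\gamma$ and $\beta$ are chosen so that $\lim_{\varepsilon\to0}\varepsilon\,\gamma(\beta)\log(\gamma(\beta))=K_1\in(0,\infty)$,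 then there is a constant $C\ge0$ independent of $\varepsilon$ and $x$ such that, for all sufficiently small $\varepsilon$ (in particular with $\tfrac23C_1\log(\gamma(\beta))>1$) and all $x\in[0,1]$, $$\|\partial_xu_\beta^\varepsilon(x,\cdot)-\partial_xu(x,\cdot)\|^2+\|u_\beta^\varepsilon(x,\cdot)-u(x,\cdot)\|_{H^1(0,1)}^2\le C\,\gamma^{\frac{7C_1x}{3}-2}(\beta).$$ (b) If instead $\lim_{\varepsilon\to0}\varepsilon\,\gamma(\beta)=K_2\in(0,\infty)$, then there is a constant $C\ge0$ independent of $\varepsilon$ and $x$ such that, for all sufficiently small $\varepsilon$ and all $x\in[0,1]$, $$\|u_\beta^\varepsilon(x,\cdot)-u(x,\cdot)\|^2\le C\,\gamma^{\frac{7C_1x}{3}-2}(\beta).$$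
   Context: All functions are real-valued. $\|\cdot\|$ is the norm of $L^2(0,1)$ (in the variable $y$), and $\langle\cdot,\cdot\rangle$ is the $L^2(0,1)$ inner product or the duality pairing between $H^{-1}(0,1)$ and $H_0^1(0,1)$. Functions of $(x,y)$ are viewed as functions of $x\in[0,1]$ with values in function spaces in $y\in(0,1)$; the operators $\mathbf{Q}_\varepsilon^\beta,\mathbf{P}_\varepsilon^\beta$ act in the variable $y$. Auxiliary function: $\gamma:(0,1)\to\mathbb{R}$ with $\gamma(\beta)\ge1$ for all $\beta\in(0,1)$ and $\lim_{\beta\to0}\gamma(\beta)=\infty$; $\gamma^a(\beta)=(\gamma(\beta))^a$. Perturbing operator: a linear map $\mathbf{Q}_\varepsilon^\beta:L^2(0,1)\to L^2(0,1)$ for which there are a (normed) function space $\mathbb{W}\subset L^2(0,1)$ and a constant $C_0>0$ independent of $\varepsilon$ with $\|\mathbf{Q}_\varepsilon^\beta u\|\le C_0\|u\|_{\mathbb{W}}/\gamma(\beta)$ for all $u\in\mathbb{W}$. Stabilized operator: a linear map $\mathbf{P}_\varepsilon^\beta:H^1(0,1)\to L^2(0,1)$ for which there is a constant $C_1>0$ independent of $\varepsilon$ with $\|\mathbf{P}_\varepsilon^\beta u\|\le C_1\log(\gamma(\beta))\|u\|_{H^1(0,1)}$ for all $u\in H^1(0,1)$. The relation $\mathbf{P}_\varepsilon^\beta=\mathbf{Q}_\varepsilon^\beta+2\,\partial^2/\partial y^2$ means $\mathbf{P}_\varepsilon^\beta v=\mathbf{Q}_\varepsilon^\beta v+2v_{yy}$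 for $v\in H^2(0,1)\cap H_0^1(0,1)$. Weak solution of the regularized problem: a function $u_\beta^\varepsilon:[0,1]\to H_0^1(0,1)$ such that (i) $u_\beta^\varepsilon\in C([0,1];H_0^1(0,1))$, $\partial_xu_\beta^\varepsilon\in C([0,1];L^2(0,1))$, $\partial_x^2u_\beta^\varepsilon\in L^2(0,1;H^{-1}(0,1))$; (ii) for every $\psi\in H_0^1(0,1)$, $\langle\partial_x^2u_\beta^\varepsilon,\psi\rangle+\langle\partial_yu_\beta^\varepsilon,\partial_y\psi\rangle+\langle\mathbf{P}_\varepsilon^\beta u_\beta^\varepsilon,\psi\rangle=0$ for a.e. $x\in(0,1)$; (iii) $u_\beta^\varepsilon(0)=u_0^\varepsilon$ and $\partial_xu_\beta^\varepsilon(0)=0$. Such a weak solution exists and is unique. *)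

(* Defs.v *)
From HB Require Import structures.
From mathcomp Require Import all_boot all_order all_algebra.
From mathcomp Require Import all_classical all_reals all_analysis.

Set Implicit Arguments.
Unset Strict Implicit.
Unset Printing Implicit Defensive.
Import Order.TTheory GRing.Theory Num.Theory.
Import numFieldNormedType.Exports.
Local Open Scope classical_set_scope.
Local Open Scope ring_scope.

(* Elements of the function spaces on (0,1) and (0,1)^2 are represented by real
   functions on R and R * R, of which only the restriction to the open domain
   matters; equality of classes is [ae_eq]. *)

Section test_functions.
Context {R : realType} {V : normedModType R}.
Implicit Types phi : V -> R.

Fixpoint iter_derive (s : seq V) phi : V -> R :=
  if s is v :: s' then 'D_v (iter_derive s' phi) else phi.

Definition smooth phi : Prop := forall s : seq V,
  continuous (iter_derive s phi) /\
  forall x v, derivable (iter_derive s phi) x v.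

Definition test_fun (Om : set V) phi : Prop :=
  [/\ smooth phi, compact (closure [set x | phi x != 0])
    & closure [set x | phi x != 0] `<=` Om].

End test_functions.

Section one_dimensional_spaces.
Context {R : realType}.
Notation mu := (@lebesgue_measure R).
Implicit Types f g h phi : R -> R.

Definition I01 : set R := `]0, 1[%classic.
Definition cI01 : set R := `[0, 1]%classic.

Definition eqae f g : Prop := ae_eq mu I01 f g.

Definition L2 f : Prop := (f \_ I01) \in Lfun mu 2%:E.
Definition normL2 f : R := fine ('N[mu]_2%:E[EFin \o (f \_ I01)])%E.
Definition ip f g : R := \int[mu]_(y in I01) (f y * g y).

Definition is_wderiv f g : Prop := forall phi, test_fun I01 phi ->
  ip f ('D_1 phi) = - ip g phi.
Definition wderiv f : R -> R :=
  xget (fun=> 0) [set g | L2 g /\ is_wderiv f g].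

Definition H1 f : Prop := L2 f /\ exists g, L2 g /\ is_wderiv f g.
Definition H2 f : Prop := H1 f /\ H1 (wderiv f).
Definition normH1 f : R := Num.sqrt (normL2 f ^+ 2 + normL2 (wderiv f) ^+ 2).

Definition H10 f : Prop := H1 f /\
  forall e, 0 < e -> exists phi, test_fun I01 phi /\ normH1 (f \- phi) < e.

(* Value at a point a of [0,1] of a function of H^1(0,1), i.e. of its continuous
   representative. *)
Definition bvalue f (a c : R) : Prop :=
  exists g, [/\ {within cI01, continuous g}, eqae f g & g a = c].

(* Functionals are only ever applied to elements of H_0^1(0,1). *)
Implicit Types w : (R -> R) -> R.

Definition Hm1 w : Prop :=
  (forall a f g, H10 f -> H10 g ->
     w (fun y => a * f y + g y) = a * w f + w g) /\
  exists C, forall f, H10 f -> `|w f| <= C * normH1 f.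
Definition normHm1 w : R :=
  sup [set `|w f| | f in [set f | H10 f /\ normH1 f <= 1]].

Definition is_linear (D : set (R -> R)) (T : (R -> R) -> (R -> R)) : Prop :=
  [/\ forall f, D f -> L2 (T f),
      forall f g, D f -> D g -> eqae f g -> eqae (T f) (T g)
    & forall a f g, D f -> D g ->
        eqae (T (fun y => a * f y + g y)) (fun y => a * T f y + T g y)].

Record normed_function_space (W : set (R -> R)) (N : (R -> R) -> R) : Prop := {
  nfs_sub : forall f, W f -> L2 f;
  nfs_zero : W (fun=> 0);
  nfs_lin : forall a f g, W f -> W g -> W (fun y => a * f y + g y);
  nfs_ae : forall f g, W f -> L2 g -> eqae f g -> W g /\ N f = N g;
  nfs_ge0 : forall f, W f -> 0 <= N f;
  nfs_eq0 : forall f, W f -> N f = 0 -> eqae f (fun=> 0);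
  nfs_triangle : forall f g, W f -> W g -> N (f \+ g) <= N f + N g;
  nfs_homog : forall a f, W f -> N (fun y => a * f y) = `|a| * N f
}.

Definition perturbing (W : set (R -> R)) (N : (R -> R) -> R) (C0 gb : R)
    (Q : (R -> R) -> (R -> R)) : Prop :=
  is_linear L2 Q /\ forall f, W f -> normL2 (Q f) <= C0 * N f / gb.

Definition stabilized (C1 gb : R) (P : (R -> R) -> (R -> R)) : Prop :=
  is_linear H1 P /\
  forall f, H1 f -> normL2 (P f) <= C1 * ln gb * normH1 f.

Definition stab_pert_rel (P Q : (R -> R) -> (R -> R)) : Prop :=
  forall f, H2 f -> H10 f ->
    eqae (P f) (fun y => Q f y + 2 * wderiv (wderiv f) y).

End one_dimensional_spaces.

Section functions_of_x.
Context {R : realType}.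
Notation mu := (@lebesgue_measure R).
Implicit Types u : R -> R -> R.

(* u \in C([0,1]; X), X being normed by N *)
Definition C01 (X : set (R -> R)) (N : (R -> R) -> R) u : Prop :=
  forall x, cI01 x ->
    X (u x) /\ (N (u z \- u x) @[z --> within cI01 (nbhs x)] --> 0).

(* v is the derivative at x of u : [0,1] -> L^2(0,1), one-sided at x = 0, 1 *)
Definition is_dx u (x : R) (v : R -> R) : Prop := L2 v /\
  (normL2 (fun y => (u z y - u x y) / (z - x) - v y)
     @[z --> within cI01 x^'] --> 0).
Definition dx u (x : R) : R -> R := xget (fun=> 0) [set v | is_dx u x v].

Implicit Types v : R -> (R -> R) -> R.

(* Bochner measurability of v : (0,1) -> H^{-1}(0,1) *)
Definition strongly_measurable v : Prop :=
  exists s : nat -> R -> (R -> R) -> R,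
    [/\ forall n x, I01 x -> Hm1 (s n x),
        forall n, finite_set (s n @` I01),
        forall n w, measurable (I01 `&` s n @^-1` [set w])
      & {ae mu, forall x, I01 x ->
          (normHm1 (s n x \- v x) @[n --> \oo] --> 0)}].

Definition L2Hm1 v : Prop :=
  [/\ forall x, I01 x -> Hm1 (v x), strongly_measurable v
    & mu.-integrable I01 (fun x => (normHm1 (v x) ^+ 2)%:E)].

(* v is the weak derivative in (0,1) of g : [0,1] -> L^2(0,1), seen with values
   in H^{-1}(0,1); the H^{-1}-valued integrals are tested against H_0^1. *)
Definition is_weak_dx (g : R -> R -> R) v : Prop :=
  forall phi psi, test_fun I01 phi -> H10 psi ->
    ip (fun x => ip (g x) psi) ('D_1 phi) = - ip (fun x => v x psi) phi.

Record weak_solution (P : (R -> R) -> (R -> R)) (u0 : R -> R) u : Prop := {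
  ws_cont : C01 H10 normH1 u;
  ws_dx : forall x, cI01 x -> is_dx u x (dx u x);
  ws_dx_cont : C01 L2 normL2 (dx u);
  ws_dxx : exists v, [/\ L2Hm1 v, is_weak_dx (dx u) v
    & forall psi, H10 psi -> {ae mu, forall x, I01 x ->
        v x psi + ip (wderiv (u x)) (wderiv psi) + ip (P (u x)) psi = 0}];
  ws_init : eqae (u 0) u0;
  ws_init_dx : eqae (dx u 0) (fun=> 0)
}.

Notation mu2 := (mu \x mu)%E.
Implicit Types F G : R * R -> R.

Definition Sq : set (R * R) := I01 `*` I01.
Definition e_x : R * R := (1, 0).
Definition e_y : R * R := (0, 1).

Definition L2Sq F : Prop := (F \_ Sq) \in Lfun mu2 2%:E.
Definition is_wpartial (e : R * R) F G : Prop := forall phi, test_fun Sq phi ->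
  \int[mu2]_(z in Sq) (F z * 'D_e phi z) =
  - \int[mu2]_(z in Sq) (G z * phi z).
Definition wpartial (e : R * R) F : R * R -> R :=
  xget (fun=> 0) [set G | L2Sq G /\ is_wpartial e F G].
Definition H1Sq F : Prop := L2Sq F /\
  forall e, e = e_x \/ e = e_y -> exists G, L2Sq G /\ is_wpartial e F G.
Definition H2Sq F : Prop :=
  [/\ H1Sq F, H1Sq (wpartial e_x F) & H1Sq (wpartial e_y F)].

(* A function of H^2((0,1)^2) is identified with its representative that is
   continuous on [0,1]^2, which gives its pointwise boundary values; u_x(0,.) is
   the L^2(0,1)-derivative of x |-> u(x,.), which exists on [0,1] as u_x is in
   H^1((0,1)^2). *)
Record strong_solution (u0 : R -> R) u : Prop := {
  ss_H2 : H2Sq (fun z => u z.1 z.2);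
  ss_cont : {within cI01 `*` cI01, continuous (fun z : R * R => u z.1 z.2)};
  ss_laplace : ae_eq mu2 Sq
    (wpartial e_x (wpartial e_x (fun z => u z.1 z.2)) \+
     wpartial e_y (wpartial e_y (fun z => u z.1 z.2))) (fun=> 0);
  ss_lateral : forall x, cI01 x -> u x 0 = 0 /\ u x 1 = 0;
  ss_init : eqae (u 0) u0;
  ss_init_dx : is_dx u 0 (fun=> 0)
}.

End functions_of_x.

(* Main.v *)
(* Energy method for w = u_eps - u. As u solves u_xx = - u_yy and P = Q + 2 d_yy,
   it also solves the hyperbolic equation u_xx = u_yy + Q u - P u, so that
   w_xx = w_yy + F with F = P u - P u_eps - Q u, in the weak sense, against test
   functions in H^1_0. The energy N = |w_x|^2 + |w|_{H^1}^2 then satisfies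
   N' <= (2 + C1 ln gamma) N + (C0 M / gamma)^2, where M bounds the W-norm of u, and
   N(0) <= eps^2. Gronwall's lemma gives
   N(x) <= e^2 gamma^(C1 x) (eps^2 + (C0 M / gamma)^2), which is of order
   gamma^(C1 x - 2) as soon as eps gamma is bounded. The energy identity is obtained
   from symmetric difference quotients of <w_x(s), w(t)>. The regularity of
   x |-> u(x, .) needed for this (values of u_x and u_y at every x, u(x, .) in
   H^1_0 for all x and in H^2 for almost all x) is read off the weak partial
   derivatives, tested against products of functions of x and of y. *)

Require Import Defs.
From HB Require Import structures.
From mathcomp Require Import all_boot all_order all_algebra.
From mathcomp Require Import all_classical all_reals all_analysis measurable_realfun.
From mathcomp Require Import ring lra.
Import Order.TTheory GRing.Theory Num.Theory.
Import numFieldNormedType.Exports.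
Local Open Scope classical_set_scope.
Local Open Scope ring_scope.
Set Implicit Arguments.
Unset Strict Implicit.
Unset Printing Implicit Defensive.

(** * The space L2 *)

(** Two obstacles shape the proof. First, $w_x(x)$ lies only in $L^2(0,1)$, whereas the equation for
    $w$ is tested with functions of $H^1_0$. Hence products are taken at two values of $x$, as in
    $\langle w_x(s),w(t)\rangle$, where every pairing is admissible; the terms $\langle
    w_x(s),w_x(t)\rangle-\langle w_y(s),w_y(t)\rangle$ are symmetric in $s,t$ and cancel. Second,
    the equations hold only for almost every $x$, while the energy is differentiated at every $x$ of
    the open interval. Each identity is therefore paired with a fixed function of $y$: both sides
    become continuous in $x$, and agreement almost everywhere becomes agreement everywhere. The
    one-dimensional calculus rests on writing a primitive as an inner product with an indicator:
    continuity, integration by parts and the du Bois-Reymond lemma then follow from the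
    Cauchy-Schwarz inequality and density. *)

Section ae_integral.
Import HBNNSimple.
Context d (T : measurableType d) (R : realType) (mu : {measure set T -> \bar R}).
Local Open Scope ereal_scope.

(* No measurability is required: the integral of a nonnegative function is a
   supremum over simple functions, which may be cut off on a null set. *)
Lemma ge0_ae_le_integral_nomeas (f g : T -> \bar R) :
  (forall x, 0 <= f x) -> (forall x, 0 <= g x) ->
  {ae mu, forall x, f x <= g x} -> \int[mu]_x f x <= \int[mu]_x g x.
Proof.
move=> f0 g0 [N [mN N0 fgN]].
rewrite !ge0_integralTE//; apply: ge_ereal_sup => _ /= [h hf <-].
have mCN : measurable (~` N) by exact: measurableC.
have -> : sintegral mu h = sintegral mu (proj_nnsfun h mCN).
  rewrite -!integralT_nnsfun; apply: ge0_ae_eq_integral => //.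
  - exact/measurable_EFinP.
  - exact/measurable_EFinP.
  - by move=> x _; rewrite lee_fin.
  - by move=> x _; rewrite lee_fin.
  - exists N; split => // x /= /not_implyP[_ hx]; apply: contrapT => Nx.
    by apply: hx; rewrite /= mindicE mem_set ?mulr1.
apply: ereal_sup_ubound; exists (proj_nnsfun h mCN) => //= x.
rewrite mindicE; case: (pselect (N x)) => Nx.
  by rewrite memNset ?mulr0//= => /(_ Nx).
rewrite mem_set// mulr1; apply: le_trans (hf x) _.
by apply: contrapT => fgx; apply: Nx; exact: fgN.
Qed.

(** The positive and negative parts are compared in both directions by the inequality above. In this
    generality [ip] can be rewritten along any almost everywhere equality, for instance for
    [fun x => v x psi] with an $H^{-1}$-valued [v]. *)
Lemma ae_eq_integral_nomeas (D : set T) (f g : T -> \bar R) :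
  ae_eq mu D f g -> \int[mu]_(x in D) f x = \int[mu]_(x in D) g x.
Proof.
move=> fg; rewrite integralE [RHS]integralE.
have key (f1 g1 : T -> \bar R) : (forall x, 0 <= f1 x) -> (forall x, 0 <= g1 x) ->
    ae_eq mu D f1 g1 -> \int[mu]_(x in D) f1 x = \int[mu]_(x in D) g1 x.
  move=> f0 g0 fg1; rewrite integral_mkcond [RHS]integral_mkcond.
  apply/eqP; rewrite eq_le; apply/andP; split;
    apply: ge0_ae_le_integral_nomeas;
    try (by move=> x; rewrite patchE; case: ifP);
    by apply: filterS fg1 => x fgx; rewrite !patchE; case: ifP => // /set_mem/fgx ->.
by congr (_ - _); apply: key => //; apply: filterS fg => x fgx /fgx;
  rewrite ?funeposE ?funenegE /= => ->.
Qed.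

End ae_integral.

(** * Square-integrable functions for a general measure *)

Section square_integrable.
Context d (T : measurableType d) (R : realType) (mu : {measure set T -> \bar R}).
Variable (D : set T) (mD : measurable D).
Implicit Types f g : T -> R.

Lemma ae_eq_Rintegral f g : ae_eq mu D f g ->
  \int[mu]_(x in D) f x = \int[mu]_(x in D) g x.
Proof.
move=> fg; rewrite /Rintegral; congr fine; apply: ae_eq_integral_nomeas.
by apply: filterS fg => x fg /fg ->.
Qed.

(** Membership in [Lfun] unfolded into measurability and integrability of the square; stated for any
    measure so as to serve both the interval and the square. *)
Definition sqint f :=
  measurable_fun D f /\ mu.-integrable D (EFin \o (fun x => f x ^+ 2)).

Lemma sqint_Lfun f : (f \_ D) \in Lfun mu 2%:E <-> sqint f.
Proof.
have e2 : (f \_ D) ^+ 2 = (fun x => f x ^+ 2) \_ D.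
  apply/funext => x; rewrite -[LHS]/((f \_ D) x ^+ 2) !patchE.
  by case: ifP => // _; rewrite expr0n.
split=> [fL|[mf fi]].
  split.
    apply/measurable_restrictT => //.
    by move: fL; rewrite inE => /andP[]; rewrite inE.
  apply/integrable_mkcond => //; rewrite restrict_EFin -e2.
  exact: Lfun2_integrable_sqr.
rewrite inE; apply/andP; split; rewrite inE/=.
  exact: (iffLR (measurable_restrictT _ mD)).
rewrite /finite_norm unlock; apply: poweR_lty.
move/integrable_mkcond : fi => /(_ mD); rewrite restrict_EFin => /integrableP[_].
apply: le_lt_trans; rewrite le_eqVlt; apply/orP; left; apply/eqP.
apply: eq_integral => x _ /=; rewrite powR_mulrn// -normrX.
by rewrite -e2.
Qed.

(** The product is dominated by $f^2+g^2$. *)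
Lemma integrable_sqintM f g : sqint f -> sqint g ->
  mu.-integrable D (EFin \o (fun x => f x * g x)).
Proof.
move=> [mf f2] [mg g2]; apply: (le_integrable mD) (integrableD mD f2 g2).
  by apply/measurable_EFinP; exact: measurable_funM.
move=> x _ /=; rewrite lee_fin [leRHS]ger0_norm ?addr_ge0 ?sqr_ge0//.
by rewrite ler_norml; apply/andP; split; nra.
Qed.

Lemma sqintS a f g : sqint f -> sqint g -> sqint (fun x => a * f x + g x).
Proof.
move=> sf sg; have fg := integrable_sqintM sf sg.
have [mf f2] := sf; have [mg g2] := sg; split.
  by apply: measurable_funD => //; exact: measurable_funM.
have := integrableD mD (integrableD mD (integrableZl mD (a ^+ 2) f2) g2)
  (integrableZl mD (2 * a) fg).
apply: eq_integrable => // x _ /=.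
rewrite -!EFinM -!EFinD; congr EFin; ring.
Qed.

Lemma sqint0 : sqint (fun=> 0).
Proof.
split => //; rewrite (_ : _ \o _ = cst 0%E); first exact: integrable0.
by apply/funext => x /=; rewrite expr0n.
Qed.

Lemma eq_sqint f g : f =1 g -> sqint f -> sqint g.
Proof. by move=> /funext ->. Qed.

Lemma sqintD f g : sqint f -> sqint g -> sqint (f \+ g).
Proof.
by move=> sf sg; apply: eq_sqint (sqintS 1 sf sg) => x /=; rewrite mul1r.
Qed.

Lemma sqintZ a f : sqint f -> sqint (fun x => a * f x).
Proof. by move=> sf; apply: eq_sqint (sqintS a sf sqint0) => x; rewrite addr0. Qed.

Lemma sqintB f g : sqint f -> sqint g -> sqint (f \- g).
Proof.
by move=> sf sg; apply: eq_sqint (sqintS (-1) sg sf) => x /=; rewrite mulN1r addrC.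
Qed.

Lemma sqintN f : sqint f -> sqint (\- f).
Proof. by move=> sf; apply: eq_sqint (sqintZ (-1) sf) => x /=; rewrite mulN1r. Qed.

Lemma sqint_bounded f (C : R) : (mu D < +oo)%E -> measurable_fun D f ->
  (forall x, D x -> `|f x| <= C) -> sqint f.
Proof.
move=> Dfin mf fC; split => //.
apply: measurable_bounded_integrable => //; first exact: measurable_funX.
exists (C ^+ 2); split => [|z Cz x Dx]; first exact: num_real.
rewrite /= normrX; apply: le_trans (ltW Cz).
by rewrite lerXn2r ?nnegrE ?fC//; exact: le_trans (fC x Dx).
Qed.

End square_integrable.

(** * Inner product and norm of $L^2(0,1)$ *)

Section L2_space.
Context {R : realType}.
Notation mu := (@lebesgue_measure R).
Implicit Types f g h : R -> R.

Lemma measurable_I01 : measurable (I01 : set (measurableTypeR R)).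
Proof. exact: measurable_itv. Qed.
Hint Resolve measurable_I01 : core.

Lemma I01_itv (x : R) : I01 x = (0 < x < 1) :> Prop.
Proof. by rewrite /I01 /= in_itv. Qed.

Lemma cI01_itv (x : R) : cI01 x = (0 <= x <= 1) :> Prop.
Proof. by rewrite /cI01 /= in_itv. Qed.

Lemma sub_I01 : @I01 R `<=` cI01.
Proof. by move=> x; rewrite I01_itv cI01_itv => /andP[/ltW -> /ltW ->]. Qed.

Lemma mu_I01 : mu I01 = 1%E.
Proof. by rewrite /I01 lebesgue_measure_itv/= lte_fin ltr01 -EFinB subr0. Qed.

Lemma mu_I01_fin : (mu I01 < +oo)%E.
Proof. by rewrite mu_I01 ltry. Qed.
Hint Resolve mu_I01_fin : core.

Lemma L2_sqint f : L2 f <-> sqint mu I01 f.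
Proof. exact: sqint_Lfun. Qed.

Lemma L2S a f g : L2 f -> L2 g -> L2 (fun y => a * f y + g y).
Proof. by move=> /L2_sqint sf /L2_sqint sg; apply/L2_sqint/sqintS. Qed.

Lemma L2D f g : L2 f -> L2 g -> L2 (f \+ g).
Proof. by move=> /L2_sqint sf /L2_sqint sg; apply/L2_sqint/sqintD. Qed.

Lemma L2B f g : L2 f -> L2 g -> L2 (f \- g).
Proof. by move=> /L2_sqint sf /L2_sqint sg; apply/L2_sqint/sqintB. Qed.

Lemma L2N f : L2 f -> L2 (\- f).
Proof. by move=> /L2_sqint sf; apply/L2_sqint/sqintN. Qed.

Lemma L2Z a f : L2 f -> L2 (fun y => a * f y).
Proof. by move=> /L2_sqint sf; apply/L2_sqint/sqintZ. Qed.

Lemma L2_0 : L2 (fun=> 0 : R).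
Proof. exact/L2_sqint/sqint0. Qed.

Lemma L2_bounded f (C : R) : measurable_fun (I01 : set (measurableTypeR R)) f ->
  (forall x, I01 x -> `|f x| <= C) -> L2 f.
Proof. by move=> mf fC; apply/L2_sqint; exact: (sqint_bounded measurable_I01 mu_I01_fin mf fC). Qed.

Lemma L2_cst (c : R) : L2 (fun=> c).
Proof. by apply: (@L2_bounded _ `|c|). Qed.

Lemma continuous_I01_measurable f :
  {within cI01, continuous f} -> measurable_fun (I01 : set (measurableTypeR R)) f.
Proof.
move=> cf; apply: (measurable_funS (E := cI01 : set (measurableTypeR R)) _ sub_I01); first exact: measurable_itv.
by apply: subspace_continuous_measurable_fun => //; exact: measurable_itv.
Qed.

Lemma continuous_I01_bounded f : {within cI01, continuous f} ->
  exists C, 0 <= C /\ forall x, cI01 x -> `|f x| <= C.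
Proof.
move=> cf; have cabs : {within cI01, continuous (fun x => `|f x|)}.
  by move=> x; apply: continuous_comp; [exact: cf|exact: norm_continuous].
have [c cI cM] := EVT_max ler01 cabs.
by exists `|f c|.
Qed.

Lemma L2_continuous f : {within cI01, continuous f} -> L2 f.
Proof.
move=> cf; have [C [_ fC]] := continuous_I01_bounded cf.
apply: (@L2_bounded _ C); first exact: continuous_I01_measurable.
by move=> x /sub_I01; exact: fC.
Qed.

Lemma integrable_L2M f g : L2 f -> L2 g ->
  mu.-integrable I01 (EFin \o (fun x => f x * g x)).
Proof. by move=> /L2_sqint sf /L2_sqint sg; exact: integrable_sqintM. Qed.

Lemma ipC f g : ip f g = ip g f.
Proof. by rewrite /ip; congr (Rintegral _ _ _); apply/funext => x; exact: mulrC. Qed.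

Lemma ip_eqae f f' g : eqae f f' -> ip f g = ip f' g.
Proof.
by move=> ff; apply: ae_eq_Rintegral; apply: filterS ff => x fx Ix; rewrite fx.
Qed.

Lemma ip_eqaer f g g' : eqae g g' -> ip f g = ip f g'.
Proof. by rewrite !(ipC f); exact: ip_eqae. Qed.

Lemma eq_ip f f' g g' : (forall x, I01 x -> f x = f' x) ->
  (forall x, I01 x -> g x = g' x) -> ip f g = ip f' g'.
Proof. by move=> ff gg; apply: eq_Rintegral => x /set_mem Ix; rewrite ff// gg. Qed.

Lemma ipSl a f g h : L2 f -> L2 g -> L2 h ->
  ip (fun y => a * f y + g y) h = a * ip f h + ip g h.
Proof.
move=> lf lg lh; rewrite /ip -RintegralZl ?integrable_L2M// -RintegralD//.
- by apply: eq_Rintegral => x _; ring.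
- have := integrableZl measurable_I01 a (integrable_L2M lf lh).
  by apply: eq_integrable => // x _ /=; rewrite -EFinM.
- exact: integrable_L2M.
Qed.

Lemma ip0l f : ip (fun=> 0) f = 0.
Proof.
by rewrite /ip; under eq_Rintegral do rewrite mul0r; rewrite Rintegral_cst// mul0r.
Qed.

Lemma ip0r f : ip f (fun=> 0) = 0. Proof. by rewrite ipC ip0l. Qed.

Lemma ipDl f g h : L2 f -> L2 g -> L2 h -> ip (f \+ g) h = ip f h + ip g h.
Proof.
move=> lf lg lh; have := ipSl 1 lf lg lh; rewrite mul1r => <-.
by apply: eq_ip => // x _ /=; rewrite mul1r.
Qed.

Lemma ipBl f g h : L2 f -> L2 g -> L2 h -> ip (f \- g) h = ip f h - ip g h.
Proof.
move=> lf lg lh; have := ipSl (-1) lg lf lh; rewrite mulN1r addrC => <-.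
by apply: eq_ip => // x _ /=; rewrite mulN1r addrC.
Qed.

Lemma ipZl a f g : L2 f -> L2 g -> ip (fun y => a * f y) g = a * ip f g.
Proof.
move=> lf lg; have := ipSl a lf L2_0 lg; rewrite ip0l addr0 => <-.
by apply: eq_ip => // x _ /=; rewrite addr0.
Qed.

Lemma ipNl f g : L2 f -> L2 g -> ip (\- f) g = - ip f g.
Proof.
move=> lf lg; rewrite -mulN1r -ipZl//.
by apply: eq_ip => // x _ /=; rewrite mulN1r.
Qed.

Lemma ipSr a f g h : L2 f -> L2 g -> L2 h ->
  ip h (fun y => a * f y + g y) = a * ip h f + ip h g.
Proof. by move=> *; rewrite ipC ipSl// !(ipC h). Qed.

Lemma ipDr f g h : L2 f -> L2 g -> L2 h -> ip h (f \+ g) = ip h f + ip h g.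
Proof. by move=> *; rewrite ipC ipDl// !(ipC h). Qed.

Lemma ipBr f g h : L2 f -> L2 g -> L2 h -> ip h (f \- g) = ip h f - ip h g.
Proof. by move=> *; rewrite ipC ipBl// !(ipC h). Qed.

Lemma ipZr a f g : L2 f -> L2 g -> ip f (fun y => a * g y) = a * ip f g.
Proof. by move=> *; rewrite ipC ipZl// (ipC g). Qed.

Lemma ip_ge0 f : 0 <= ip f f.
Proof. by apply: Rintegral_ge0 => x _; rewrite -expr2 sqr_ge0. Qed.

Lemma normL2_ge0 f : 0 <= normL2 f.
Proof. by rewrite /normL2 fine_ge0// Lnorm_ge0. Qed.
Hint Resolve normL2_ge0 : core.

Lemma normL2_sqr f : L2 f -> normL2 f ^+ 2 = ip f f.
Proof.
move=> lf; have /integrable_fin_num fin := integrable_L2M lf lf.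
rewrite /normL2 unlock /=.
have -> : (\int[mu]_x `|((f \_ I01) x)%:E| `^ 2 = (ip f f)%:E)%E.
  rewrite /ip /Rintegral fineK ?fin//.
  rewrite [RHS]integral_mkcond; apply: eq_integral => x _.
  rewrite !patchE; case: ifP => _ /=; last by rewrite normr0 powR0.
  by rewrite powR_mulrn// real_normK ?num_real// expr2.
rewrite poweR_EFin /= -powR_mulrn ?powR_ge0// -powRrM mulVf// powRr1//.
exact: ip_ge0.
Qed.

Lemma normL2E f : L2 f -> normL2 f = Num.sqrt (ip f f).
Proof. by move=> lf; rewrite -normL2_sqr// sqrtr_sqr ger0_norm. Qed.

(* The quadratic [t |-> |t f + g|^2] is nonnegative. *)
Lemma ip_CS f g : L2 f -> L2 g -> `|ip f g| <= normL2 f * normL2 g.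
Proof.
move=> lf lg.
have key t : 0 <= t ^+ 2 * normL2 f ^+ 2 + 2 * t * ip f g + normL2 g ^+ 2.
  have lh := L2S t lf lg.
  have := ip_ge0 (fun y => t * f y + g y).
  rewrite ipSl// !(ipSr t lf lg)// -!normL2_sqr// (ipC g f).
  by congr (_ <= _); ring.
have f0 := normL2_ge0 f; have g0 := normL2_ge0 g.
rewrite -[leRHS]ger0_norm ?mulr_ge0// -ler_sqr ?nnegrE// !real_normK ?num_real//.
rewrite exprMn; have [f00|fn0] := eqVneq (normL2 f) 0.
  rewrite f00 expr0n mul0r.
  have [->|ne] := eqVneq (ip f g) 0; first by rewrite expr0n.
  (* When $\|f\|=0$ the quadratic is affine in $t$; at this $t$ it would equal $-1$. *)
  have := key (- (normL2 g ^+ 2 + 1) / (2 * ip f g)).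
  rewrite f00 expr0n mulr0 add0r mulrAC.
  rewrite [X in X + _](_ : _ = - (normL2 g ^+ 2 + 1)); last by field.
  by lra.
(* This $t$ minimises the quadratic. *)
have := key (- ip f g / normL2 f ^+ 2).
rewrite [X in 0 <= X -> _](_ : _ =
  (normL2 f ^+ 2 * normL2 g ^+ 2 - ip f g ^+ 2) / normL2 f ^+ 2); last by field.
by rewrite pmulr_lge0 ?subr_ge0// invr_gt0 exprn_gt0// lt0r fn0.
Qed.

Lemma normL2D f g : L2 f -> L2 g -> normL2 (f \+ g) <= normL2 f + normL2 g.
Proof.
move=> lf lg; have lfg := L2D lf lg.
rewrite -ler_sqr ?nnegrE ?addr_ge0// normL2_sqr// ipDl// !ipDr// -!normL2_sqr//.
have := le_trans (ler_norm _) (ip_CS lf lg); rewrite (ipC g f) sqrrD; lra.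
Qed.

Lemma normL2Z a f : L2 f -> normL2 (fun y => a * f y) = `|a| * normL2 f.
Proof.
move=> lf; have lZ := L2Z a lf.
rewrite normL2E// ipZl// ipZr// mulrA -expr2 sqrtrM ?sqr_ge0// sqrtr_sqr.
by rewrite -normL2E.
Qed.

Lemma eq_normL2 f g : (forall x, I01 x -> f x = g x) -> normL2 f = normL2 g.
Proof.
move=> fg; rewrite /normL2; congr (fine (Lnorm _ _ _)); apply/funext => x /=.
by rewrite !patchE; case: ifP => // /set_mem/fg ->.
Qed.

Lemma normL2N f : L2 f -> normL2 (\- f) = normL2 f.
Proof.
move=> lf; rewrite -[RHS]mul1r -(@normr1 R) -normrN -normL2Z//.
by apply: eq_normL2 => x _ /=; rewrite mulN1r.
Qed.

Lemma normL2B f g : L2 f -> L2 g -> normL2 (f \- g) <= normL2 f + normL2 g.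
Proof.
move=> lf lg; rewrite -(normL2N lg).
by apply: le_trans (normL2D lf (L2N lg)).
Qed.

Lemma normL2C f g : L2 f -> L2 g -> normL2 (f \- g) = normL2 (g \- f).
Proof.
move=> lf lg; rewrite -normL2N; last exact: L2B.
by apply: eq_normL2 => x _ /=; rewrite opprB.
Qed.

Lemma normL2_0 : normL2 (fun=> 0 : R) = 0.
Proof. by rewrite normL2E ?ip0l ?sqrtr0//; exact: L2_0. Qed.

Lemma normL2_eqae f g : L2 f -> L2 g -> eqae f g -> normL2 f = normL2 g.
Proof.
by move=> lf lg fg; rewrite !normL2E// (ip_eqae _ fg) (ip_eqaer _ fg).
Qed.

Lemma normL2_eq0 f : L2 f -> normL2 f = 0 -> eqae f (fun=> 0).
Proof.
move=> lf f0.
have [mf fi] := (L2_sqint f).1 lf.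
have m2 : measurable_fun I01 (fun x => (f x ^+ 2)%:E).
  by apply/measurable_EFinP; exact: measurable_funX.
have : (\int[mu]_(x in I01) `|(f x ^+ 2)%:E| = 0)%E.
  transitivity (\int[mu]_(x in I01) ((f x ^+ 2)%:E))%E.
    by apply: eq_integral => x _; rewrite /= ger0_norm// sqr_ge0.
  have := normL2_sqr lf; rewrite f0 expr0n /= /ip /Rintegral => /esym/eqP.
  rewrite fine_eq0; last exact: (integrable_fin_num _ (integrable_L2M lf lf)).
  by move=> /eqP.
move/(ae_eq_integral_abs _ measurable_I01 m2); apply: filterS => x fx Ix.
by move: (fx Ix) => /= -[/eqP]; rewrite sqrf_eq0 => /eqP.
Qed.

Lemma eqae_refl f : eqae f f.
Proof. exact: ae_eq_refl. Qed.

Lemma eqae_sym f g : eqae f g -> eqae g f.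
Proof. exact: ae_eq_sym. Qed.

Lemma eqae_trans g f h : eqae f g -> eqae g h -> eqae f h.
Proof. exact: ae_eq_trans. Qed.

Lemma eqae_subr0 f g : eqae (f \- g) (fun=> 0) -> eqae f g.
Proof. by apply: filterS => x /= fg /fg /subr0_eq. Qed.

Lemma ip_self_eq0 f : L2 f -> ip f f = 0 -> eqae f (fun=> 0).
Proof.
by move=> lf f0; apply: normL2_eq0 => //; rewrite normL2E// f0 sqrtr0.
Qed.

End L2_space.
#[export] Hint Resolve measurable_I01 mu_I01_fin normL2_ge0 : core.

(** * Smooth functions *)

Section smooth_functions.
Context {R : realType} {V : normedModType R}.
Implicit Types (f g : V -> R) (C : set (V -> R)).

Inductive lin_span C : (V -> R) -> Prop :=
| lin_span0 : lin_span C (fun=> 0)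
| lin_spanS a f g : C f -> lin_span C g -> lin_span C (fun x => a * f x + g x).

Lemma lin_span1 C f : C f -> lin_span C f.
Proof.
move=> Cf; have := lin_spanS 1 Cf (lin_span0 C).
by congr lin_span; apply/funext => x; rewrite mul1r addr0.
Qed.

Lemma lin_spanD C a f g : lin_span C f -> lin_span C g ->
  lin_span C (fun x => a * f x + g x).
Proof.
move=> + Cg; elim=> [|b f1 g1 Cf1 _ IH].
  by apply: eq_ind Cg _ _; apply/funext => x; rewrite mulr0 add0r.
have := lin_spanS (a * b) Cf1 IH; congr lin_span; apply/funext => x; ring.
Qed.

Lemma is_derive_lin a f g df dg x v : is_derive x v f df -> is_derive x v g dg ->
  is_derive x v (fun x => a * f x + g x) (a * df + dg).
Proof.
move=> f' g'; have := is_deriveD (is_deriveZ a f') g'.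
by congr is_derive.
Qed.

(** Smoothness without formulas for higher derivatives: if the derivatives of the generators stay in
    the span, all iterated derivatives do, and every member of the span is continuous and
    derivable. *)
Lemma smooth_lin_span C :
  (forall f, C f -> continuous f) ->
  (forall f v, C f -> exists2 f', lin_span C f' & forall x, is_derive x v f (f' x)) ->
  forall f, lin_span C f -> smooth f.
Proof.
move=> Cc Cd.
have lc f : lin_span C f -> continuous f.
  elim=> [|a f1 g Cf1 _ gc]; first exact: cst_continuous.
  move=> x; apply: cvgD; last exact: gc.
  by apply: cvgMr; exact: Cc.
have ld f v : lin_span C f ->
    exists2 f', lin_span C f' & forall x, is_derive x v f (f' x).
  elim=> [|a f1 g Cf1 _ [g' Cg' dg]].
    by exists (fun=> 0); [exact: lin_span0|move=> x; exact: is_derive_cst].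
  have [f' Cf' df] := Cd _ v Cf1.
  exists (fun x => a * f' x + g' x); first exact: lin_spanD.
  by move=> x; exact: is_derive_lin.
have li s f : lin_span C f -> lin_span C (iter_derive s f).
  move=> Cf; elim: s => //= v s /(ld _ v)[f' Cf' df].
  have -> // : 'D_v (iter_derive s f) = f'.
  by apply/funext => x; have dx := df x; exact: derive_val.
move=> f Cf s; have Cs := li s _ Cf; split; first exact: lc.
by move=> x v; have [f' _ df] := ld _ v Cs; have dx := df x; exact: ex_derive.
Qed.

Lemma smooth_continuous f : smooth f -> continuous f.
Proof. by move=> /(_ [::])[]. Qed.

Lemma smooth_derivable f : smooth f -> forall x v, derivable f x v.
Proof. by move=> /(_ [::])[]. Qed.

Lemma smooth_is_derive f x v : smooth f -> is_derive x v f ('D_v f x).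
Proof. by move=> sf; apply/derivableP/smooth_derivable. Qed.

Lemma smooth_derive f v : smooth f -> smooth ('D_v f).
Proof.
move=> sf s; have -> : iter_derive s ('D_v f) = iter_derive (rcons s v) f.
  by elim: s => //= w s ->.
exact: sf.
Qed.

Lemma smooth_cst (c : R) : smooth (fun _ : V => c).
Proof.
apply: (@smooth_lin_span [set (fun=> c) | c in setT]).
- by move=> _ [c' _ <-]; exact: cst_continuous.
- move=> _ v [c' _ <-]; exists (fun=> 0); first exact: lin_span0.
  by move=> x; exact: is_derive_cst.
- by apply: lin_span1; exists c.
Qed.

Lemma smoothM f g : smooth f -> smooth g -> smooth (fun x => f x * g x).
Proof.
move=> sf sg.
(* By the Leibniz rule the derivative of a product of smooth functions is a sum of two such
   products. *)
pose C := [set h | exists f g, [/\ smooth f, smooth g & h = fun x => f x * g x]].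
apply: (@smooth_lin_span C).
- move=> _ [f1 [g1 [sf1 sg1 ->]]] x.
  by apply: cvgM; exact: smooth_continuous.
- move=> _ v [f1 [g1 [sf1 sg1 ->]]].
  exists (fun x => 1 * (f1 x * 'D_v g1 x) + (g1 x * 'D_v f1 x)).
    apply: lin_spanD; apply: lin_span1.
      by exists f1, ('D_v g1); split; [exact: sf1|exact: smooth_derive|].
    by exists g1, ('D_v f1); split; [exact: sg1|exact: smooth_derive|].
  move=> x; rewrite mul1r.
  exact: is_deriveM (smooth_is_derive x v sf1) (smooth_is_derive x v sg1).
- by apply: lin_span1; exists f, g.
Qed.

Lemma smoothS a f g : smooth f -> smooth g -> smooth (fun x => a * f x + g x).
Proof.
move=> sf sg; apply: (@smooth_lin_span smooth).
- exact: smooth_continuous.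
- move=> f1 v sf1; exists ('D_v f1); first by apply: lin_span1; exact: smooth_derive.
  by move=> x; exact: smooth_is_derive.
- by apply: lin_spanS => //; exact: lin_span1.
Qed.

End smooth_functions.

Section smooth_line.
Context {R : realType}.
Implicit Types (f g : R -> R) (C : set (R -> R)).

(** Derivatives are linear in the direction, so on the line only the direction 1 has to be
    examined. *)
Lemma is_derive_dir f (x v df : R) : is_derive x 1 f df -> is_derive x v f (v * df).
Proof.
move=> fx; have /derivable1_diffP dx : derivable f x 1 by exact: ex_derive.
have dv : derivable f x v by exact: diff_derivable.
apply: DeriveDef => //; rewrite deriveE// -(@derive_val _ _ _ _ _ _ _ fx) deriveE//.
by rewrite -{1}[v]mulr1 -[v * 1]/(v *: 1) linearZ.
Qed.

Lemma smooth_line_lin_span C :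
  (forall f, C f -> exists2 f', lin_span C f' & forall x : R, is_derive x 1 f (f' x)) ->
  forall f, C f -> smooth f.
Proof.
move=> Cd f Cf; apply: (@smooth_lin_span _ _ C); last exact: lin_span1.
- move=> {Cf}f /Cd[f' _ df] x; apply: differentiable_continuous.
  by apply/derivable1_diffP; have dx := df x; exact: ex_derive.
- move=> g v /Cd[f' lf df]; exists (fun x => v * f' x + 0).
    by apply: lin_spanD => //; exact: lin_span0.
  by move=> x; rewrite addr0; exact: is_derive_dir.
Qed.

Lemma smooth_affine f (a b : R) : smooth f -> smooth (fun x => f (a * x + b)).
Proof.
move=> sf.
apply: (@smooth_line_lin_span [set h | exists2 f, smooth f & h = fun x => f (a * x + b)]).
  move=> _ [g sg ->]; exists (fun x => a * 'D_1 g (a * x + b) + 0).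
    apply: lin_spanS (lin_span0 _); by exists ('D_1 g); first exact: smooth_derive.
  move=> x; rewrite addr0 mulrC.
  have d1 : is_derive x 1 (fun x => a * x + b) a.
    have := is_derive_lin a (is_derive_id x 1) (is_derive_cst b x 1).
    by rewrite mulr1 addr0.
  have d2 := smooth_is_derive (a * x + b) 1 sg.
  exact: (@is_derive1_comp _ g).
by exists f.
Qed.

(** Adjoining [f] to the class of smooth functions keeps it closed under derivation, since the
    derivative of [f] is the smooth [g]. *)
Lemma smooth_primitive f g : smooth g -> (forall x : R, is_derive x 1 f (g x)) ->
  smooth f.
Proof.
move=> sg df; apply: (@smooth_line_lin_span (f |` smooth)); last by left.
move=> h [->|sh].
  by exists g => //; apply: lin_span1; right.
exists ('D_1 h); first by apply: lin_span1; right; exact: smooth_derive.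
by move=> x; exact: smooth_is_derive.
Qed.

End smooth_line.

(** * Smooth functions with compact support *)

Section bump_functions.
Context {R : realType}.
Implicit Types (l x h : R) (k : nat).

Lemma is_derive_quotient (f : R -> R) x d :
  (h^-1 * (f (h + x) - f x)) @[h --> 0^'] --> d -> is_derive x 1 f d.
Proof.
move=> fd; have fd' : h^-1 *: (f (h *: 1 + x) - f x) @[h --> 0^'] --> d.
  by under eq_fun do rewrite [_ *: 1]mulr1.
by apply: DeriveDef; [apply/cvg_ex; exists d|exact: cvg_lim].
Qed.

(** The functions $x^{-k}e^{-l/x}$ extended by 0 to $x\le0$: together they span a space closed under
    derivation, and $k=0$ gives the classical flat function. *)
Definition flat_mono l k x : R := if 0 < x then x ^- k * expR (- (l / x)) else 0.

(** Comes from $e^{-t}\le (k+2)!/t^{k+2}$ at $t=l/x$. The exponent $k+2$ leaves $x^2$, which makes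
    the difference quotient at 0 tend to 0. *)
Lemma flat_mono_bound l k x : 0 < l -> 0 < x ->
  0 <= flat_mono l k x <= (k.+2)`!%:R / l ^+ k.+2 * x ^+ 2.
Proof.
move=> l0 x0; rewrite /flat_mono x0.
have xk : 0 < x ^- k by rewrite invr_gt0 exprn_gt0.
apply/andP; split; first by rewrite mulr_ge0 ?expR_ge0 ?ltW.
have t0 : 0 < l / x by rewrite divr_gt0.
have f0 : 0 < (k.+2)`!%:R :> R by rewrite ltr0n fact_gt0.
have e1 : expR (- (l / x)) <= (k.+2)`!%:R / (l / x) ^+ k.+2.
  rewrite expRN -[leRHS]invrK lef_pV2 ?posrE ?expR_gt0 ?invr_gt0 ?divr_gt0 ?exprn_gt0//.
  rewrite invf_div; apply: le_trans (expR_ge1Dxn k.+1 (ltW t0)).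
  by rewrite lerDr.
apply: (le_trans (ler_wpM2l (ltW xk) e1)).
rewrite le_eqVlt; apply/orP; left; apply/eqP.
rewrite expr_div_n -[in x ^+ k.+2]addn2 exprD; field.
by rewrite !expf_neq0 ?gt_eqF.
Qed.

Lemma is_derive_flat_mono l k x : 0 < l ->
  is_derive x 1 (flat_mono l k)
    (- k%:R * flat_mono l k.+1 x + l * flat_mono l k.+2 x).
Proof.
move=> l0; have [x0|x0|->] := ltgtP x 0.
- have -> : - k%:R * flat_mono l k.+1 x + l * flat_mono l k.+2 x = 0.
    by rewrite /flat_mono ltNge ltW//= !mulr0 addr0.
  have d0 : is_derive x (1 : R) (fun=> 0 : R) 0 by exact: is_derive_cst.
  apply: near_eq_is_derive d0.
  near=> y; rewrite /flat_mono ltNge ltW//=.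
  by near: y; exact: lt_nbhsl.
- have xn0 : x != 0 by rewrite gt_eqF.
  have dV : is_derive x 1 (fun y : R => y^-1) (- x ^- 2).
    by have := is_deriveV (f := id) xn0 (is_derive_id x 1); rewrite [_ *: 1]mulr1.
  have dX : is_derive x 1 (fun y : R => y^-1 ^+ k) (- k%:R * x ^- k.+1).
    have := is_deriveX k dV.
    congr is_derive; first by rewrite exprfctE.
    rewrite -[LHS]/(_ * _); case: k {dV} => [|k]; first by rewrite !mul0r oppr0 mul0r.
    rewrite /= -mulr_natl !exprVn [in RHS]exprS [in RHS]exprS exprS; field.
    by rewrite !expf_neq0.
  have dE : is_derive x 1 (fun y : R => expR (- (l / y)))
      (expR (- (l / x)) * (l * x ^- 2)).
    have dl : is_derive x 1 (fun y : R => - (l / y)) (l * x ^- 2).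
      have := is_deriveN (is_deriveZ l dV).
      by rewrite [l *: _]mulrN opprK.
    exact: is_derive1_comp (is_derive_expR _) dl.
  have dM := is_deriveM dX dE.
  have {}dM : is_derive x 1 (fun y : R => y^-1 ^+ k * expR (- (l / y)))
      (- k%:R * flat_mono l k.+1 x + l * flat_mono l k.+2 x).
    move: dM; congr is_derive; rewrite /flat_mono x0.
    rewrite -[LHS]/(_ * _ + _ * _) exprVn [x ^+ k.+2]exprSr [x ^+ k.+1]exprSr.
    by field; rewrite xn0 expf_neq0.
  apply: near_eq_is_derive dM; near=> y; rewrite /flat_mono exprVn ifT//.
  by near: y; exact: lt_nbhsr.
- have -> : - k%:R * flat_mono l k.+1 0 + l * flat_mono l k.+2 0 = 0.
    by rewrite /flat_mono ltxx !mulr0 addr0.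
  (* At the origin the quotient is squeezed between 0 and $K|h|$. *)
  apply: is_derive_quotient; set K := (k.+2)`!%:R / l ^+ k.+2.
  have K0 : 0 <= K by rewrite divr_ge0// exprn_ge0// ltW.
  apply: (@squeeze_cvgr _ _ _ _ (fun=> 0) (fun h => K * `|h|)).
  + near=> h; rewrite addr0 /flat_mono ltxx subr0.
    have [h0|h0] := ltP 0 h; last by rewrite mulr0 lexx mulr_ge0.
    have /andP[b0 b1] := flat_mono_bound k l0 h0.
    move: b0 b1; rewrite /flat_mono h0 => b0 b1.
    apply/andP; split; first by apply: mulr_ge0 => //; rewrite invr_ge0 ltW.
    by rewrite ler_pdivrMl// gtr0_norm// mulrCA -expr2.
  + exact: cvg_cst.
  + have c0 : `|h| @[h --> (0 : R)^'] --> (0 : R).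
      apply: cvg_within_filter.
      by have := @norm_continuous _ R 0; rewrite /continuous_at normr0.
    by rewrite -[X in _ --> X](mulr0 K); exact: cvgMr.
Unshelve. all: end_near.
Qed.

Definition flat l x : R := if 0 < x then expR (- (l / x)) else 0.

Lemma smooth_flat l : 0 < l -> smooth (flat l).
Proof.
move=> l0; have -> : flat l = flat_mono l 0.
  by apply/funext => x; rewrite /flat /flat_mono expr0 invr1 mul1r.
apply: (@smooth_line_lin_span _ (range (flat_mono l))); last by exists 0%N.
move=> _ [k _ <-].
exists (fun x => - k%:R * flat_mono l k.+1 x + (l * flat_mono l k.+2 x + 0)).
  apply: lin_spanS; first by exists k.+1.
  by apply: lin_spanS; [exists k.+2|exact: lin_span0].
by move=> x; rewrite addr0; exact: is_derive_flat_mono.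
Qed.

(** The parameter [l] governs the steepness: as it tends to 0, the bump tends to the indicator of
    $(a,c)$ pointwise. *)
Definition bump l a c x : R := flat l (x - a) * flat l (c - x).

Lemma smooth_bump l a c : 0 < l -> smooth (bump l a c).
Proof.
move=> l0; apply: smoothM.
  have := smooth_affine 1 (- a) (smooth_flat l0).
  by congr smooth; apply/funext => x; rewrite mul1r.
have := smooth_affine (-1) c (smooth_flat l0).
by congr smooth; apply/funext => x; rewrite mulN1r addrC.
Qed.

Lemma flat_ge0 l x : 0 <= flat l x.
Proof. by rewrite /flat; case: ifP => // _; exact: expR_ge0. Qed.

Lemma flat_le1 l x : 0 < l -> flat l x <= 1.
Proof.
move=> l0; rewrite /flat; case: ifP => // x0.
by rewrite -expR0 ler_expR oppr_le0 divr_ge0// ltW.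
Qed.

Lemma bump_ge0 l a c x : 0 <= bump l a c x.
Proof. by rewrite mulr_ge0 ?flat_ge0. Qed.

Lemma bump_le1 l a c x : 0 < l -> bump l a c x <= 1.
Proof. by move=> l0; rewrite mulr_ile1 ?flat_ge0 ?flat_le1. Qed.

Lemma bump_gt0 l a c x : a < x < c -> 0 < bump l a c x.
Proof.
move=> /andP[ax xc]; rewrite /bump /flat !subr_gt0 ax xc.
by rewrite mulr_gt0 ?expR_gt0.
Qed.

Lemma bump_eq0 l a c x : ~~ (a < x < c) -> bump l a c x = 0.
Proof.
rewrite negb_and /bump /flat !subr_gt0 => /orP[|] /negbTE ->.
  by rewrite mul0r.
by rewrite mulr0.
Qed.

End bump_functions.

(** * Primitives and density *)

Section primitive.
Context {R : realType}.
Notation mu := (@lebesgue_measure R).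
Implicit Types f g : R -> R.

Definition below (x s : R) : R := (s < x)%R%:R.

Lemma measurable_below (x : R) (D : set (measurableTypeR R)) :
  measurable D -> measurable_fun D (below x).
Proof.
move=> mD; have -> : below x = \1_(`]-oo, x[ : set R).
  apply/funext => s; rewrite indicE /below; congr (_%:R).
  by congr nat_of_bool; apply/idP/idP; rewrite inE /= in_itv.
apply: measurable_indic; exact: measurable_itv.
Qed.

Lemma below_bounded (x s : R) : `|below x s| <= 1.
Proof. by rewrite /below; case: (_ < _); rewrite ?normr1 ?normr0. Qed.

Lemma L2_below x : L2 (below x).
Proof.
apply: (@L2_bounded _ _ 1); first exact: measurable_below.
by move=> s _; exact: below_bounded.
Qed.

(** As an inner product with an indicator, the primitive inherits linearity, bounds and invariance
    under almost everywhere equality from [ip]. It is constant on each side of $[0,1]$. *)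
Definition prim g (x : R) : R := ip g (below x).

Lemma primS a f g x : L2 f -> L2 g ->
  prim (fun y => a * f y + g y) x = a * prim f x + prim g x.
Proof. by move=> lf lg; rewrite /prim ipSl//; exact: L2_below. Qed.

Lemma primB f g x : L2 f -> L2 g -> prim (f \- g) x = prim f x - prim g x.
Proof. by move=> lf lg; rewrite /prim ipBl//; exact: L2_below. Qed.

Lemma prim_eqae f g x : eqae f g -> prim f x = prim g x.
Proof. exact: ip_eqae. Qed.

Lemma prim_le0 g x : x <= 0 -> prim g x = 0.
Proof.
move=> x0; rewrite /prim (@eq_ip _ g g _ (fun=> 0)) ?ip0r//.
move=> s; rewrite I01_itv => /andP[s0 _].
by rewrite /below ltNge (ltW (le_lt_trans x0 s0)).
Qed.

Lemma prim_ge1 g x : 1 <= x -> prim g x = ip g (fun=> 1).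
Proof.
move=> x1; apply: eq_ip => // s; rewrite I01_itv => /andP[_ s1].
by rewrite /below (lt_le_trans s1 x1).
Qed.

Lemma ip1_below (x : R) : 0 <= x <= 1 -> ip (fun=> 1) (below x) = x.
Proof.
move=> /andP[x0 x1].
have -> : ip (fun=> 1) (below x) = \int[mu]_(s in I01 `&` `]-oo, x[) (1 : R).
  rewrite Rintegral_mkcondr; apply: eq_Rintegral => s _.
  rewrite mul1r patchE /below; have [sx|xs] := ltP s x.
    by rewrite mem_set//= in_itv.
  by rewrite memNset//= in_itv/= ltNge xs.
have -> : I01 `&` `]-oo, x[ = `]0, x[%classic.
  apply/seteqP; split => s; rewrite /I01 /= !in_itv/=.
    by move=> [/andP[-> _] ->].
  by move=> /andP[s0 sx]; rewrite s0 sx (lt_le_trans sx).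
rewrite Rintegral_cst//.
rewrite mul1r [X in fine X](lebesgue_measure_itv `]0, x[)/= lte_fin.
case: ifPn => [_|]; first by rewrite /= oppr0 addr0.
by rewrite -leNgt => xle; apply/eqP; rewrite /= eq_le x0 xle.
Qed.

(** [below x \- below x'] is the indicator of $[x',x)$ and has integral $x-x'$, so the left side is
    the integral of $g-m$ over that interval. With $m$ a value of [g] this yields derivatives of
    primitives. *)
Lemma prim_increment g (m eta x x' : R) : L2 g -> 0 <= x' <= x -> x <= 1 ->
  (forall s, 0 < s < 1 -> x' <= s < x -> `|g s - m| <= eta) ->
  `|prim g x - prim g x' - m * (x - x')| <= eta * (x - x').
Proof.
move=> lg /andP[x'0 x'x] x1 gm.
have lx := L2_below x; have lx' := L2_below x'.
have lD : L2 (below x \- below x') by exact: L2B.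
have l1 : L2 (fun=> 1 : R) by exact: L2_cst.
have iD : ip (fun=> 1) (below x \- below x') = x - x'.
  by rewrite ipBr// !ip1_below ?x'0 ?x1 ?(le_trans x'x)// (le_trans x'0).
have lgm : L2 (fun s => -m * 1 + g s) by exact: L2S.
have -> : prim g x - prim g x' - m * (x - x') =
    ip (fun s => - m * 1 + g s) (below x \- below x').
  by rewrite ipSl// iD ipBr// mulNr addrC.
rewrite -iD -ipZl//.
apply: le_trans (le_normr_Rintegral measurable_I01 (integrable_L2M lgm lD)) _.
apply: le_Rintegral => //.
- by have := integrable_norm (integrable_L2M lgm lD); apply: eq_integrable.
- exact: (integrable_L2M (L2Z eta l1) lD).
move=> s; rewrite I01_itv => s01 /=; rewrite normrM mulr1 mulr1 addrC /below.
have [sx|xs] := ltP s x; have [sx'|x's] := ltP s x'; rewrite ?subrr ?normr0 ?mulr0//.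
- by rewrite subr0 normr1 !mulr1; apply: gm; rewrite ?x's.
- by have := lt_le_trans sx' x'x; rewrite ltNge xs.
Qed.

Lemma below_sub_sqr (x x' : R) : 0 <= x' <= x -> x <= 1 ->
  normL2 (below x \- below x') ^+ 2 = x - x'.
Proof.
move=> /andP[x'0 x'x] x1; have lx := L2_below x; have lx' := L2_below x'.
rewrite normL2_sqr; last exact: L2B.
have -> : ip (below x \- below x') (below x \- below x') =
    ip (fun=> 1) (below x \- below x').
  apply: eq_Rintegral => s _ /=; rewrite /below.
  have [sx|xs] := ltP s x; have [sx'|x's] := ltP s x'.
  - by rewrite subrr !mulr0.
  - by rewrite subr0 !mulr1.
  - by have := lt_le_trans sx' x'x; rewrite ltNge xs.
  - by rewrite subrr !mulr0.
have l1 : L2 (fun=> 1 : R) by exact: L2_cst.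
rewrite ipBr// !ip1_below ?x'0 ?x1 ?(le_trans x'x)//.
by rewrite (le_trans x'0).
Qed.

Lemma normL2_below (x : R) : normL2 (below x) <= 1.
Proof.
rewrite -(@expr_le1 _ 2) ?normL2_ge0// normL2_sqr; last exact: L2_below.
rewrite -[leRHS](@ip1_below 1) ?ler01 ?lexx//.
have l1 : L2 (fun=> 1 : R) by exact: L2_cst.
have lx := L2_below x; have ly := L2_below 1.
apply: le_Rintegral => //; [exact: integrable_L2M|exact: integrable_L2M|].
move=> s; rewrite I01_itv /below => /andP[_ ->]; rewrite mulr1.
by case: (s < x); rewrite ?mulr1 ?mulr0 ?ler01.
Qed.

Lemma prim_bound g x : L2 g -> `|prim g x| <= normL2 g.
Proof.
move=> lg; apply: le_trans (ip_CS lg (L2_below x)) _.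
by rewrite ler_piMr ?normL2_ge0 ?normL2_below.
Qed.

(** Cauchy-Schwarz with the indicator of $[x',x)$, whose norm is $\sqrt{x-x'}$. *)
Lemma prim_holder g (x x' : R) : L2 g -> 0 <= x' <= x -> x <= 1 ->
  `|prim g x - prim g x'| <= normL2 g * Num.sqrt (x - x').
Proof.
move=> lg x'x x1.
rewrite /prim -ipBr//; [|exact: L2_below|exact: L2_below].
apply: le_trans (ip_CS lg (L2B (L2_below x) (L2_below x'))) _.
by rewrite -(below_sub_sqr x'x x1) sqrtr_sqr ger0_norm ?normL2_ge0.
Qed.

(** Moving both points to the nearest point of $[0,1]$ leaves the primitive unchanged and does not
    increase their distance. *)
Lemma prim_holderT g (x x' : R) : L2 g ->
  `|prim g x - prim g x'| <= normL2 g * Num.sqrt `|x - x'|.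
Proof.
move=> lg; wlog x'x : x x' / x' <= x.
  move=> H; have [|/ltW] := leP x' x; first exact: H.
  by move=> /H; rewrite distrC (distrC x').
have nn : 0 <= normL2 g * Num.sqrt `|x - x'| by rewrite mulr_ge0 ?sqrtr_ge0 ?normL2_ge0.
have [x0|x0] := leP x 0.
  by rewrite !prim_le0 ?subrr ?normr0// (le_trans x'x).
have [x'1|x'1] := leP 1 x'.
  by rewrite !prim_ge1 ?subrr ?normr0// (le_trans x'1).
have [b [pb b1 b2 b3]] : exists b, [/\ prim g x = prim g b, 0 < b <= 1, b <= x & x' <= b].
  have [x1|x1] := leP x 1; first by exists x; rewrite x0 x1 lexx.
  by exists 1; rewrite !prim_ge1 ?ltr01 ?lexx ?ltW.
have [a [pa a1 a2]] : exists a, [/\ prim g x' = prim g a, 0 <= a <= b & x' <= a].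
  have [x'0|x'0] := leP 0 x'; first by exists x'; rewrite x'0 b3 lexx.
  by exists 0; have /andP[/ltW-> _] := b1; rewrite !prim_le0 ?lexx ?ltW.
have /andP[_ b1'] := b1; have /andP[_ ab] := a1.
rewrite pb pa; apply: le_trans (prim_holder lg a1 b1') _.
apply: ler_wpM2l; first exact: normL2_ge0.
apply: ler_wsqrtr; rewrite ger0_norm ?subr_ge0//.
exact: lerB.
Qed.

Lemma continuous_prim g : L2 g -> continuous (prim g).
Proof.
move=> lg x; apply/cvgrPdist_le => e e0.
have g1 : 0 < normL2 g + 1 by rewrite ltr_wpDl ?normL2_ge0.
have d0 : 0 < e / (normL2 g + 1) by rewrite divr_gt0.
have d2 : 0 < (e / (normL2 g + 1)) ^+ 2 by rewrite exprn_gt0.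
near=> y; apply: le_trans (prim_holderT _ _ lg) _.
have xy : `|x - y| <= (e / (normL2 g + 1)) ^+ 2.
  by near: y; apply/nbhs_ballP; eexists; [exact: d2|move=> y /ltW].
have := ler_wsqrtr xy; rewrite sqrtr_sqr [X in _ <= X]ger0_norm ?(ltW d0)// => sxy.
apply: le_trans (ler_wpM2l (normL2_ge0 g) sxy) _.
by rewrite mulrCA ler_piMr ?(ltW e0)// ler_pdivrMr// mul1r lerDl.
Unshelve. all: end_near.
Qed.

Lemma L2_prim g : L2 g -> L2 (prim g).
Proof.
by move=> lg; apply: L2_continuous; exact/continuous_subspaceT/continuous_prim.
Qed.

Lemma normL2_le_sup f (C : R) : L2 f -> 0 <= C -> (forall x, I01 x -> `|f x| <= C) ->
  normL2 f <= C.
Proof.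
move=> lf C0 fC; rewrite -ler_sqr ?nnegrE ?normL2_ge0// normL2_sqr//.
have lC := @L2_cst R C.
have -> : C ^+ 2 = ip (fun=> C) (fun=> C).
  by rewrite /ip Rintegral_cst// [X in fine X]mu_I01/= mulr1 expr2.
apply: le_Rintegral => //; [exact: integrable_L2M|exact: integrable_L2M|].
move=> x Ix; rewrite -!expr2 -[f x ^+ 2]real_normK ?num_real//.
by rewrite lerXn2r ?nnegrE ?fC.
Qed.

Lemma normL2_prim g : L2 g -> normL2 (prim g) <= normL2 g.
Proof.
move=> lg; apply: normL2_le_sup => //; first exact: L2_prim.
by move=> x _; exact: prim_bound.
Qed.

Lemma is_derive_prim g (x : R) : L2 g -> 0 < x < 1 -> {for x, continuous g} ->
  is_derive x 1 (prim g) (g x).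
Proof.
move=> lg /andP[x0 x1] gx; apply: is_derive_quotient.
apply/cvgrPdist_le => e e0.
have /cvgrPdist_le/(_ _ e0)/nbhs_ballP[d /= d0 gd] := gx.
near=> h.
have hn0 : h != 0 by near: h; exact: nbhs_dnbhs_neq.
have hd : `|h| < d.
  near: h; apply: dnbhs0_lt => //.
have h1 : `|h| < Num.min x (1 - x).
  near: h; apply: dnbhs0_lt; by rewrite lt_min x0 subr_gt0.
have {h1}/andP[h1 h2] : (`|h| < x) && (`|h| < 1 - x) by rewrite -lt_min.
have gs s : `|s - x| <= `|h| -> `|g s - g x| <= e.
  by move=> sx; rewrite distrC; apply: gd; rewrite /ball /= distrC; exact: le_lt_trans hd.
rewrite distrC -(@ler_pM2l _ `|h|) ?normr_gt0// -normrM mulrBr mulrA divff// mul1r.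
have [h0|h0] := ltP 0 h.
  have := @prim_increment g (g x) e (h + x) x lg.
  rewrite addrK mulrC (mulrC `|h|) (gtr0_norm h0); apply.
  - by rewrite lerDr !ltW.
  - by move: h2; rewrite gtr0_norm//; lra.
  - move=> s _ /andP[xs sh]; apply: gs; rewrite ger0_norm ?subr_ge0// gtr0_norm//; lra.
have {}h0 : h < 0 by rewrite lt_neqAle hn0.
have := @prim_increment g (g x) e x (h + x) lg.
rewrite opprD addrA addrAC subrr sub0r mulrN opprK (ltr0_norm h0) mulrC.
have -> : prim g (h + x) - prim g x - h * g x =
    - (prim g x - prim g (h + x) + h * g x) by ring.
rewrite normrN (mulrC (- h)); apply.
- by apply/andP; split; move: h1; rewrite ltr0_norm//; lra.
- exact: ltW.
- move=> s _ /andP[xs sh]; apply: gs; rewrite ltr0_norm ?subr_lt0// ltr0_norm//; lra.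
Unshelve. all: end_near.
Qed.

End primitive.

(** * Density of a countable family of bumps in $L^2(0,1)$ *)

Section density.
Context {R : realType}.
Notation mu := (@lebesgue_measure R).
Implicit Types f g h : R -> R.

Lemma closure_support (phi : R -> R) (a c : R) :
  (forall x, ~~ (a <= x <= c) -> phi x = 0) ->
  closure [set x | phi x != 0] `<=` `[a, c].
Proof.
move=> phi0; have -> : `[a, c]%classic = closure `[a, c].
  by apply/closure_id; exact: itv_closed.
apply: closure_subset => x /= phix; rewrite in_itv/=.
by apply: contraNT phix => /phi0 ->.
Qed.

Lemma test_fun_itv (phi : R -> R) (a c : R) : smooth phi -> 0 < a -> c < 1 ->
  (forall x, ~~ (a <= x <= c) -> phi x = 0) -> test_fun I01 phi.
Proof.
move=> sphi a0 c1 phi0; have sub := closure_support phi0; split => //.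
  apply: subclosed_compact sub; first exact: closed_closure.
  exact: segment_compact.
move=> x /sub /=; rewrite in_itv/= I01_itv => /andP[ax xc].
by rewrite (lt_le_trans a0 ax) (le_lt_trans xc c1).
Qed.

Lemma test_bump (l a c : R) : 0 < l -> 0 < a -> c < 1 -> test_fun I01 (bump l a c).
Proof.
move=> l0 a0 c1; apply: (@test_fun_itv _ a c) => //; first exact: smooth_bump.
move=> x axc; apply: bump_eq0; by apply: contra axc => /andP[/ltW -> /ltW ->].
Qed.

Lemma test_fun_out (phi : R -> R) x : test_fun I01 phi -> ~~ (0 < x < 1) ->
  phi x = 0.
Proof.
move=> [_ _ sub] x01; apply: contraNeq x01 => phix.
by rewrite -I01_itv; apply: sub; exact: subset_closure.
Qed.

Lemma L2_smooth (phi : R -> R) : smooth phi -> L2 phi.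
Proof.
move=> sphi; apply: L2_continuous; apply: continuous_subspaceT.
exact: smooth_continuous.
Qed.

Lemma L2_test (phi : R -> R) : test_fun I01 phi -> L2 phi.
Proof. by case=> sphi _ _; exact: L2_smooth. Qed.

Lemma L2_test_derive (phi : R -> R) : test_fun I01 phi -> L2 ('D_1 phi).
Proof. by case=> sphi _ _; apply/L2_smooth/smooth_derive. Qed.

Lemma L2_indic (A : set (measurableTypeR R)) : measurable A -> L2 (\1_A : R -> R).
Proof.
move=> mA; apply: (@L2_bounded _ _ 1); first exact: measurable_indic.
by move=> x _; rewrite indicE; case: (_ \in _); rewrite ?normr1 ?normr0.
Qed.

(** Dominated convergence for the squared error, with $(2h)^2$ as dominating function. *)
Lemma L2_dominated_cvg (g : nat -> R -> R) f h : L2 h -> L2 f ->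
  (forall n, L2 (g n)) -> (forall n x, I01 x -> `|g n x| <= h x) ->
  (forall x, I01 x -> g n x @[n --> \oo] --> f x) ->
  forall e, 0 < e -> exists n, normL2 (f \- g n) < e.
Proof.
move=> lh lf lg gh gf e e0.
have lfg n : L2 (f \- g n) by exact: L2B.
have fh x : I01 x -> `|f x| <= h x.
  move=> Ix; have /cvg_norm := gf x Ix => gfx.
  rewrite -(cvg_lim _ gfx)//; apply: limr_le; first by apply/cvg_ex; eexists; exact: gfx.
  by near=> n; exact: gh.
have [||||| _ _] := @dominated_convergence _ _ _ mu I01 measurable_I01
  (fun n x => ((f \- g n) x * (f \- g n) x)%:E) (cst 0%E)
  (fun x => ((2 * h x) * (2 * h x))%:E).
- by move=> n; have /integrableP[] := integrable_L2M (lfg n) (lfg n).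
- exact: measurable_cst.
- apply: aeW => x Ix; apply: cvg_EFin; first exact: nearW.
  rewrite -[X in _ --> X](mulr0 0).
  have d0 : (f \- g n) x @[n --> \oo] --> (0 : R).
    by rewrite -(subrr (f x)); apply: cvgB; [exact: cvg_cst|exact: gf].
  exact: cvgM.
- exact: (integrable_L2M (L2Z 2 lh) (L2Z 2 lh)).
- apply: aeW => x n Ix; rewrite lee_fin normrM.
  have fg2 : `|(f \- g n) x| <= 2 * h x.
    by rewrite mulr2n mulrDl mul1r; apply: le_trans (ler_normB _ _) (lerD (fh _ Ix) (gh _ _ Ix)).
  by apply: ler_pM.
rewrite integral0 => /fine_cvg /cvgrPdist_lt /(_ (e ^+ 2)).
rewrite exprn_gt0// => /(_ isT)[n _ /(_ n (leqnn _))] /=.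
rewrite sub0r normrN => H; exists n.
rewrite -(@ltr_pXn2r _ 2) ?nnegrE ?normL2_ge0 ?(ltW e0)// normL2_sqr//.
exact: le_lt_trans (ler_norm _) H.
Unshelve. all: end_near.
Qed.

(* Rational intervals and [1 / n]-bumps: a countable family of test functions
   whose pointwise limits contain the indicators of intervals. *)
Definition cbump (q r : rat) (n : nat) : R -> R :=
  bump n.+1%:R^-1 (ratr q) (ratr r).

Lemma test_cbump q r n : 0 < ratr q :> R -> ratr r < 1 :> R ->
  test_fun I01 (cbump q r n).
Proof. by move=> q0 r1; apply: test_bump => //; rewrite invr_gt0 ltr0n. Qed.

(** The left ends decrease towards $x$ from above and the right ends tend to 1 from below, so that
    supports stay inside $(0,1)$ while the steepness parameter tends to 0. *)
Lemma cbump_cvg (x : R) : 0 <= x < 1 -> exists q r : nat -> rat,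
  (forall n, 0 < ratr (q n) :> R /\ ratr (r n) < 1 :> R) /\
  forall s, 0 < s < 1 ->
    cbump (q n) (r n) n s @[n --> \oo] --> (\1_(`]x, +oo[ : set R) s : R).
Proof.
move=> /andP[x0 x1]; pose h (n : nat) : R := harmonic n.
have h0 n : 0 < h n by rewrite invr_gt0 ltr0n.
have H1 (n : nat) : exists z : rat, x < ratr z < x + h n.
  have : x < x + h n by rewrite ltrDl.
  by move=> /rat_in_itvoo[z]; rewrite in_itv => zP; exists z.
have [q qP] := boolp.choice H1.
have H2 (n : nat) : exists z : rat, 1 - h n < ratr z < (1 : R).
  have : 1 - h n < 1 by rewrite gtrBl.
  by move=> /rat_in_itvoo[z]; rewrite in_itv => zP; exists z.
have [r rP] := boolp.choice H2.
exists q, r; split => [n|s /andP[s0 s1]].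
  by have /andP[qx _] := qP n; have /andP[_ ->] := rP n; rewrite (le_lt_trans x0 qx).
have [sx|xs] := leP s x.
  rewrite indicE memNset /=; last by rewrite in_itv/= andbT; apply/negP; rewrite -leNgt.
  rewrite [X in X @ _ --> _](_ : _ = fun=> 0); first exact: cvg_cst.
  apply/funext => n; apply: bump_eq0; rewrite negb_and -leNgt.
  by have /andP[qx _] := qP n; rewrite (le_trans sx (ltW qx)).
rewrite indicE mem_set /=; last by rewrite in_itv/= andbT.
have sx0 : 0 < (s - x) / 2 by rewrite divr_gt0// subr_gt0.
have s10 : 0 < (1 - s) / 2 by rewrite divr_gt0// subr_gt0.
(* Once [h n] is below half the distances from $s$ to $x$ and to 1, [K] bounds the sum of the
   inverse distances from $s$ to the two ends of the bump. *)
pose K := ((s - x) / 2)^-1 + ((1 - s) / 2)^-1.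
apply: (@squeeze_cvgr _ _ _ _ (fun n => expR (- (h n * K))) (fun=> 1)).
- near=> n.
  have l0 : 0 < h n by [].
  rewrite [leRHS]/= bump_le1 ?andbT//.
  have hx : h n < (s - x) / 2.
    by near: n; have /cvgr0Pnorm_lt/(_ _ sx0) := @cvg_harmonic R;
      apply: filterS => n; exact/le_lt_trans/ler_norm.
  have hs : h n < (1 - s) / 2.
    by near: n; have /cvgr0Pnorm_lt/(_ _ s10) := @cvg_harmonic R;
      apply: filterS => n; exact/le_lt_trans/ler_norm.
  have /andP[_ q2] := qP n; have /andP[r1 _] := rP n.
  have sq : (s - x) / 2 <= s - ratr (q n) by lra.
  have sr : (1 - s) / 2 <= ratr (r n) - s by lra.
  have sq0 := lt_le_trans sx0 sq; have sr0 := lt_le_trans s10 sr.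
  rewrite /cbump /bump /flat sq0 sr0 -expRD ler_expR -opprD lerN2 -mulrDr.
  by rewrite ler_wpM2l ?(ltW l0)// lerD// lef_pV2.
- rewrite -[X in _ --> X](@expR0 R) -[X in expR X]oppr0 -[X in - X](mul0r K).
  apply: continuous_cvg; first exact: continuous_expR.
  by apply: cvgN; apply: cvgMl; exact: cvg_harmonic.
- exact: cvg_cst.
Unshelve. all: end_near.
Qed.

Section closed_span.
Variable S : set (R -> R).
Hypothesis S_lin : forall a f g, S f -> S g -> S (fun y => a * f y + g y).
Hypothesis S_closed : forall f, L2 f ->
  (forall e, 0 < e -> exists g, [/\ S g, L2 g & normL2 (f \- g) < e]) -> S f.
Hypothesis S_bump : forall q r n, 0 < ratr q :> R -> ratr r < 1 :> R ->
  S (cbump q r n).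

Let S0 : S (fun=> 0).
Proof.
have Sb : S (cbump 1 0 0) by apply: S_bump; rewrite ?rmorph1 ?rmorph0.
by have := S_lin (-1) Sb Sb; congr S; apply/funext => y; ring.
Qed.

(** [normL2] does not see values outside the open interval, so closedness makes [S] insensitive to
    them. *)
Let S_eq f g : S g -> L2 g -> L2 f -> (forall x, I01 x -> f x = g x) -> S f.
Proof.
move=> Sg lg lf fg; apply: S_closed => // e e0; exists g; split => //.
rewrite (@eq_normL2 _ _ (fun=> 0)) ?normL2_0// => x Ix /=.
by rewrite fg// subrr.
Qed.

Let S_cvg (g : nat -> R -> R) f h : L2 h -> L2 f ->
  (forall n, L2 (g n)) -> (forall n x, I01 x -> `|g n x| <= h x) ->
  (forall x, I01 x -> g n x @[n --> \oo] --> f x) -> (forall n, S (g n)) -> S f.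
Proof.
move=> lh lf lg gh gf Sg; apply: S_closed => // e e0.
by have [n ne] := L2_dominated_cvg lh lf lg gh gf e0; exists (g n); split.
Qed.

Let S_ray (x : R) : S (\1_(`]x, +oo[ : set R)).
Proof.
have lr y : L2 (\1_(`]y, +oo[ : set R) : R -> R) by apply: L2_indic; exact: measurable_itv.
have S01 y : 0 <= y < 1 -> S (\1_(`]y, +oo[ : set R)).
  move=> y01; have [q [r [qr qrc]]] := cbump_cvg y01.
  apply: (@S_cvg (fun n => cbump (q n) (r n) n) _ (fun=> 1)) => //.
  - exact: L2_cst.
  - by move=> n; have [q0 r1] := qr n; apply: L2_test; exact: test_cbump.
  - move=> n s _; rewrite ger0_norm ?bump_ge0//.
    by apply: bump_le1; rewrite invr_gt0 ltr0n.
  - by move=> n; have [q0 r1] := qr n; exact: S_bump.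
have [x1|x1] := leP 1 x.
  apply: (S_eq S0) => //; first exact: L2_0.
  move=> s; rewrite I01_itv => /andP[_ s1]; rewrite indicE memNset//= in_itv/= andbT.
  by apply/negP; rewrite -leNgt (le_trans (ltW s1)).
have [x0|x0] := leP 0 x; first by apply: S01; rewrite x0 x1.
apply: (S_eq (S01 0 _)) => //; first by rewrite lexx ltr01.
move=> s; rewrite I01_itv => /andP[s0 _].
by rewrite !indicE !mem_set//= in_itv/= ?s0 ?(lt_trans x0 s0).
Qed.

Let S_indic (A : set (measurableTypeR R)) : measurable A -> S (\1_A).
Proof.
move: A; have mE := RGenOInfty.measurableE R.
have S1 : S (fun=> 1).
  apply: (S_eq (S_ray 0)); first by apply: L2_indic; exact: measurable_itv.
    exact: L2_cst.
  move=> s; rewrite I01_itv => /andP[s0 _].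
  by rewrite indicE mem_set//= in_itv/= s0.
suff H : forall A, <<s @RGenOInfty.G R >> A -> S (\1_A).
  by move=> A mA; apply: H; rewrite -[<<s _ >>]/(_.-sigma.-measurable) -mE.
(* The rays generate the Borel sets and are stable under intersection, the larger end being kept.
   Complements come from $1-1_A$, disjoint unions from partial sums by dominated convergence. *)
apply: (dynkin_induction (T := measurableTypeR R)).
- exact: mE.
- move=> _ _ [x ->] [y ->]; exists (Num.max x y); apply/seteqP; split=> z /=;
    rewrite !in_itv/= !andbT gt_max; by [move=> [-> ->]|move=> /andP[]].
- by rewrite indicT.
- by move=> _ [x ->]; exact: S_ray.
- move=> A mA SA; have := S_lin (-1) SA S1; congr S; apply/funext => x.
  rewrite !indicE in_setC; case: (x \in A); rewrite /= ?mulr1 ?mulr0; ring.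
move=> F mF tF SF.
pose g n : R -> R := \1_(\big[setU/set0]_(i < n) F i).
have mU n : measurable (\big[setU/set0]_(i < n) F i) by exact: bigsetU_measurable.
have mUU : measurable (\bigcup_k F k) by exact: bigcup_measurable.
apply: (@S_cvg g _ (fun=> 1)).
- exact: L2_cst.
- exact: L2_indic.
- by move=> n; exact: L2_indic.
- by move=> n x _; rewrite /g indicE; case: (_ \in _); rewrite ?normr1 ?normr0.
- move=> x _; rewrite indicE; have [[k _ Fk]|nF] := pselect ((\bigcup_k F k) x).
    rewrite mem_set; last by exists k.
    apply: cvg_near_cst; near=> n; rewrite /g indicE mem_set// -bigcup_mkord.
    by exists k => //=; near: n; exact: nbhs_infty_gt.
  rewrite memNset//; apply: cvg_near_cst; near=> n; rewrite /g indicE memNset//.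
  by rewrite -bigcup_mkord => -[k _ Fk]; apply: nF; exists k.
elim=> [|n IHn]; first by rewrite /g big_ord0 indic0.
have := S_lin 1 IHn (SF n); congr S; apply/funext => x.
rewrite /g big_ord_recr /= !indicE in_setU mul1r.
have [Fn|Fn] := boolP (x \in F n); last by rewrite orbF addr0.
rewrite orbT memNset ?add0r// -bigcup_mkord => -[k /= kn Fk].
have kn' : k = n by apply: tF => //; exists x; split => //; exact: set_mem.
by move: kn; rewrite /= kn' ltnn.
Unshelve. all: end_near.
Qed.

Import HBNNSimple.

Let S_nnsfun (s : {nnsfun measurableTypeR R >-> R}) : S s.
Proof.
have -> : s = (fun x => \sum_(y <- finmap.enum_fset (fset_set (range s)))
    (y * \1_(s @^-1` [set y]) x)) :> (R -> R).
  by apply/funext => x; rewrite [LHS](fimfunE s) fsbig_finite.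
elim: (finmap.enum_fset _) => [|y r IHr].
  by apply: eq_ind S0 _ _; apply/funext => x; rewrite big_nil.
have Sy : S (\1_(s @^-1` [set y])).
  by apply: S_indic; exact: measurable_funPTI.
have := S_lin y Sy IHr; congr S; apply/funext => x.
by rewrite big_cons.
Qed.

(** The induction principle for $L^2$ used throughout: limits of bumps give rays, Dynkin's theorem
    gives Borel sets, linearity gives simple functions, and these approximate nonnegative functions
    from below. *)
Lemma closed_span_L2 f : L2 f -> S f.
Proof.
move=> lf.
(* $f=(|f|+f)-|f|$ is a difference of nonnegative functions. *)
suff pos g : L2 g -> (forall x, 0 <= g x) -> S g.
  have labs : L2 (fun x => `|f x|).
    have /L2_sqint[mf f2] := lf; apply/L2_sqint; split.
      exact: measurableT_comp.
    apply: eq_integrable f2 => // x _ /=.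
    by rewrite real_normK ?num_real.
  have labsf : L2 (fun x => 1 * `|f x| + f x) by exact: L2S.
  have Sabs : S (fun x => `|f x|) by exact: pos.
  have Sabsf : S (fun x => 1 * `|f x| + f x).
    by apply: pos => // x; rewrite mul1r -lerBlDr sub0r -normrN ler_norm.
  by have := S_lin (-1) Sabs Sabsf; congr S; apply/funext => x; ring.
move=> lg g0; have [mg _] := (L2_sqint g).1 lg.
have mEg : measurable_fun (I01 : set (measurableTypeR R)) (EFin \o g).
  exact/measurable_EFinP.
pose s := nnsfun_approx measurable_I01 mEg.
have s_cvg x : I01 x -> s n x @[n --> \oo] --> g x.
  move=> Ix; have := @cvg_nnsfun_approx _ _ _ _ measurable_I01 _ mEg _ x Ix.
  by move=> /(_ (fun x _ => g0 x))/fine_cvg.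
have s_le n x : I01 x -> s n x <= g x.
  move=> Ix; rewrite -(cvg_lim _ (s_cvg x Ix))//.
  apply: nondecreasing_cvgn_le; last by apply/cvg_ex; exists (g x); exact: s_cvg.
  move=> m k mk; have := nd_nnsfun_approx measurable_I01 mEg mk.
  by move=> /lefP.
have s_abs n x : I01 x -> `|s n x| <= g x.
  by move=> Ix; rewrite ger0_norm// s_le.
have ms n : measurable_fun (I01 : set (measurableTypeR R)) (s n).
  by apply: measurable_funTS.
apply: (@S_cvg (fun n => s n : R -> R) g g) => //.
move=> n; apply/L2_sqint; have [_ g2] := (L2_sqint g).1 lg; split => //.
apply: (le_integrable measurable_I01) g2.
  by apply/measurable_EFinP; exact: measurable_funX.
move=> x Ix /=; rewrite lee_fin !normrX lerXn2r ?nnegrE//.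
by rewrite (le_trans (s_abs n x Ix))// ler_norm.
Qed.

End closed_span.

End density.

(** * Sobolev spaces on the interval *)

Section sobolev_interval.
Opaque L2 smooth.
Context {R : realType}.
Notation mu := (@lebesgue_measure R).
Implicit Types f g h b phi psi : R -> R.

Let one : R -> R := fun=> 1.
Let L2one : L2 one. Proof. exact: L2_cst. Qed.

(** $F$ minus the primitive of $h$ has zero derivative inside and is continuous up to the ends, so
    the mean value theorem makes it constant. *)
Lemma prim_FTC F h (x : R) : L2 h ->
  (forall y, 0 < y < 1 -> {for y, continuous h}) ->
  (forall y : R, 0 < y < 1 -> is_derive y 1 F (h y)) ->
  {within cI01, continuous F} -> 0 <= x <= 1 -> F x = F 0 + prim h x.
Proof.
move=> lh hc dF Fc /andP[x0 x1].
move: x0; rewrite le_eqVlt => /predU1P[<-|x0]; first by rewrite prim_le0 ?addr0.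
have sub : `[0, x] `<=` @cI01 R.
  by move=> y /=; rewrite in_itv/= cI01_itv => /andP[-> /le_trans->].
have dG (y : R) : y \in `]0, x[ -> is_derive y 1 (F \- prim h) ((fun=> 0) y).
  rewrite in_itv/= => /andP[y0 yx].
  have y01 : 0 < y < 1 by rewrite y0 (lt_le_trans yx).
  have d1 := dF y y01; have d2 := is_derive_prim lh y01 (hc y y01).
  by have := is_deriveB d1 d2; rewrite subrr.
have [|c _] := MVT x0 dG.
  move=> y; apply: cvgB; first exact: (continuous_subspaceW sub Fc).
  by apply: continuous_subspaceT; exact: continuous_prim.
by rewrite mul0r /= (prim_le0 h (lexx 0)) subr0 => /eqP; rewrite subr_eq0 subr_eq => /eqP.
Qed.

Lemma prim_mulE f g (x : R) : smooth f -> smooth g -> 0 <= x <= 1 ->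
  prim (fun y => f y * prim g y + prim f y * g y) x = prim f x * prim g x.
Proof.
move=> sf sg x01; have lf := L2_smooth sf; have lg := L2_smooth sg.
have cf := smooth_continuous sf; have cg := smooth_continuous sg.
have cp := continuous_prim lf; have cq := continuous_prim lg.
have ch : continuous (fun y => f y * prim g y + prim f y * g y).
  move=> y; apply: cvgD; apply: cvgM; [exact: cf|exact: cq|exact: cp|exact: cg].
have lh := L2_continuous (continuous_subspaceT ch).
rewrite [RHS](@prim_FTC (fun y => prim f y * prim g y) _ x lh)//.
- by rewrite (prim_le0 f (lexx 0)) mul0r add0r.
- by move=> y _; exact: ch.
- move=> y y01; have d1 := is_derive_prim lf y01 (cf y).
  have d2 := is_derive_prim lg y01 (cg y).
  apply: is_derive_eq (is_deriveM d1 d2) _.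
  by rewrite -[LHS]/(_ * _ + _ * _) addrC mulrC.
- apply: continuous_subspaceT => y; apply: cvgM; [exact: cp|exact: cq].
Qed.

(** The product rule for the two primitives, integrated over $[0,1]$. Both vanish at 0, so only the
    boundary term at 1 remains. *)
Lemma ip_prim_smooth f g : smooth f -> smooth g ->
  ip f (prim g) + ip (prim f) g = ip f one * ip g one.
Proof.
move=> sf sg; have lf := L2_smooth sf; have lg := L2_smooth sg.
have l1 := integrable_L2M lf (L2_prim lg).
have l2 := integrable_L2M (L2_prim lf) lg.
have := @prim_mulE f g 1 sf sg; rewrite ler01 lexx => /(_ isT).
rewrite !prim_ge1// => <-.
rewrite /ip -RintegralD//; apply: eq_Rintegral => y _.
by rewrite mulr1.
Qed.

Lemma L2_le_eps (c d : R) : (forall e, 0 < e -> `|c - d| <= e) -> c = d.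
Proof.
move=> H; apply/eqP; rewrite -subr_eq0 -normr_le0.
by apply/ler_addgt0Pl => e e0; rewrite addr0; exact: H.
Qed.

(** The usual way density is exploited: the set where two bounded linear functionals agree is a
    closed subspace, to which [closed_span_L2] applies. *)
Lemma closed_span_eq (A B : (R -> R) -> R) (K : R) :
  (forall a f g, L2 f -> L2 g -> A (fun y => a * f y + g y) = a * A f + A g) ->
  (forall a f g, L2 f -> L2 g -> B (fun y => a * f y + g y) = a * B f + B g) ->
  0 <= K -> (forall f, L2 f -> `|A f| <= K * normL2 f) ->
  (forall f, L2 f -> `|B f| <= K * normL2 f) ->
  (forall q r n, 0 < ratr q :> R -> ratr r < 1 :> R ->
    A (cbump q r n) = B (cbump q r n)) ->
  forall f, L2 f -> A f = B f.
Proof.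
move=> Al Bl K0 AK BK AB f lf.
suff [] : (fun f => L2 f /\ A f = B f) f by [].
have subl (X : (R -> R) -> R) f1 g1 :
    (forall a f g, L2 f -> L2 g -> X (fun y => a * f y + g y) = a * X f + X g) ->
    L2 f1 -> L2 g1 -> X f1 = X (f1 \- g1) + X g1.
  move=> Xl lf1 lg1; have := Xl 1 (f1 \- g1) g1 (L2B lf1 lg1) lg1.
  rewrite mul1r => <-; congr X; apply/funext => y /=; ring.
move: lf; apply: (@closed_span_L2 _ (fun f => L2 f /\ A f = B f)) => {f}.
- by move=> a f1 g1 [l1 e1] [l2 e2]; split; [exact: L2S|rewrite Al// Bl// e1 e2].
- move=> f1 lf1 H; split => //; apply: L2_le_eps => e e0.
  have K1 : 0 < 2 * K + 1 by rewrite ltr_wpDl// mulr_ge0.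
  have [g [[lg eg] _ fg]] := H _ (divr_gt0 e0 K1).
  have lfg := L2B lf1 lg.
  rewrite (subl A f1 g)// (subl B f1 g)// eg opprD addrACA subrr addr0.
  apply: le_trans (ler_normB _ _) _.
  apply: le_trans (lerD (AK _ lfg) (BK _ lfg)) _.
  rewrite -mulrDl -mulr2n -mulr_natl.
  apply: le_trans (ler_wpM2r (normL2_ge0 _) (_ : 2 * K <= 2 * K + 1)) _.
    by rewrite lerDl.
  by rewrite mulrC -ler_pdivlMr// ltW.
- move=> q r n q0 r1; split; last exact: AB.
  by apply: L2_test; exact: test_cbump.
Qed.

Lemma smooth_cbump q r n : smooth (@cbump R q r n).
Proof. by apply: smooth_bump; rewrite invr_gt0 ltr0n. Qed.

Lemma normL2_one : normL2 one = 1.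
Proof.
rewrite normL2E// /ip /one; under eq_Rintegral do rewrite mulr1.
by rewrite Rintegral_cst// [X in fine X]mu_I01/= mulr1 sqrtr1.
Qed.

Opaque ip prim normL2.

Lemma ip_one_le f : L2 f -> `|ip f one| <= normL2 f.
Proof. by move=> lf; apply: le_trans (ip_CS lf L2one) _; rewrite normL2_one mulr1. Qed.

Lemma prim_linear a f g : L2 f -> L2 g ->
  prim (fun y => a * f y + g y) = (fun x => a * prim f x + prim g x).
Proof. by move=> lf lg; apply/funext => x; exact: primS. Qed.

(** Integration by parts for primitives. Both sides are bounded and bilinear, so the smooth case
    extends to all of $L^2$ in one argument and then in the other. *)
Lemma ip_prim f g : L2 f -> L2 g ->
  ip f (prim g) + ip (prim f) g = ip f one * ip g one.
Proof.
move=> + lg; move: f.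
have key h : smooth h -> forall f, L2 f ->
    ip f (prim h) + ip (prim f) h = ip f one * ip h one.
  move=> sh; have lh := L2_smooth sh; have lph := L2_prim lh.
  apply: (@closed_span_eq (fun f => ip f (prim h) + ip (prim f) h)
    (fun f => ip f one * ip h one) (2 * normL2 h)).
  - move=> a f1 g1 l1 l2; rewrite prim_linear// !ipSl//; [by rewrite mulrDr addrACA|exact: L2_prim|exact: L2_prim].
  - by move=> a f1 g1 l1 l2; rewrite ipSl// mulrDl mulrA.
  - by rewrite mulr_ge0 ?normL2_ge0.
  - move=> f lf; apply: le_trans (ler_normD _ _) _.
    have lpf := L2_prim lf.
    have := le_trans (ip_CS lf lph) (ler_wpM2l (normL2_ge0 f) (normL2_prim lh)).
    have := le_trans (ip_CS lpf lh) (ler_wpM2r (normL2_ge0 h) (normL2_prim lf)).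
    by move=> H1 H2; apply: le_trans (lerD H2 H1) _; rewrite mulrC; lra.
  - move=> f lf; rewrite normrM.
    apply: le_trans (ler_pM _ _ (ip_one_le lf) (ip_one_le lh)) _ => //.
    have := mulr_ge0 (normL2_ge0 f) (normL2_ge0 h); lra.
  - by move=> q r n q0 r1; apply: ip_prim_smooth; [exact: smooth_cbump|exact: sh].
move=> f lf; move: g lg; have lpf := L2_prim lf.
apply: (@closed_span_eq (fun g => ip f (prim g) + ip (prim f) g)
    (fun g => ip f one * ip g one) (2 * normL2 f)).
- move=> a f1 g1 l1 l2; rewrite prim_linear// !ipSr//; [by rewrite mulrDr addrACA|exact: L2_prim|exact: L2_prim].
- by move=> a f1 g1 l1 l2; rewrite ipSl// mulrDr mulrCA.
- by rewrite mulr_ge0 ?normL2_ge0.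
- move=> g lg; apply: le_trans (ler_normD _ _) _.
  have lpg := L2_prim lg.
  have := le_trans (ip_CS lf lpg) (ler_wpM2l (normL2_ge0 f) (normL2_prim lg)).
  have := le_trans (ip_CS lpf lg) (ler_wpM2r (normL2_ge0 g) (normL2_prim lf)).
  by move=> H1 H2; apply: le_trans (lerD H2 H1) _; lra.
- move=> g lg; rewrite normrM.
  apply: le_trans (ler_pM _ _ (ip_one_le lf) (ip_one_le lg)) _ => //.
  have := mulr_ge0 (normL2_ge0 f) (normL2_ge0 g); lra.
- by move=> q r n q0 r1; apply: key; [exact: smooth_cbump|exact: lf].
Qed.

End sobolev_interval.

(** * Mean-zero functions and their primitives *)

Section mean_zero.
Context {R : realType}.
Notation mu := (@lebesgue_measure R).
Implicit Types f g h b phi psi : R -> R.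
Opaque L2 smooth.

Let one : R -> R := fun=> 1.
Let L2one : L2 one. Proof. exact: L2_cst. Qed.

Definition theta0 : R -> R := bump 1 4^-1 (3 / 4).

Lemma smooth_theta0 : smooth theta0. Proof. exact: smooth_bump. Qed.

(** If the integral vanished, the primitive of the nonnegative [theta0] would be identically 0, and
    so would its derivative, which at $1/2$ is a positive value of [theta0]. *)
Lemma ip_theta0_gt0 : 0 < ip theta0 (fun=> 1).
Proof.
have lt := L2_smooth smooth_theta0.
have pt x : 0 <= prim theta0 x <= ip theta0 one.
  apply/andP; split.
    by apply: Rintegral_ge0 => s _; rewrite mulr_ge0 ?bump_ge0// /below; case: (_ < _).
  have lb := L2_below x; apply: le_Rintegral => //; [exact: integrable_L2M|exact: integrable_L2M|].
  move=> s _; rewrite ler_wpM2l ?bump_ge0// /below /one.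
  by case: (s < x); rewrite ?ler01.
rewrite lt_neqAle; apply/andP; split; last by apply: le_trans (proj1 (andP (pt 0))) (proj2 (andP (pt 0))).
apply/eqP => t0; have p0 : prim theta0 = fun=> 0.
  apply/funext => x; apply/eqP; rewrite eq_le.
  by have := pt x; rewrite -[ip theta0 one]/(ip theta0 (fun=> 1)) -t0 andbC.
have h01 : 0 < (2^-1 : R) < 1 by lra.
have ct : continuous theta0 by exact: smooth_continuous smooth_theta0.
have d1 := is_derive_prim lt h01 (ct _).
rewrite p0 in d1; have := @derive_val _ _ _ _ _ _ _ d1; rewrite derive_cst => e0.
have : 0 < theta0 2^-1 by apply: bump_gt0; lra.
by rewrite -e0 ltxx.
Qed.

Definition theta : R -> R := fun y => (ip theta0 (fun=> 1))^-1 * theta0 y.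

Lemma smooth_theta : smooth theta.
Proof.
have := smoothS (ip theta0 (fun=> 1))^-1 smooth_theta0 (smooth_cst 0).
by congr smooth; apply/funext => y; rewrite addr0.
Qed.

Lemma L2_theta : L2 theta. Proof. exact/L2_smooth/smooth_theta. Qed.

Lemma ip_theta : ip theta one = 1.
Proof.
rewrite ipZl//; last exact/L2_smooth/smooth_theta0.
by rewrite mulVf// gt_eqF// ip_theta0_gt0.
Qed.

Lemma theta_out y : ~~ (4^-1 <= y <= 3 / 4) -> theta y = 0.
Proof.
move=> H; rewrite /theta /theta0 bump_eq0 ?mulr0//.
by apply: contra H => /andP[/ltW -> /ltW ->].
Qed.

(* The mean of [b] is removed by a multiple of [theta]: the primitive of
   [corr b] vanishes at both ends of the interval. *)
Definition corr b : R -> R := fun y => - ip b (fun=> 1) * theta y + b y.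

Lemma L2_corr b : L2 b -> L2 (corr b).
Proof. by move=> lb; apply: L2S => //; exact: L2_theta. Qed.

Lemma ip_corr_one b : L2 b -> ip (corr b) one = 0.
Proof.
by move=> lb; rewrite ipSl// ?ip_theta ?mulr1 ?addNr//; exact: L2_theta.
Qed.

Lemma corr_linear a f g : L2 f -> L2 g ->
  corr (fun y => a * f y + g y) = fun y => a * corr f y + corr g y.
Proof. by move=> lf lg; apply/funext => y; rewrite /corr ipSl//; ring. Qed.

Lemma normL2_corr b : L2 b -> normL2 (corr b) <= (normL2 theta + 1) * normL2 b.
Proof.
move=> lb; have lt := L2_theta.
apply: le_trans (normL2D (L2Z _ lt) lb) _; rewrite normL2Z// normrN mulrDl mul1r.
by rewrite lerD2r mulrC ler_wpM2l ?normL2_ge0// ip_one_le.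
Qed.

Lemma corr_id b : ip b one = 0 -> corr b = b.
Proof.
by rewrite /corr => ->; apply/funext => y; rewrite oppr0 mul0r add0r.
Qed.

(** It turns bumps into test functions ([test_J_cbump]) and maps all of $L^2$ into $H^1_0$
    ([H10_J]). *)
Definition J b : R -> R := prim (corr b).

Lemma L2_J b : L2 b -> L2 (J b).
Proof. by move=> lb; exact/L2_prim/L2_corr. Qed.

Lemma J_linear a f g : L2 f -> L2 g ->
  J (fun y => a * f y + g y) = fun y => a * J f y + J g y.
Proof.
move=> lf lg; rewrite /J corr_linear// prim_linear//; exact: L2_corr.
Qed.

Lemma normL2_J b : L2 b -> normL2 (J b) <= (normL2 theta + 1) * normL2 b.
Proof.
by move=> lb; apply: le_trans (normL2_corr lb); exact/normL2_prim/L2_corr.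
Qed.

Lemma smooth_corr b : smooth b -> smooth (corr b).
Proof. by move=> sb; exact: smoothS smooth_theta sb. Qed.

Section primitive_of_test.
Variables (b : R -> R) (a c : R).
Hypotheses (sb : smooth b) (a0 : 0 < a) (c1 : c < 1).
Hypothesis b0 : forall y, ~~ (a <= y <= c) -> b y = 0.

(** The interval carrying [b] is enlarged so as to carry [theta] too. *)
Let a' := Num.min a 4^-1.
Let c' := Num.max c (3 / 4).

Let a'0 : 0 < a'.
Proof. by rewrite lt_min a0 invr_gt0 ltr0n. Qed.

Let c'1 : c' < 1.
Proof. by rewrite gt_max c1; lra. Qed.

Let corr0 y : ~~ (a' <= y <= c') -> corr b y = 0.
Proof.
move=> H; rewrite /corr theta_out ?b0 ?mulr0 ?addr0//; apply: contra H => /andP[ya yc].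
  by rewrite ge_min ya le_max yc.
by rewrite ge_min ya le_max yc !orbT.
Qed.

Let J0 y : ~~ (a' <= y <= c') -> J b y = 0.
Proof.
have lb := L2_smooth sb; rewrite negb_and -!ltNge => /orP[ya|yc].
  rewrite /J /prim (_ : ip _ _ = ip (fun=> 0) one); first exact: ip0l.
  apply: eq_Rintegral => s _; rewrite mul0r /below.
  have [sy|_] := ltP s y; last by rewrite mulr0.
  by rewrite corr0 ?mul0r// negb_and -ltNge (lt_trans sy ya).
rewrite -(ip_corr_one lb); apply: eq_Rintegral => s _; rewrite /below.
have [sy|ys] := ltP s y; first by rewrite mulr1.
by rewrite corr0 ?mul0r// negb_and -!ltNge (lt_le_trans yc ys) orbT.
Qed.

Lemma is_derive_J (x : R) : is_derive x 1 (J b) (corr b x).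
Proof.
have lb := L2_smooth sb; have sc := smooth_corr sb.
have [x01|] := boolP (0 < x < 1).
  apply: is_derive_prim => //; first exact: L2_corr.
  exact: smooth_continuous.
(* [is_derive_prim] covers the open interval only; elsewhere the point lies outside $[a',c']$, and
   [J b] vanishes near it. *)
rewrite negb_and -!leNgt => x01.
have x01' : (x < a') || (c' < x).
  by case/orP: x01 => h; apply/orP; [left|right]; [exact: le_lt_trans h _|exact: lt_le_trans h].
rewrite corr0; last by rewrite negb_and -!ltNge.
have d0 : is_derive x (1 : R) (fun=> 0 : R) 0 by exact: is_derive_cst.
apply: near_eq_is_derive d0; case/orP: x01' => h; near=> y;
  rewrite J0// negb_and -!ltNge; apply/orP; [left|right]; near: y.
  exact: lt_nbhsl.
exact: lt_nbhsr.
Unshelve. all: end_near.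
Qed.

Lemma test_J : test_fun I01 (J b).
Proof.
apply: (test_fun_itv _ a'0 c'1 J0).
exact: smooth_primitive (smooth_corr sb) is_derive_J.
Qed.

End primitive_of_test.

Lemma cbump_out q r n y : ~~ (ratr q <= y <= ratr r) -> @cbump R q r n y = 0.
Proof.
by move=> H; apply: bump_eq0; apply: contra H => /andP[/ltW -> /ltW ->].
Qed.

Lemma test_J_cbump q r n : 0 < ratr q :> R -> ratr r < 1 :> R ->
  test_fun I01 (J (cbump q r n)).
Proof.
move=> q0 r1; apply: test_J q0 r1 _; first exact: smooth_cbump.
by move=> y; exact: cbump_out.
Qed.

Lemma derive_J_cbump q r n : 0 < ratr q :> R -> ratr r < 1 :> R ->
  'D_1 (J (cbump q r n)) = corr (cbump q r n).
Proof.
move=> q0 r1; apply/funext => x.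
have d1 : is_derive x (1:R) (J (cbump q r n)) (corr (cbump q r n) x).
  by apply: is_derive_J q0 r1 _ _; [exact: smooth_cbump|move=> y; exact: cbump_out].
exact: derive_val.
Qed.

End mean_zero.

(** * Weak derivatives and the spaces $H^1$ and $H^1_0$ *)

Section weak_derivative.
Context {R : realType}.
Notation mu := (@lebesgue_measure R).
Implicit Types f g h b phi psi : R -> R.
Opaque L2 smooth ip prim normL2.

Let one : R -> R := fun=> 1.
Let L2one : L2 one. Proof. exact: L2_cst. Qed.

Let K : R := normL2 theta + 1.
Let K0 : 0 <= K. Proof. by rewrite addr_ge0 ?normL2_ge0. Qed.

Lemma prim0 x : prim (fun=> 0 : R) x = 0.
Proof. exact: ip0l. Qed.

Lemma normL2_0_of_sub f : normL2 (f \- f) = 0.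
Proof. by rewrite (@eq_normL2 _ _ (fun=> 0)) ?normL2_0// => x _ /=; rewrite subrr. Qed.

(* Countably many test functions suffice: this keeps exceptional null sets
   countable when [f] and [g] depend on a parameter. *)
Lemma wderiv_corr f g : L2 f -> L2 g ->
  (forall q r n, 0 < ratr q :> R -> ratr r < 1 :> R ->
    ip f ('D_1 (J (cbump q r n))) = - ip g (J (cbump q r n))) ->
  forall b, L2 b -> ip f (corr b) = - ip g (J b).
Proof.
move=> lf lg fg; have K1 : 0 <= (normL2 f + normL2 g) * K by rewrite mulr_ge0 ?addr_ge0 ?normL2_ge0.
apply: (@closed_span_eq _ (fun b => ip f (corr b)) (fun b => - ip g (J b)) _ _ _ K1).
- by move=> a b1 b2 l1 l2; rewrite corr_linear// ipSr//; exact: L2_corr.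
- move=> a b1 b2 l1 l2; rewrite J_linear// ipSr//; [by rewrite opprD mulrN|exact: L2_J|exact: L2_J].
- move=> b lb; apply: le_trans (ip_CS lf (L2_corr lb)) _; rewrite -mulrA.
  apply: ler_pM; rewrite ?normL2_ge0//; [by rewrite lerDl normL2_ge0|exact: normL2_corr].
- move=> b lb; rewrite normrN; apply: le_trans (ip_CS lg (L2_J lb)) _; rewrite -mulrA.
  apply: ler_pM; rewrite ?normL2_ge0//; [by rewrite lerDr normL2_ge0|exact: normL2_J].
- by move=> q r n q0 r1; rewrite -fg// derive_J_cbump.
Qed.

(** The du Bois-Reymond lemma. [wderiv_corr] is applied to the difference [b] between $f$ and the
    candidate itself, and integration by parts turns the result into $\langle b,b\rangle=0$. *)
Lemma wderiv_prim f g : L2 f -> L2 g ->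
  (forall q r n, 0 < ratr q :> R -> ratr r < 1 :> R ->
    ip f ('D_1 (J (cbump q r n))) = - ip g (J (cbump q r n))) ->
  exists c, eqae f (fun y => c * 1 + prim g y).
Proof.
move=> lf lg fg; have lt := @L2_theta R; have lpg := L2_prim lg; have lpt := L2_prim lt.
(* By [ip_prim] and $\int\theta=1$, this is $\langle f-\mathrm{prim}\,g,\theta\rangle$, the only
   possible value of a constant difference. *)
pose c := ip f theta - ip g one + ip g (prim theta); exists c.
set p := (fun y => c * 1 + prim g y).
have lp : L2 p by exact: L2S.
apply: eqae_subr0; apply: ip_self_eq0; first exact: L2B.
have lb : L2 (f \- p) by exact: L2B.
have lpb := L2_prim lb.
have := wderiv_corr lf lg fg lb; rewrite /J /corr prim_linear// !ipSr//.
have := ip_prim lg lb; set b := f \- p => ipb.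
rewrite -[ip b (fun=> 1)]/(ip b one); set B := ip b one.
have -> : ip b b = ip f b - ip p b by exact: ipBl.
rewrite /p ipSl// -[fun=> 1]/one (ipC one b) -/B.
have -> : ip g (prim b) = ip g one * B - ip (prim g) b by rewrite -ipb addrK.
rewrite /c => H.
have -> : ip f b = - (- B * ip g (prim theta) + (ip g one * B - ip (prim g) b)) + B * ip f theta.
  by rewrite -H addrAC mulNr addNr add0r.
set X1 := ip f theta; set X2 := ip g one; set X3 := ip g _; set X4 := ip _ b.
by move: B X1 X2 X3 X4 {H ipb} => B X1 X2 X3 X4; ring.
Qed.

Lemma is_wderiv_cbump f g : is_wderiv f g ->
  forall q r n, 0 < ratr q :> R -> ratr r < 1 :> R ->
    ip f ('D_1 (J (cbump q r n))) = - ip g (J (cbump q r n)).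
Proof. by move=> fg q r n q0 r1; apply: fg; exact: test_J_cbump. Qed.

Lemma prim_test phi (x : R) : test_fun I01 phi -> 0 <= x <= 1 ->
  prim ('D_1 phi) x = phi x.
Proof.
move=> tphi x01; have [sphi _ _] := tphi; have sd := smooth_derive (1 : R) sphi.
have := @prim_FTC _ phi ('D_1 phi) x (L2_smooth sd) _ _ _ x01.
have -> : phi 0 = 0 by apply: test_fun_out tphi _; rewrite ltxx.
rewrite add0r => H; apply/esym/H.
- by move=> y _; exact: (smooth_continuous sd).
- by move=> y _; exact: smooth_is_derive.
- by apply: continuous_subspaceT; exact: (smooth_continuous sphi).
Qed.

Lemma is_wderiv_prim g (c : R) : L2 g -> is_wderiv (fun y => c * 1 + prim g y) g.
Proof.
move=> lg phi tphi; have ld := L2_test_derive tphi; have lphi := L2_test tphi.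
have p1 : ip ('D_1 phi) one = 0.
  by rewrite -(prim_ge1 _ (lexx 1)) prim_test ?ler01 ?lexx// (test_fun_out tphi)// ltxx andbF.
have lpg := L2_prim lg.
rewrite ipSl// (ipC _ ('D_1 phi)) -[fun=> 1]/one p1 mulr0 add0r.
have := ip_prim lg ld; rewrite p1 mulr0.
have -> : ip g (prim ('D_1 phi)) = ip g phi.
  apply: eq_ip => // x; rewrite I01_itv => /andP[/ltW x0 /ltW x1].
  by rewrite prim_test// x0.
by move=> /eqP; rewrite addrC addr_eq0 => /eqP.
Qed.

Lemma is_wderiv_eqae f f' g g' : eqae f f' -> eqae g g' -> is_wderiv f g ->
  is_wderiv f' g'.
Proof.
by move=> ff gg fg phi tphi; rewrite -(ip_eqae _ ff) -(ip_eqae _ gg); exact: fg.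
Qed.

Lemma is_wderivS a f g f' g' : L2 f -> L2 g -> L2 f' -> L2 g' ->
  is_wderiv f f' -> is_wderiv g g' ->
  is_wderiv (fun y => a * f y + g y) (fun y => a * f' y + g' y).
Proof.
move=> lf lg lf' lg' ff gg phi tphi; have ld := L2_test_derive tphi.
have lp := L2_test tphi.
by rewrite !ipSl// ff// gg// opprD mulrN.
Qed.

Lemma L2_orth f : L2 f ->
  (forall q r n, 0 < ratr q :> R -> ratr r < 1 :> R -> ip f (cbump q r n) = 0) ->
  eqae f (fun=> 0).
Proof.
move=> lf f0; apply: ip_self_eq0 => //.
apply: (@closed_span_eq _ (fun b => ip f b) (fun=> 0) (normL2 f)) => //.
- by move=> a g h lg lh; rewrite ipSr.
- by move=> a g h lg lh; rewrite mulr0 addr0.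
- by move=> b lb; rewrite ip_CS.
- by move=> b lb; rewrite normr0 mulr_ge0 ?normL2_ge0.
Qed.

Lemma test_orth f : L2 f -> (forall phi, test_fun I01 phi -> ip f phi = 0) ->
  eqae f (fun=> 0).
Proof. by move=> lf H; apply: L2_orth => // q r n q0 r1; apply/H/test_cbump. Qed.

Lemma is_wderiv_unique f g g' : L2 g -> L2 g' -> is_wderiv f g -> is_wderiv f g' ->
  eqae g g'.
Proof.
move=> lg lg' fg fg'; apply/eqae_subr0/test_orth; first exact: L2B.
move=> phi tphi; rewrite ipBl//; last exact: L2_test.
by apply/eqP; rewrite subr_eq0 -eqr_opp -fg// -fg'.
Qed.

Lemma H1_L2 f : H1 f -> L2 f. Proof. by case. Qed.

Lemma H1_wderiv f : H1 f -> L2 (wderiv f) /\ is_wderiv f (wderiv f).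
Proof. by case=> _ [g fg]; rewrite /wderiv; case: xgetP => [h -> //|/(_ g)]. Qed.

Lemma H1I f g : L2 f -> L2 g -> is_wderiv f g -> H1 f /\ eqae (wderiv f) g.
Proof.
move=> lf lg fg; have h1 : H1 f by split => //; exists g.
by split => //; have [lw fw] := H1_wderiv h1; exact: is_wderiv_unique fw fg.
Qed.

(** The choice depends on $f$ only through its set of weak derivatives, which is the same for $f'$;
    hence a genuine equality. *)
Lemma wderiv_eqae f f' : eqae f f' -> wderiv f = wderiv f'.
Proof.
move=> ff; rewrite /wderiv; congr xget; apply/seteqP.
split=> g /= [lg fg]; split => //.
  exact: is_wderiv_eqae ff (eqae_refl _) fg.
exact: is_wderiv_eqae (eqae_sym ff) (eqae_refl _) fg.
Qed.

Lemma H1_eqae f f' : L2 f' -> eqae f f' -> H1 f -> H1 f'.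
Proof.
move=> lf' ff hf; have [lw fw] := H1_wderiv hf; split => //; exists (wderiv f).
by split => //; exact: is_wderiv_eqae ff (eqae_refl _) fw.
Qed.

Opaque wderiv H1.

Lemma H1S a f g : H1 f -> H1 g -> H1 (fun y => a * f y + g y) /\
  eqae (wderiv (fun y => a * f y + g y)) (fun y => a * wderiv f y + wderiv g y).
Proof.
move=> hf hg; have [lf' ff'] := H1_wderiv hf; have [lg' gg'] := H1_wderiv hg.
have lf := H1_L2 hf; have lg := H1_L2 hg.
by apply: H1I; [exact: L2S|exact: L2S|exact: is_wderivS].
Qed.

Lemma H1B f g : H1 f -> H1 g -> H1 (f \- g) /\
  eqae (wderiv (f \- g)) (wderiv f \- wderiv g).
Proof.
move=> hf hg; have [h1 h2] := H1S (-1) hg hf.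
have e (p q : R -> R) : (fun y => -1 * p y + q y) = q \- p.
  by apply/funext => y /=; rewrite mulN1r addrC.
by rewrite -!e.
Qed.

Lemma normH1_sqr f : normH1 f ^+ 2 = normL2 f ^+ 2 + normL2 (wderiv f) ^+ 2.
Proof. by rewrite sqr_sqrtr// addr_ge0 ?sqr_ge0. Qed.

Lemma normH1_ge0 f : 0 <= normH1 f. Proof. exact: sqrtr_ge0. Qed.

Lemma normL2_le_H1 f : normL2 f <= normH1 f.
Proof.
rewrite -(@ler_pXn2r _ 2) ?nnegrE ?normL2_ge0 ?normH1_ge0// normH1_sqr.
by rewrite lerDl sqr_ge0.
Qed.

Lemma normL2_wderiv_le_H1 f : normL2 (wderiv f) <= normH1 f.
Proof.
rewrite -(@ler_pXn2r _ 2) ?nnegrE ?normL2_ge0 ?normH1_ge0// normH1_sqr.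
by rewrite lerDr sqr_ge0.
Qed.

Lemma normH1_le f : normH1 f <= normL2 f + normL2 (wderiv f).
Proof.
rewrite -(@ler_pXn2r _ 2) ?nnegrE ?addr_ge0 ?normL2_ge0 ?normH1_ge0// normH1_sqr.
by rewrite sqrrD lerD2r lerDl mulrn_wge0// mulr_ge0 ?normL2_ge0.
Qed.

Lemma normH1_eqae f g : L2 f -> L2 g -> eqae f g -> normH1 f = normH1 g.
Proof. by move=> lf lg fg; rewrite /normH1 (normL2_eqae lf lg fg) (wderiv_eqae fg). Qed.

Opaque normH1.

Lemma normL2_wderivB f g : H1 f -> H1 g ->
  normL2 (wderiv f \- wderiv g) <= normH1 (f \- g).
Proof.
move=> hf hg; have [h1 h2] := H1B hf hg.
have [lf _] := H1_wderiv hf; have [lg _] := H1_wderiv hg; have [lfg _] := H1_wderiv h1.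
by rewrite -(normL2_eqae lfg (L2B lf lg) h2); exact: normL2_wderiv_le_H1.
Qed.

Lemma H1_test phi : test_fun I01 phi -> H1 phi /\ eqae (wderiv phi) ('D_1 phi).
Proof.
move=> tphi; have ld := L2_test_derive tphi; apply: H1I => //; first exact: L2_test.
apply: is_wderiv_eqae (is_wderiv_prim 0 ld); last exact: eqae_refl.
apply: aeW => x; rewrite I01_itv => /andP[/ltW x0 /ltW x1].
by rewrite mul0r add0r prim_test// x0.
Qed.

Lemma H10_H1 f : H10 f -> H1 f. Proof. by case. Qed.

Lemma H10_test phi : test_fun I01 phi -> H10 phi.
Proof.
move=> tphi; have [hp _] := H1_test tphi; split => // e e0; exists phi; split => //.
have lphi := H1_L2 hp.
rewrite (normH1_eqae (L2B lphi lphi) L2_0); last by apply: aeW => x _ /=; rewrite subrr.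
have l0 := @L2_0 R; have [h0 w0] : H1 (fun=> 0 : R) /\ eqae (wderiv (fun=> 0 : R)) (fun=> 0 : R).
  by apply: H1I => // p tp; rewrite !ip0l oppr0.
have [lw0 _] := H1_wderiv h0.
by apply: le_lt_trans (normH1_le _) _; rewrite (normL2_eqae lw0 l0 w0) normL2_0 addr0.
Qed.

(** The factor 2 comes from passing through the sum of the two $L^2$ norms. The inequality serves
    limits, where a constant is harmless. *)
Lemma normH1_triangle f g : H1 f -> H1 g ->
  normH1 (f \- g) <= 2 * (normH1 f + normH1 g).
Proof.
move=> hf hg; have [h1 h2] := H1B hf hg; have [lf _] := H1_wderiv hf.
have [lg _] := H1_wderiv hg; have [lfg _] := H1_wderiv h1.
apply: le_trans (normH1_le _) _; rewrite (normL2_eqae lfg (L2B lf lg) h2).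
apply: le_trans (lerD (normL2B (H1_L2 hf) (H1_L2 hg)) (normL2B lf lg)) _.
rewrite addrACA mulr_natl.
have le2 h : normL2 h + normL2 (wderiv h) <= normH1 h *+ 2.
  by rewrite mulr2n; exact: lerD (normL2_le_H1 h) (normL2_wderiv_le_H1 h).
by rewrite mulrnDl; exact: lerD.
Qed.

Lemma normH1C f g : H1 f -> H1 g -> normH1 (f \- g) = normH1 (g \- f).
Proof.
move=> hf hg; apply/eqP; rewrite -(@eqrXn2 _ 2) ?normH1_ge0//.
have [h1 e1] := H1B hf hg; have [h2 e2] := H1B hg hf.
have [lf _] := H1_wderiv hf; have [lg _] := H1_wderiv hg.
have [l1 _] := H1_wderiv h1; have [l2 _] := H1_wderiv h2.
rewrite !normH1_sqr (normL2C (H1_L2 hf) (H1_L2 hg)).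
rewrite (normL2_eqae l1 (L2B lf lg) e1) (normL2_eqae l2 (L2B lg lf) e2).
by rewrite (normL2C lf lg).
Qed.

Lemma H10_closed f : H1 f ->
  (forall e, 0 < e -> exists g, H10 g /\ normH1 (f \- g) < e) -> H10 f.
Proof.
move=> hf H; split => // e e0; have e4 : 0 < e / 4 by rewrite divr_gt0.
have [g [[hg gt] fg]] := H _ e4; have [phi [tphi gphi]] := gt _ e4.
exists phi; split => //; have [hphi _] := H1_test tphi.
have [h1 _] := H1B hf hg; have [h2 _] := H1B hphi hg.
have lg := H1_L2 hg; have lphi := H1_L2 hphi.
have -> : f \- phi = (f \- g) \- (phi \- g) by apply/funext => x /=; ring.
apply: le_lt_trans (normH1_triangle h1 h2) _.
rewrite (normH1C hphi hg).
move: (normH1 _) (normH1 _) fg gphi => x1 x2; lra.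
Qed.

Lemma H10_eqae f g : L2 g -> eqae f g -> H10 f -> H10 g.
Proof.
move=> lg fg [hf ft]; split; first exact: H1_eqae fg hf.
move=> e /ft[phi [tphi fphi]]; exists phi; split; first exact: tphi.
have lphi := L2_test tphi; have lf := H1_L2 hf.
suff fg' : eqae (f \- phi) (g \- phi).
  by rewrite -(normH1_eqae (L2B lf lphi) (L2B lg lphi) fg').
by apply: filterS fg => x /= fgx /fgx ->.
Qed.

Lemma test_funS (a : R) phi psi : test_fun I01 phi -> test_fun I01 psi ->
  test_fun I01 (fun y => a * phi y + psi y).
Proof.
move=> [sphi cphi iphi] [spsi cpsi ipsi].
have sub : closure [set y | a * phi y + psi y != 0] `<=`
    closure [set y | phi y != 0] `|` closure [set y | psi y != 0].
  rewrite -closureU; apply: closure_subset => y /=.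
  have [->|] := eqVneq (phi y) 0; last by left.
  by rewrite mulr0 add0r; right.
split; first exact: smoothS.
- apply: subclosed_compact sub; first exact: closed_closure.
  exact: compactU.
- by move=> y /sub[]; [exact: iphi|exact: ipsi].
Qed.

Lemma normH1S a f g : H1 f -> H1 g ->
  normH1 (fun y => a * f y + g y) <= 2 * (`|a| * normH1 f + normH1 g).
Proof.
move=> hf hg; have [h1 h2] := H1S a hf hg; have [lf _] := H1_wderiv hf.
have [lg _] := H1_wderiv hg; have [lfg _] := H1_wderiv h1.
apply: le_trans (normH1_le _) _; rewrite (normL2_eqae lfg (L2S a lf lg) h2).
apply: le_trans (lerD (normL2D (L2Z a (H1_L2 hf)) (H1_L2 hg)) (normL2D (L2Z a lf) lg)) _.
rewrite (normL2Z a (H1_L2 hf)) (normL2Z a lf) addrACA -mulrDr.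
have le2 h : normL2 h + normL2 (wderiv h) <= 2 * normH1 h.
  by rewrite mulrDl mul1r; exact: lerD (normL2_le_H1 h) (normL2_wderiv_le_H1 h).
rewrite [leRHS]mulrDr [2 * (_ * _)]mulrCA.
by apply: lerD (ler_wpM2l (normr_ge0 a) (le2 f)) (le2 g).
Qed.

Lemma H10S a f g : H10 f -> H10 g -> H10 (fun y => a * f y + g y).
Proof.
move=> [hf ft] [hg gt]; have [h _] := H1S a hf hg; split; [exact: h|move=> e e0].
have a1 : 0 < 4 * (`|a| + 1) by rewrite mulr_gt0// ltr_wpDl.
have e4 : 0 < e / 4 by rewrite divr_gt0.
have [phi [tphi fphi]] := ft _ (divr_gt0 e0 a1).
have [psi [tpsi gpsi]] := gt _ e4.
exists (fun y => a * phi y + psi y); split; first exact: test_funS.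
have [h1 _] := H1B hf (H1_test tphi).1; have [h2 _] := H1B hg (H1_test tpsi).1.
have -> : (fun y => a * f y + g y) \- (fun y => a * phi y + psi y) =
    fun y => a * (f \- phi) y + (g \- psi) y by apply/funext => y /=; ring.
apply: le_lt_trans (normH1S a h1 h2) _.
have := normH1_ge0 (f \- phi); move: fphi; rewrite ltr_pdivlMr//.
move: (normH1 _) (normH1 _) gpsi => x1 x2.
rewrite (_ : x1 * (4 * _) = 4 * (`|a| * x1) + 4 * x1); last by ring.
by set y := `|a| * _; lra.
Qed.

(** The weak derivative of [J b] is [corr b], so [J] is bounded from $L^2$ to $H^1$. The $b$ sent
    into $H^1_0$ thus form a closed subspace, and it contains the bumps. *)
Lemma H10_J b : L2 b -> H10 (J b).
Proof.
have JH1 g : L2 g -> H1 (J g) /\ eqae (wderiv (J g)) (corr g).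
  move=> lg; have lc := L2_corr lg; apply: H1I => //; first exact: L2_J.
  apply: is_wderiv_eqae (is_wderiv_prim 0 lc); last exact: eqae_refl.
  by apply: aeW => x _; rewrite mul0r add0r.
move=> lb; suff [] : (fun b => L2 b /\ H10 (J b)) b by [].
move: lb; apply: (@closed_span_L2 _ (fun b => L2 b /\ H10 (J b))) => {b}.
- move=> a f g [lf hf] [lg hg]; split; first exact: L2S.
  by rewrite (J_linear a lf lg); exact: H10S.
- move=> f lf H; split => //; apply: H10_closed; first exact: (JH1 f lf).1.
  move=> e e0; have K1 : 0 < 2 * K + 1 by rewrite ltr_wpDl ?mulr_ge0.
  have [g [[lg hg] _ fg]] := H _ (divr_gt0 e0 K1).
  exists (J g); split => //.
  have lfg := L2B lf lg.
  have -> : J f \- J g = J (f \- g).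
    have e1 (p q : R -> R) : q \- p = (fun y => -1 * p y + q y).
      by apply/funext => y /=; rewrite mulN1r addrC.
    by rewrite !e1 (J_linear _ lg lf).
  apply: le_lt_trans (normH1_le _) _.
  have [hJ eJ] := JH1 _ lfg; have [lw _] := H1_wderiv hJ.
  rewrite (normL2_eqae lw (L2_corr lfg) eJ).
  apply: le_lt_trans (lerD (normL2_J lfg) (normL2_corr lfg)) _.
  rewrite -/K; move: fg; rewrite ltr_pdivlMr//.
  have := mulr_ge0 K0 (normL2_ge0 (f \- g)); have := normL2_ge0 (f \- g).
  by set X := normL2 _; lra.
- move=> q r n q0 r1; split; first by apply: L2_test; exact: test_cbump.
  by apply: H10_test; exact: test_J_cbump.
Qed.

(** The difference has zero primitive, and at an interior point the derivative of this primitive is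
    the value of the difference. The two ends follow by continuity. *)
Lemma eqae_continuous f g : {within cI01, continuous f} ->
  {within cI01, continuous g} -> eqae f g -> forall x, cI01 x -> f x = g x.
Proof.
move=> cf cg fg.
have ch : {within cI01, continuous (f \- g)}.
  by move=> y; apply: cvgB; [exact: cf|exact: cg].
have lh := L2_continuous ch.
have h0 : eqae (f \- g) (fun=> 0) by apply: filterS fg => y /= fg /fg ->; rewrite subrr.
have p0 : prim (f \- g) = fun=> 0.
  by apply/funext => y; rewrite (prim_eqae _ h0) prim0.
have int (x : R) : 0 < x < 1 -> (f \- g) x = 0.
  move=> x01; have cx : {for x, continuous (f \- g)}.
    by have [hoo _ _] := (continuous_within_itvP _ ltr01).1 ch; apply: hoo; rewrite in_itv.
  have d1 := is_derive_prim lh x01 cx.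
  by rewrite p0 in d1; have := @derive_val _ _ _ _ _ _ _ d1; rewrite derive_cst.
have [_ h00 h01] := (continuous_within_itvP _ ltr01).1 ch.
move=> x; rewrite cI01_itv => /andP[x0 x1]; apply: subr0_eq.
rewrite -[LHS]/((f \- g) x).
move: x0 x1; rewrite le_eqVlt => /predU1P[<- _|x0].
  apply: (cvg_unique _ h00) => //; apply: cvg_near_cst; near=> y; apply: int.
  by apply/andP; split; [by near: y; exact: nbhs_right_gt|by near: y; exact: nbhs_right_lt].
rewrite le_eqVlt => /predU1P[->|x1]; last by apply: int; rewrite x0.
apply: (cvg_unique _ h01) => //; apply: cvg_near_cst; near=> y; apply: int.
by apply/andP; split; [by near: y; exact: nbhs_left_gt|by near: y; exact: nbhs_left_lt].
Unshelve. all: end_near.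
Qed.

(* Functions of [H^1] vanishing at both ends are primitives of mean-zero
   functions, hence limits of the test functions [J (cbump q r n)]. *)
Lemma H10_boundary f : H1 f -> {within cI01, continuous f} -> f 0 = 0 -> f 1 = 0 ->
  H10 f.
Proof.
move=> hf cf f0 f1; have [lw fw] := H1_wderiv hf; have lf := H1_L2 hf.
have [c fc] := wderiv_prim lf lw (is_wderiv_cbump fw).
have cp : {within cI01, continuous (fun y => c * 1 + prim (wderiv f) y)}.
  apply: continuous_subspaceT => y; apply: cvgD; first exact: cvg_cst.
  exact: continuous_prim.
have E := eqae_continuous cf cp fc.
have c0 : c = 0.
  have := E 0; rewrite cI01_itv lexx ler01 => /(_ isT).
  by rewrite f0 prim_le0// addr0 mulr1.
have w0 : ip (wderiv f) (fun=> 1) = 0.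
  have := E 1; rewrite cI01_itv lexx ler01 => /(_ isT).
  by rewrite f1 prim_ge1// c0 mul0r add0r.
have HJ := H10_J lw; rewrite /J (corr_id w0) in HJ.
apply: H10_eqae HJ => //; apply: aeW => x Ix; apply/esym.
by rewrite E ?c0 ?mul0r ?add0r//; exact: sub_I01.
Qed.

(** This removes exceptional points: for continuous functions the almost everywhere identity of
    [wderiv_prim] holds on the whole closed interval. It is applied in the variable $x$ to pairings
    with a fixed function of $y$. *)
Lemma wderiv_continuous f g : {within cI01, continuous f} ->
  {within cI01, continuous g} -> is_wderiv f g ->
  forall x, 0 <= x <= 1 -> f x = f 0 + prim g x.
Proof.
move=> cf cg fg; have lf := L2_continuous cf; have lg := L2_continuous cg.
have [c fc] := wderiv_prim lf lg (is_wderiv_cbump fg).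
have cp : {within cI01, continuous (fun y => c * 1 + prim g y)}.
  apply: continuous_subspaceT => y; apply: cvgD; first exact: cvg_cst.
  exact: continuous_prim.
have E := eqae_continuous cf cp fc.
move=> x x01; rewrite !E ?cI01_itv ?lexx ?ler01//.
by rewrite (prim_le0 g (lexx 0)) addr0.
Qed.

Lemma ip_wderiv f psi : H1 f -> H10 psi -> ip (wderiv f) psi = - ip f (wderiv psi).
Proof.
move=> hf [hpsi psit]; have [lw fw] := H1_wderiv hf; have lf := H1_L2 hf.
have [lwp _] := H1_wderiv hpsi; have lpsi := H1_L2 hpsi.
apply: L2_le_eps => e e0.
have C0 : 0 < normL2 (wderiv f) + normL2 f + 1 by rewrite ltr_wpDl ?addr_ge0 ?normL2_ge0.
have [phi [tphi pphi]] := psit _ (divr_gt0 e0 C0).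
have [hphi wphi] := H1_test tphi; have lphi := H1_L2 hphi.
have [lwphi _] := H1_wderiv hphi.
have -> : ip (wderiv f) psi - - ip f (wderiv psi) =
    ip (wderiv f) (psi \- phi) + ip f (wderiv psi \- wderiv phi).
  rewrite !ipBr//; have := fw _ tphi; rewrite (ip_eqaer _ wphi) => ->.
  by rewrite !opprK [RHS]addrACA addNr addr0.
apply: le_trans (ler_normD _ _) _.
apply: le_trans (lerD (ip_CS lw (L2B lpsi lphi)) (ip_CS lf (L2B lwp lwphi))) _.
have n1 := normL2_le_H1 (psi \- phi); have n2 := normL2_wderivB hpsi hphi.
apply: le_trans (lerD (ler_wpM2l (normL2_ge0 _) n1) (ler_wpM2l (normL2_ge0 _) n2)) _.
rewrite -mulrDl; move: pphi; rewrite ltr_pdivlMr// mulrC => /ltW; apply: le_trans.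
by rewrite ler_wpM2r ?normH1_ge0// lerDl.
Qed.

End weak_derivative.

(** * Functions on the square *)

Section square_slices.
Context {R : realType}.
Notation mu := (@lebesgue_measure R).
Notation T := (measurableTypeR R).
Notation mu2 := (mu \x mu)%E.
Implicit Types (F G h : R * R -> R) (k psi : R -> R).

Lemma ae_imp (P Q : R -> Prop) : {ae mu, forall x, P x} ->
  (forall x, P x -> Q x) -> {ae mu, forall x, Q x}.
Proof.
move=> [N [mN N0 sN]] PQ; exists N; split => //; apply: subset_trans sN.
by move=> x; apply: contra_not; exact: PQ.
Qed.

Lemma measurable_Sq : measurable (Sq : set (T * T)).
Proof. exact: measurableX. Qed.

Lemma mu2_Sq_fin : (mu2 Sq < +oo)%E.
Proof. by rewrite product_measure1E// [X in (X * X)%E]mu_I01 mule1 ltry. Qed.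

Lemma L2Sq_sqint F : L2Sq F <-> sqint mu2 Sq F.
Proof. apply: sqint_Lfun; exact: measurable_Sq. Qed.

Lemma patch_Sq h (x y : R) : I01 y -> (h \_ Sq) (x, y) = ((fun x => h (x, y)) \_ I01) x.
Proof.
move=> Iy; rewrite !patchE; case: ifPn => [/set_mem[Ix _]|/negP nS].
  by rewrite mem_set.
by rewrite memNset// => Ix; apply: nS; rewrite inE; split.
Qed.

(** Fubini's theorem for the extension of $h$ by zero to the plane, whose slices at heights in the
    interval are the extended slices of $h$. *)
Lemma Sq_slices h : mu2.-integrable Sq (EFin \o h) ->
  [/\ \int[mu2]_(z in Sq) h z = \int[mu]_(y in I01) (\int[mu]_(x in I01) h (x, y)),
      mu.-integrable I01 (fun y => (\int[mu]_(x in I01) h (x, y))%:E) &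
      {ae mu, forall y, I01 y -> mu.-integrable I01 (EFin \o (fun x => h (x, y)))}].
Proof.
move=> /(integrable_mkcond _ measurable_Sq); rewrite restrict_EFin => ih.
have /integrableP[mh _] := ih.
have := measurable_fubini_G ih; have := integral21_prod_meas1 ih.
have := ae_integrable2 ih.
set G := fubini_G _ _ => aeG intG mG.
have iG : mu.-integrable setT G.
  apply/integrableP; split => //; apply: le_lt_trans ((integrable21ltyP _ _ mh).1 ih).
  apply: ge0_le_integral => //.
  - exact: measurableT_comp.
  - have ma : measurable_fun [set: T * T] (abse \o (EFin \o h \_ Sq)).
      exact: measurableT_comp.
    exact: (measurable_fun_fubini_tonelli_G _ ma (fun z => abse_ge0 _)).
  - move=> y _; apply: le_abse_integral => //.
    exact: measurable_fun_pair1.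
have GE y : I01 y -> G y = (\int[mu]_(x in I01) (h (x, y))%:E)%E.
  move=> Iy; rewrite /G /fubini_G [RHS]integral_mkcond; apply: eq_integral => x _.
  by rewrite /= patch_Sq// !patchE; case: ifP.
have aeS : {ae mu, forall y, I01 y -> mu.-integrable I01 (EFin \o (fun x => h (x, y)))}.
  apply: filterS aeG => y iy Iy; apply/(integrable_mkcond _ measurable_I01).
  apply: eq_integrable iy => // x _ /=; rewrite patch_Sq// !patchE.
  by case: ifP.
have iS : mu.-integrable I01 (fun y => (\int[mu]_(x in I01) h (x, y))%:E).
  have iGI : mu.-integrable I01 G by apply: integrableS iG.
  apply: (@eq_integrable _ _ _ _ _ measurable_I01 (fun y => (fine (G y))%:E)).
    by move=> y /set_mem Iy; rewrite GE.
  apply: (le_integrable measurable_I01) iGI.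
    apply/measurable_EFinP; apply: measurable_funTS; apply: measurableT_comp mG; exact: fine_measurable.
  by move=> y _; case: (G y) => [r| |]//=; rewrite normr0 leey.
split => //; rewrite /Rintegral; congr fine.
rewrite integral_mkcond restrict_EFin -intG.
transitivity (\int[mu]_(y in I01) G y)%E.
  rewrite [RHS]integral_mkcond; apply: eq_integral => y _; rewrite patchE.
  case: ifPn => // /negP nI; rewrite /G /fubini_G integral0_eq// => x _ /=.
  by rewrite patchE memNset// => -[_ Iy]; apply: nI; rewrite inE.
have E2 : ae_eq mu I01 G (fun y => (\int[mu]_(x in I01) h (x, y))%:E).
  apply: ae_imp aeS _ => y iy Iy.
  by rewrite GE// fineK//; exact: integrable_fin_num (iy Iy).
exact: (ae_eq_integral_nomeas E2).
Qed.

Lemma slice_L2 F : L2Sq F -> {ae mu, forall y, I01 y -> L2 (fun x => F (x, y))}.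
Proof.
move=> /L2Sq_sqint[mF iF]; have [_ _ ae2] := Sq_slices iF.
apply: ae_imp ae2 _ => y iy Iy; apply/L2_sqint; split; last exact: iy.
apply/(measurable_restrictT _ measurable_I01).
have mF' := iffLR (measurable_restrictT _ measurable_Sq) mF.
have := @measurable_fun_pair1 _ _ _ _ _ _ _ y mF'.
by apply: eq_measurable_fun => x _; rewrite patch_Sq.
Qed.

Lemma ae_le_L2 (g n : R -> R) : measurable_fun (I01 : set T) g ->
  mu.-integrable I01 (EFin \o n) -> (forall y, 0 <= n y) ->
  {ae mu, forall y, I01 y -> g y ^+ 2 <= n y} ->
  L2 g /\ normL2 g ^+ 2 <= \int[mu]_(y in I01) n y.
Proof.
move=> mg inn n0 gn.
have le1 : (\int[mu]_(y in I01) (g y ^+ 2)%:E <= \int[mu]_(y in I01) (n y)%:E)%E.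
  rewrite integral_mkcond [leRHS]integral_mkcond.
  apply: ge0_ae_le_integral_nomeas.
  - by move=> x; rewrite patchE; case: ifP; rewrite ?lee_fin ?sqr_ge0.
  - by move=> x; rewrite patchE; case: ifP; rewrite ?lee_fin.
  apply: ae_imp gn _ => y gy; rewrite !patchE; case: ifPn => // /set_mem Iy.
  by rewrite lee_fin; exact: gy.
have nfin : (\int[mu]_(y in I01) (n y)%:E)%E \is a fin_num by exact: integrable_fin_num.
have L : L2 g.
  apply/L2_sqint; split => //; apply/integrableP; split.
    by apply/measurable_EFinP; exact: measurable_funX.
  under eq_integral do rewrite /= ger0_norm ?sqr_ge0//.
  by apply: le_lt_trans le1 _; rewrite ltey_eq nfin.
split => //; rewrite normL2_sqr//.
have ifin : (\int[mu]_(y in I01) (g y * g y)%:E)%E \is a fin_num.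
  exact: (integrable_fin_num _ (integrable_L2M L L)).
by rewrite /ip /Rintegral fine_le.
Qed.

(** A weighted average over $x$, hence a function of $y$. The weights in use are [theta] and the
    kernels of the traces. *)
Definition Av k F (y : R) : R := ip (fun x => F (x, y)) k.

Lemma sqint_bounded_Sq (B : R * R -> R) (C : R) :
  measurable_fun [set: T * T] B -> (forall z, `|B z| <= C) -> sqint mu2 Sq B.
Proof.
move=> mB BC; apply: (sqint_bounded measurable_Sq mu2_Sq_fin (C := C)) => //.
exact: measurable_funTS.
Qed.

Lemma measurable_fst_comp k : measurable_fun [set: T] k ->
  measurable_fun [set: T * T] (fun z => k z.1).
Proof. by move=> mk; apply: (measurableT_comp mk); exact: measurable_fst. Qed.

Lemma measurable_snd_comp k : measurable_fun [set: T] k ->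
  measurable_fun [set: T * T] (fun z => k z.2).
Proof. by move=> mk; apply: (measurableT_comp mk); exact: measurable_snd. Qed.

(** Cauchy-Schwarz in $x$ on almost every slice, followed by integration in $y$. *)
Lemma L2_Av k F (C : R) : measurable_fun [set: T] k -> (forall x, `|k x| <= C) ->
  L2Sq F -> L2 (Av k F) /\
  normL2 (Av k F) ^+ 2 <= normL2 k ^+ 2 * \int[mu2]_(z in Sq) F z ^+ 2.
Proof.
move=> mk kC LF; have sF := (L2Sq_sqint F).1 LF; have [_ iF2] := sF.
have [eF2 in2 _] := Sq_slices iF2.
have lk : L2 k by apply: (@L2_bounded _ _ C) => //; exact: measurable_funTS.
have sk := sqint_bounded_Sq (measurable_fst_comp mk) (fun z => kC z.1).
have [_ iAv _] := Sq_slices (integrable_sqintM measurable_Sq sF sk).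
have mAv : measurable_fun (I01 : set T) (Av k F).
  by apply/measurable_EFinP; have /integrableP[] := iAv.
pose n y := \int[mu]_(x in I01) (F (x, y) ^+ 2).
have n0 y : 0 <= n y by apply: Rintegral_ge0 => x _; exact: sqr_ge0.
have ikn : mu.-integrable I01 (EFin \o (fun y => normL2 k ^+ 2 * n y)).
  by have := integrableZl measurable_I01 (normL2 k ^+ 2) in2; apply: eq_integrable.
have [||||L le] := @ae_le_L2 (Av k F) (fun y => normL2 k ^+ 2 * n y).
- exact: mAv.
- exact: ikn.
- by move=> y; rewrite mulr_ge0 ?sqr_ge0.
- apply: ae_imp (slice_L2 LF) _ => y Ly Iy.
  have := ip_CS (Ly Iy) lk; rewrite -/(Av k F y) => CS.
  have -> : n y = normL2 (fun x => F (x, y)) ^+ 2.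
    by rewrite (normL2_sqr (Ly Iy)); apply: eq_Rintegral => x _; rewrite expr2.
  rewrite -exprMn mulrC -[_ ^+ 2]real_normK ?num_real//.
  by rewrite lerXn2r ?nnegrE// mulr_ge0 ?normL2_ge0.
split => //; apply: le_trans le _.
by rewrite RintegralZl// eF2.
Qed.

Lemma Av_fubini k psi F (C C' : R) : measurable_fun [set: T] k ->
  (forall x, `|k x| <= C) -> measurable_fun [set: T] psi ->
  (forall x, `|psi x| <= C') -> L2Sq F ->
  \int[mu2]_(z in Sq) (F z * (k z.1 * psi z.2)) = ip (Av k F) psi.
Proof.
move=> mk kC mpsi psiC /L2Sq_sqint sF.
have sk : sqint mu2 Sq (fun z => k z.1 * psi z.2).
  apply: (@sqint_bounded_Sq _ (C * C')).
    exact: measurable_funM (measurable_fst_comp mk) (measurable_snd_comp mpsi).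
  by move=> z; rewrite normrM; exact: ler_pM.
have ik := integrable_sqintM measurable_Sq sF sk; have [-> _ _] := Sq_slices ik.
have sk' := sqint_bounded_Sq (measurable_fst_comp mk) (fun z => kC z.1).
have [_ _ ae2] := Sq_slices (integrable_sqintM measurable_Sq sF sk').
apply: ae_eq_Rintegral; apply: ae_imp ae2 _ => y iy Iy.
rewrite /Av /ip -RintegralZr//; last exact: iy.
by apply: eq_Rintegral => x _ /=; rewrite mulrA.
Qed.

Definition transp (z : R * R) : R * R := (z.2, z.1).

Lemma measurable_transp : measurable_fun [set: T * T] (transp : T * T -> T * T).
Proof. exact: measurable_fun_pair. Qed.

Lemma L2Sq_swap F : L2Sq F -> L2Sq (F \o transp).
Proof.
move=> /L2Sq_sqint[mF iF]; apply/L2Sq_sqint.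
have swapE h : (h \o transp) \_ Sq = (h \_ Sq) \o transp.
  apply/funext => -[x y]; rewrite /= !patchE; congr (if _ then _ else _).
  by apply/idP/idP; rewrite !inE => -[/= ? ?]; split.
have mF' := iffLR (measurable_restrictT _ measurable_Sq) mF.
split.
  apply/(measurable_restrictT _ measurable_Sq); rewrite swapE.
  by apply: measurableT_comp mF' _; exact: measurable_transp.
move/(integrable_mkcond _ measurable_Sq) : iF; rewrite restrict_EFin => iF.
apply/(integrable_mkcond _ measurable_Sq); rewrite restrict_EFin.
rewrite (swapE (fun z => F z ^+ 2)).
have /integrableP[m2 _] := iF.
have ms : measurable_fun [set: T * T] (EFin \o (((fun z => F z ^+ 2) \_ Sq) \o transp)).
  by apply: (measurableT_comp m2); exact: measurable_transp.
apply/(integrable12ltyP _ _ ms) => /=.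
exact: ((integrable21ltyP _ _ m2).1 iF).
Qed.

Lemma integral_swap h : mu2.-integrable Sq (EFin \o h) ->
  mu2.-integrable Sq (EFin \o (h \o transp)) ->
  \int[mu2]_(z in Sq) (h \o transp) z = \int[mu2]_(z in Sq) h z.
Proof.
move=> ih ihs; rewrite /Rintegral; congr fine.
rewrite integral_mkcond [RHS]integral_mkcond !restrict_EFin.
move/(integrable_mkcond _ measurable_Sq) : ih; rewrite restrict_EFin => ih.
move/(integrable_mkcond _ measurable_Sq) : ihs; rewrite restrict_EFin => ihs.
rewrite -(integral12_prod_meas1 ih) -(integral21_prod_meas1 ihs).
apply: eq_integral => x _; apply: eq_integral => y _ /=; congr EFin.
rewrite !patchE /=; congr (if _ then _ else _).
by apply/idP/idP; rewrite !inE => -[/= ? ?]; split.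
Qed.

(** The weighted average over $y$, written through the exchange of variables so that the lemmas on
    [Av] apply. *)
Definition row psi F : R -> R := Av psi (F \o transp).

Lemma rowE psi F x : row psi F x = ip (fun y => F (x, y)) psi.
Proof. by []. Qed.

Lemma row_fubini k psi F (C C' : R) : measurable_fun [set: T] k ->
  (forall x, `|k x| <= C) -> measurable_fun [set: T] psi ->
  (forall x, `|psi x| <= C') -> L2Sq F ->
  \int[mu2]_(z in Sq) (F z * (k z.1 * psi z.2)) = ip (row psi F) k.
Proof.
move=> mk kC mpsi psiC LF; have LFs := L2Sq_swap LF.
rewrite -(Av_fubini mpsi psiC mk kC LFs).
pose h z := F z * (k z.1 * psi z.2).
have bd (a b : R -> R) (A B : R) : measurable_fun [set: T] a -> (forall x, `|a x| <= A) ->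
    measurable_fun [set: T] b -> (forall x, `|b x| <= B) ->
    sqint mu2 Sq (fun z => a z.1 * b z.2).
  move=> ma aA mb bB; apply: (@sqint_bounded_Sq _ (A * B)).
    exact: measurable_funM (measurable_fst_comp ma) (measurable_snd_comp mb).
  by move=> z; rewrite normrM; exact: ler_pM.
have ih : mu2.-integrable Sq (EFin \o h).
  by apply: (integrable_sqintM measurable_Sq ((L2Sq_sqint F).1 LF)); exact: bd mk kC mpsi psiC.
have ihs : mu2.-integrable Sq (EFin \o (h \o transp)).
  have := integrable_sqintM measurable_Sq ((L2Sq_sqint _).1 LFs) (bd _ _ _ _ mpsi psiC mk kC).
  apply: eq_integrable; first exact: measurable_Sq.
  by move=> z _; rewrite /h /= (mulrC (k _)).
rewrite -(integral_swap ih ihs); apply: eq_Rintegral => z _.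
by rewrite /h /= (mulrC (k _)).
Qed.

End square_slices.

(** * Weak partial derivatives tested with tensor products *)

Section tensor_products.
Context {R : realType}.
Notation mu := (@lebesgue_measure R).
Notation T := (measurableTypeR R).
Notation mu2 := (mu \x mu)%E.
Implicit Types (F G : R * R -> R) (phi psi : R -> R) (z v : (R * R)%type).

Lemma is_derive_fst phi z v d : is_derive z.1 v.1 phi d ->
  is_derive z v (fun z => phi z.1) d.
Proof. by case=> ex der; apply: DeriveDef. Qed.

Lemma is_derive_snd phi z v d : is_derive z.2 v.2 phi d ->
  is_derive z v (fun z => phi z.2) d.
Proof. by case=> ex der; apply: DeriveDef. Qed.

Definition tensor phi psi : R * R -> R := fun z => phi z.1 * psi z.2.

Lemma is_derive_tensor phi psi z v : smooth phi -> smooth psi ->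
  is_derive z v (tensor phi psi)
    (v.2 * (tensor phi ('D_1 psi) z) + v.1 * tensor ('D_1 phi) psi z).
Proof.
move=> sphi spsi.
have d1 := is_derive_fst (is_derive_dir v.1 (smooth_is_derive z.1 1 sphi)).
have d2 := is_derive_snd (is_derive_dir v.2 (smooth_is_derive z.2 1 spsi)).
apply: is_derive_eq (is_deriveM d1 d2) _.
rewrite -[LHS]/(_ * _ + _ * _) /tensor; ring.
Qed.

Lemma smooth_tensor phi psi : smooth phi -> smooth psi -> smooth (tensor phi psi).
Proof.
move=> sphi spsi.
pose C := [set F | exists phi psi, [/\ smooth phi, smooth psi & F = tensor phi psi]].
apply: (@smooth_lin_span _ _ C).
- move=> _ [f [g [sf sg ->]]] z; apply: cvgM.
    apply: (@continuous_comp _ _ _ fst f); first exact: cvg_fst.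
    exact: (smooth_continuous sf).
  apply: (@continuous_comp _ _ _ snd g); first exact: cvg_snd.
  exact: (smooth_continuous sg).
- move=> _ v [f [g [sf sg ->]]].
  exists (fun z => v.2 * tensor f ('D_1 g) z + (v.1 * tensor ('D_1 f) g z + 0)).
    apply: lin_spanS; first by exists f, ('D_1 g); split; [exact: sf|exact: smooth_derive|].
    apply: lin_spanS; last exact: lin_span0.
    by exists ('D_1 f), g; split; [exact: smooth_derive|exact: sg|].
  by move=> z; rewrite addr0; exact: is_derive_tensor.
- by apply: lin_span1; exists phi, psi; split; [exact: sphi|exact: spsi|].
Qed.

Lemma closed_setX (A B : set R) : closed A -> closed B -> closed (A `*` B).
Proof.
move=> cA cB; have -> : A `*` B = fst @^-1` A `&` snd @^-1` B.
  by apply/seteqP; split=> z.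
apply: closedI; apply: closed_comp => // z _; [exact: cvg_fst|exact: cvg_snd].
Qed.

Lemma test_tensor phi psi : test_fun I01 phi -> test_fun I01 psi ->
  test_fun Sq (tensor phi psi).
Proof.
move=> [sphi cphi iphi] [spsi cpsi ipsi].
have sub : closure [set z | tensor phi psi z != 0] `<=`
    closure [set x | phi x != 0] `*` closure [set y | psi y != 0].
  have cl : closed (closure [set x | phi x != 0] `*` closure [set y | psi y != 0]).
    by apply: closed_setX; exact: closed_closure.
  rewrite [X in _ `<=` X](iffLR (closure_id _) cl); apply: closure_subset => z /=.
  by rewrite mulf_eq0 negb_or => /andP[p1 p2]; split; exact: subset_closure.
split; first exact: smooth_tensor.
- apply: subclosed_compact sub; first exact: closed_closure.
  exact: compact_setX.
- by move=> z /sub[z1 z2]; split; [exact: iphi|exact: ipsi].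
Qed.

Lemma derive_tensor_x phi psi z : smooth phi -> smooth psi ->
  'D_e_x (tensor phi psi) z = tensor ('D_1 phi) psi z.
Proof.
move=> sphi spsi; have d := is_derive_tensor z e_x sphi spsi.
by rewrite (@derive_val _ _ _ _ _ _ _ d) /= mul0r add0r mul1r.
Qed.

Lemma derive_tensor_y phi psi z : smooth phi -> smooth psi ->
  'D_e_y (tensor phi psi) z = tensor phi ('D_1 psi) z.
Proof.
move=> sphi spsi; have d := is_derive_tensor z e_y sphi spsi.
by rewrite (@derive_val _ _ _ _ _ _ _ d) /= mul0r addr0 mul1r.
Qed.

Lemma test_derive phi : test_fun I01 phi -> test_fun I01 ('D_1 phi).
Proof.
move=> [sphi cphi iphi].
have sub : closure [set x | 'D_1 phi x != 0] `<=` closure [set x | phi x != 0].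
  rewrite [X in _ `<=` X](iffLR (closure_id _) (@closed_closure _ _)).
  apply: closure_subset => x /= dx; apply: contrapT => nx.
  have ox : open (~` closure [set x | phi x != 0]).
    by apply: closed_openC; exact: closed_closure.
  have d0 : is_derive x (1 : R) (fun=> 0 : R) 0 by exact: is_derive_cst.
  have d1 : is_derive x (1 : R) phi 0.
    apply: near_eq_is_derive d0; have := open_nbhs_nbhs (conj ox nx).
    apply: filterS => y ny; apply/esym/eqP; apply: contrapT => /negP phiy.
    by apply: ny; exact: subset_closure.
  by move: dx; rewrite (@derive_val _ _ _ _ _ _ _ d1) eqxx.
split; first exact: smooth_derive.
- by apply: (subclosed_compact _ cphi sub); exact: closed_closure.
- exact: subset_trans sub iphi.
Qed.

Lemma smooth_measurable phi : smooth phi -> measurable_fun [set: T] phi.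
Proof. by move=> sphi; apply: continuous_measurable_fun; exact: (smooth_continuous sphi). Qed.

Lemma test_bounded phi : test_fun I01 phi -> exists C, forall x, `|phi x| <= C.
Proof.
move=> tphi; have [sphi _ _] := tphi.
have [C [C0 phiC]] := continuous_I01_bounded (continuous_subspaceT (smooth_continuous sphi)).
exists C => x; have [x01|x01] := boolP (0 < x < 1).
  by apply: phiC; apply: sub_I01; rewrite I01_itv.
by rewrite (test_fun_out tphi x01) normr0.
Qed.

Lemma row_tensor phi psi F : test_fun I01 phi -> test_fun I01 psi -> L2Sq F ->
  \int[mu2]_(z in Sq) (F z * tensor phi psi z) = ip (row psi F) phi.
Proof.
move=> tphi tpsi LF; have [C phiC] := test_bounded tphi.
have [C' psiC] := test_bounded tpsi; have [s1 _ _] := tphi; have [s2 _ _] := tpsi.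
exact: row_fubini (smooth_measurable s1) phiC (smooth_measurable s2) psiC LF.
Qed.

Lemma L2_row psi F : test_fun I01 psi -> L2Sq F -> L2 (row psi F).
Proof.
move=> tpsi LF; have [C psiC] := test_bounded tpsi; have [s _ _] := tpsi.
by have [] := L2_Av (smooth_measurable s) psiC (L2Sq_swap LF).
Qed.

(** Tensor test functions reduce weak partial derivatives to rows: the one in $x$ becomes a
    one-dimensional weak derivative, the one in $y$ an identity for almost every $x$ in which the
    derivative falls on [psi]. *)
Lemma row_wpartial_x psi F G : test_fun I01 psi -> L2Sq F -> L2Sq G ->
  is_wpartial e_x F G -> is_wderiv (row psi F) (row psi G).
Proof.
move=> tpsi LF LG FG phi tphi; have [s1 _ _] := tphi; have [s2 _ _] := tpsi.
have := FG _ (test_tensor tphi tpsi); under eq_Rintegral do rewrite (derive_tensor_x _ s1 s2).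
by rewrite (row_tensor (test_derive tphi) tpsi LF) (row_tensor tphi tpsi LG).
Qed.

Lemma row_wpartial_y psi F G : test_fun I01 psi -> L2Sq F -> L2Sq G ->
  is_wpartial e_y F G -> eqae (row ('D_1 psi) F) (\- row psi G).
Proof.
move=> tpsi LF LG FG; have tpsi' := test_derive tpsi.
have l1 := L2_row tpsi' LF; have l2 := L2_row tpsi LG; have l3 := L2N l2.
apply: eqae_subr0; apply: test_orth; first exact: L2B.
move=> phi tphi; have [s1 _ _] := tphi; have [s2 _ _] := tpsi.
have := FG _ (test_tensor tphi tpsi); under eq_Rintegral do rewrite (derive_tensor_y _ s1 s2).
rewrite (row_tensor tphi tpsi' LF) (row_tensor tphi tpsi LG) => e.
have lphi := L2_test tphi; rewrite (ipBl l1 l3 lphi) (ipNl l2 lphi) e.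
by rewrite subrr.
Qed.

Lemma H1Sq_wpartial F e : H1Sq F -> e = e_x \/ e = e_y ->
  L2Sq (wpartial e F) /\ is_wpartial e F (wpartial e F).
Proof.
move=> [_ H] /H[G FG]; rewrite /wpartial; case: xgetP => [h -> //|/(_ G)].
by case.
Qed.

Lemma test_dense f : L2 f -> forall e, 0 < e ->
  exists phi, test_fun I01 phi /\ normL2 (f \- phi) < e.
Proof.
move=> lf; suff [] : (fun f => L2 f /\ forall e, 0 < e ->
    exists phi, test_fun I01 phi /\ normL2 (f \- phi) < e) f by [].
move: lf; apply: (@closed_span_L2 _ (fun f => L2 f /\ forall e, 0 < e ->
    exists phi, test_fun I01 phi /\ normL2 (f \- phi) < e)) => {f}.
- move=> a f g [lf hf] [lg hg]; split; first exact: L2S.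
  move=> e e0; have a1 : 0 < 2 * (`|a| + 1) by rewrite mulr_gt0// ltr_wpDl.
  have e2 : 0 < e / 2 by rewrite divr_gt0.
  have [phi [tphi fphi]] := hf _ (divr_gt0 e0 a1); have [psi [tpsi gpsi]] := hg _ e2.
  have lphi := L2_test tphi; have lpsi := L2_test tpsi.
  exists (fun y => a * phi y + psi y); split; first exact: test_funS.
  have -> : (fun y => a * f y + g y) \- (fun y => a * phi y + psi y) =
      (fun y => a * (f \- phi) y) \+ (g \- psi) by apply/funext => y /=; ring.
  have l1 := L2B lf lphi; have l2 := L2B lg lpsi.
  apply: le_lt_trans (normL2D (L2Z a l1) l2) _; rewrite (normL2Z a l1).
  have := normL2_ge0 (f \- phi); move: fphi; rewrite ltr_pdivlMr//.
  move: (normL2 _) (normL2 _) gpsi => x1 x2.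
  rewrite (_ : x1 * (2 * _) = 2 * (`|a| * x1) + 2 * x1); last by ring.
  by set y := `|a| * _; lra.
- move=> f lf H; split => // e e0; have e2 : 0 < e / 2 by rewrite divr_gt0.
  have [g [[lg hg] _ fg]] := H _ e2; have [phi [tphi gphi]] := hg _ e2.
  exists phi; split => //; have lphi := L2_test tphi.
  have -> : f \- phi = (f \- g) \+ (g \- phi) by apply/funext => y /=; ring.
  apply: le_lt_trans (normL2D (L2B lf lg) (L2B lg lphi)) _.
  by move: (normL2 _) (normL2 _) fg gphi => x1 x2; lra.
- move=> q r n q0 r1; have t := test_cbump n q0 r1; split; first exact: L2_test.
  by move=> e e0; exists (cbump q r n); rewrite normL2_0_of_sub.
Qed.

(** Duality: a test function close to $f$ stands in for $f$. With $N=\|f\|$ and approximation error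
    $\delta$, one gets $N^2\le CN+(N+C)\delta$, and $\delta$ is chosen so that the last term is at
    most $eN$. *)
Lemma normL2_by_tests (f : R -> R) (C : R) : L2 f ->
  (forall phi, test_fun I01 phi -> `|ip f phi| <= C * normL2 phi) -> 0 <= C ->
  normL2 f <= C.
Proof.
move=> lf H C0; apply/ler_addgt0Pl => e e0.
have N0 := normL2_ge0 f; set N := normL2 f in N0 *.
have d0 : 0 < N + C + 1 by rewrite ltr_wpDl ?addr_ge0.
have [f0|fn0] := eqVneq N 0; first by rewrite f0 addr_ge0 ?(ltW e0).
have Np : 0 < N by rewrite lt_neqAle eq_sym fn0.
have [phi [tphi fphi]] := test_dense lf (divr_gt0 (mulr_gt0 e0 Np) d0).
have lphi := L2_test tphi; have lB := L2B lf lphi.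
have CS := le_trans (ler_norm _) (ip_CS lf lB).
rewrite (ipBr lf lphi lf) -normL2_sqr// -/N in CS.
have Hphi := le_trans (ler_norm _) (H _ tphi).
have nphi : normL2 phi <= N + normL2 (f \- phi).
  have -> : normL2 phi = normL2 (f \- (f \- phi)).
    by apply: eq_normL2 => y _ /=; ring.
  exact: normL2B.
have d1 : (N + C) * normL2 (f \- phi) <= e * N.
  move: fphi; rewrite ltr_pdivlMr// => /ltW; apply: le_trans.
  by rewrite mulrC ler_wpM2l ?normL2_ge0// lerDl.
rewrite -(ler_pM2r Np) -expr2.
have := ler_wpM2l C0 nphi.
move: (normL2 (f \- phi)) (normL2 phi) (ip f phi) CS Hphi d1 {H fphi nphi}.
by move: N {N0 fn0 Np d0} => N x1 x2 x3 h1 h2 h3 h4; lra.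
Qed.

End tensor_products.

(** * Values at every $x$ of a function with a weak derivative in $x$ *)

Section traces.
Context {R : realType}.
Notation mu := (@lebesgue_measure R).
Notation T := (measurableTypeR R).
Notation mu2 := (mu \x mu)%E.
Implicit Types (F G : R * R -> R) (phi psi : R -> R).

(** By [ip_prim], $\langle\mathrm{prim}\,g,\theta\rangle+\langle
    g,\mathrm{prim}\,\theta\rangle=\langle g,1\rangle$; hence
    $\langle\mathrm{prim}\,g,\theta\rangle+\langle
    g,\mathrm{kern}\,x\rangle=\mathrm{prim}\,g\,(x)$. *)
Let kern (x : R) : R -> R := (below x \+ prim theta) \- (fun=> 1).

(* [f = <f, theta> + <f', kern x>] for [f] in [H^1(0,1)]: this gives the values in
   [L^2] at every [x] of a function of two variables. *)
Definition trace F G (x : R) : R -> R := Av theta F \+ Av (kern x) G.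

Let measurable_kern x : measurable_fun [set: T] (kern x).
Proof.
apply: measurable_funB => //; apply: measurable_funD; first exact: measurable_below.
apply: continuous_measurable_fun; apply: continuous_prim; exact: L2_theta.
Qed.

Let kern_bounded x s : `|kern x s| <= 1 + normL2 theta + 1.
Proof.
rewrite /kern; apply: le_trans (ler_normB _ _) _; rewrite normr1 lerD2r.
apply: le_trans (ler_normD _ _) _; apply: lerD; first exact: below_bounded.
by apply: prim_bound; exact: L2_theta.
Qed.

Lemma theta_bounded : exists C, forall x : R, `|theta x| <= C.
Proof.
have lt : 0 < (ip (@theta0 R) (fun=> 1))^-1 by rewrite invr_gt0 ip_theta0_gt0.
exists (ip theta0 (fun=> 1))^-1 => x; rewrite /theta normrM gtr0_norm//.
by rewrite ler_piMr ?(ltW lt)// ger0_norm ?bump_ge0// bump_le1.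
Qed.

Lemma L2_trace F G x : L2Sq F -> L2Sq G -> L2 (trace F G x).
Proof.
move=> LF LG; have [C tC] := theta_bounded; apply: L2D.
  by have [] := L2_Av (smooth_measurable (@smooth_theta R)) tC LF.
by have [] := L2_Av (measurable_kern x) (kern_bounded x) LG.
Qed.

(** The row of $F$ is controlled only almost everywhere; the trace supplies, with one constant for
    all $x$, its representative as a primitive. *)
Lemma ip_trace F G psi : L2Sq F -> L2Sq G -> is_wpartial e_x F G ->
  test_fun I01 psi -> exists2 c, eqae (row psi F) (fun x => ip (trace F G x) psi) &
  forall x, ip (trace F G x) psi = c + prim (row psi G) x.
Proof.
move=> LF LG FG tpsi; have lpsi := L2_test tpsi.
have lf := L2_row tpsi LF; have lg := L2_row tpsi LG.
have [c fc] := wderiv_prim lf lg (is_wderiv_cbump (row_wpartial_x tpsi LF LG FG)).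
have [C tC] := theta_bounded; have [C' pC] := test_bounded tpsi.
have [sp _ _] := tpsi; have lt := @L2_theta R; have lpt := L2_prim lt.
have mt := smooth_measurable (@smooth_theta R).
have E x : ip (trace F G x) psi = c + prim (row psi G) x.
  have [l1 _] := L2_Av mt tC LF.
  have [l2 _] := L2_Av (measurable_kern x) (kern_bounded x) LG.
  rewrite /trace (ipDl l1 l2 lpsi).
  rewrite -(Av_fubini mt tC (smooth_measurable sp) pC LF).
  rewrite -(Av_fubini (measurable_kern x) (kern_bounded x) (smooth_measurable sp) pC LG).
  rewrite (row_fubini mt tC (smooth_measurable sp) pC LF).
  rewrite (row_fubini (measurable_kern x) (kern_bounded x) (smooth_measurable sp) pC LG).
  rewrite (ip_eqae _ fc).
  have l1' : L2 (fun=> 1 : R) by exact: L2_cst.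
  have lx := L2_below x; have lpg := L2_prim lg.
  rewrite (ipSl c l1' lpg lt) (ipC (fun=> 1) theta) ip_theta mulr1.
  rewrite (ipBr (L2D lx lpt) l1' lg) (ipDr lx lpt lg).
  have := ip_prim lg lt; rewrite ip_theta mulr1.
  rewrite -[ip _ (below x)]/(prim (row psi G) x).
  move: (prim _ x) (ip (row psi G) (prim theta)) (ip (prim _) theta) (ip _ (fun=> 1)).
  by move=> x1 x2 x3 x4 <-; ring.
exists c => //; apply: eqae_trans fc _; apply: aeW => x _; rewrite E mulr1//.
Qed.

(** The terms with [theta] cancel, which leaves the average of $G$ with the indicator of $[x',x)$ as
    weight; its squared norm is $x-x'$. *)
Lemma trace_increment F G (x x' : R) : L2Sq F -> L2Sq G -> is_wpartial e_x F G ->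
  0 <= x' <= x -> x <= 1 ->
  normL2 (trace F G x \- trace F G x') ^+ 2 <=
  (x - x') * \int[mu2]_(z in Sq) G z ^+ 2.
Proof.
move=> LF LG FG x'x x1; pose k := below x \- below x'.
have mk : measurable_fun [set: T] k.
  by apply: measurable_funB; exact: measurable_below.
have kC s : `|k s| <= 1 + 1.
  apply: le_trans (ler_normB _ _) _; apply: lerD; exact: below_bounded.
have [lk nk] := L2_Av mk kC LG.
have lx := L2_trace x LF LG; have lx' := L2_trace x' LF LG.
have lB := L2B lx lx'.
rewrite (below_sub_sqr x'x x1) in nk; apply: le_trans nk.
suff e : eqae (trace F G x \- trace F G x') (Av k G) by rewrite (normL2_eqae lB lk e).
apply: eqae_subr0; apply: test_orth; first exact: L2B.
move=> psi tpsi; have lpsi := L2_test tpsi; have lg := L2_row tpsi LG.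
have [C' pC] := test_bounded tpsi; have [sp _ _] := tpsi.
have [c _ E] := ip_trace LF LG FG tpsi.
rewrite (ipBl lB lk lpsi) (ipBl lx lx' lpsi) !E.
rewrite -(Av_fubini mk kC (smooth_measurable sp) pC LG).
rewrite (row_fubini mk kC (smooth_measurable sp) pC LG).
rewrite (ipBr (L2_below x) (L2_below x') lg) -!/(prim _ _).
by rewrite opprD addrACA subrr add0r subrr.
Qed.

End traces.

(** * The exact solution *)

Section continuous_families.
Context {R : realType}.
Notation mu := (@lebesgue_measure R).
Implicit Types (f g h psi : R -> R) (v w : R -> R -> R).
Opaque L2 normL2 ip.

Lemma within_cI01P f (x l : R) : f z @[z --> within cI01 (nbhs x)] --> l <->
  forall e : R, 0 < e -> exists2 d : R, 0 < d &
    forall z : R, 0 <= z <= 1 -> `|z - x| < d -> `|f z - l| < e.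
Proof.
split=> [/cvgrPdist_lt cf e e0|H].
  have /nbhs_ballP [d d0 dH] := cf e e0; exists d => // z z01 zx.
  rewrite distrC; apply: dH; last by rewrite cI01_itv.
  by rewrite -ball_normE /= distrC.
apply/cvgrPdist_lt => e e0; have [d d0 dH] := H e e0.
apply/nbhs_ballP; exists d => // z; rewrite -ball_normE /= => zx; rewrite cI01_itv => z01.
by rewrite distrC dH// distrC.
Qed.

Lemma within_cI01_continuousP f : {within cI01, continuous f} <->
  forall x : R, 0 <= x <= 1 -> forall e : R, 0 < e -> exists2 d : R, 0 < d &
    forall z : R, 0 <= z <= 1 -> `|z - x| < d -> `|f z - f x| < e.
Proof.
split=> [/subspace_continuousP cf x x01|H].
  by apply/within_cI01P; apply: cf; rewrite cI01_itv.
by apply/subspace_continuousP => x; rewrite cI01_itv => x01; apply/within_cI01P; exact: H.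
Qed.

Lemma C01_eps (X : set (R -> R)) (N : (R -> R) -> R) v (x e : R) : C01 X N v ->
  0 <= x <= 1 -> 0 < e -> exists2 d : R, 0 < d &
    forall z : R, 0 <= z <= 1 -> `|z - x| < d -> N (v z \- v x) < e.
Proof.
move=> cv; rewrite -cI01_itv => x01 e0; have [_ /within_cI01P H] := cv _ x01.
have [d d0 dH] := H _ e0; exists d => // z z01 zx; have := dH z z01 zx.
by rewrite subr0; apply: le_lt_trans; exact: ler_norm.
Qed.

Lemma C01_mem (X : set (R -> R)) (N : (R -> R) -> R) v (x : R) : C01 X N v ->
  0 <= x <= 1 -> X (v x).
Proof. by move=> cv; rewrite -cI01_itv => /cv[]. Qed.

Lemma C01I (X : set (R -> R)) (N : (R -> R) -> R) v : (forall f, 0 <= N f) ->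
  (forall x : R, 0 <= x <= 1 -> X (v x)) ->
  (forall x : R, 0 <= x <= 1 -> forall e : R, 0 < e -> exists2 d : R, 0 < d &
    forall z : R, 0 <= z <= 1 -> `|z - x| < d -> N (v z \- v x) < e) -> C01 X N v.
Proof.
move=> N0 Xv H x; rewrite cI01_itv => x01; split; first exact: Xv.
apply/within_cI01P => e e0; have [d d0 dH] := H x x01 e e0; exists d => // z z01 zx.
by rewrite subr0 ger0_norm// dH.
Qed.

Lemma C01_cst psi : L2 psi -> C01 L2 normL2 (fun=> psi).
Proof.
move=> lp; apply: C01I => // x _ e e0; exists 1 => // z _ _.
by rewrite normL2_0_of_sub.
Qed.

Lemma C01B v w : C01 L2 normL2 v -> C01 L2 normL2 w ->
  C01 L2 normL2 (fun x => v x \- w x).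
Proof.
move=> cv cw; apply: C01I => // [x x01|x x01 e e0].
  exact: L2B (C01_mem cv x01) (C01_mem cw x01).
have e2 : 0 < e / 2 by rewrite divr_gt0.
have [d d0 dH] := C01_eps cv x01 e2; have [d' d'0 d'H] := C01_eps cw x01 e2.
exists (Num.min d d'); first by rewrite lt_min d0.
move=> z z01; rewrite lt_min => /andP[zd zd'].
have lvz := C01_mem cv z01; have lvx := C01_mem cv x01.
have lwz := C01_mem cw z01; have lwx := C01_mem cw x01.
have -> : normL2 ((v z \- w z) \- (v x \- w x)) =
    normL2 ((v z \- v x) \- (w z \- w x)).
  apply: eq_normL2 => y _ /=.
  by move: (v z y) (w z y) (v x y) (w x y) => a b c c'; ring.
apply: le_lt_trans (normL2B (L2B lvz lvx) (L2B lwz lwx)) _.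
by rewrite (splitr e) ltrD// ?dH// d'H.
Qed.

(** Continuity jointly in two parameters, as the energy identity evaluates these products off the
    diagonal. *)
Lemma ip_joint v w (x y e : R) : C01 L2 normL2 v -> C01 L2 normL2 w ->
  0 <= x <= 1 -> 0 <= y <= 1 -> 0 < e -> exists2 d : R, 0 < d &
    forall s t : R, 0 <= s <= 1 -> 0 <= t <= 1 -> `|s - x| < d -> `|t - y| < d ->
      `|ip (v s) (w t) - ip (v x) (w y)| < e.
Proof.
move=> cv cw x01 y01 e0.
pose A := normL2 (v x); pose B := normL2 (w y).
have A0 : 0 <= A := normL2_ge0 _.
have B0 : 0 <= B := normL2_ge0 _.
(* The bound $h\le1$ makes the product of the two increments less than $h$, so that the total error
   stays below $h(1+A+B)\le e$. *)
pose h := Num.min 1 (e / (1 + A + B)).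
have AB : 0 < 1 + A + B by rewrite -addrA ltr_pwDl// addr_ge0.
have h0 : 0 < h by rewrite lt_min ltr01 divr_gt0.
have h1 : h <= 1 by rewrite ge_min lexx.
have he : h * (1 + A + B) <= e by rewrite -ler_pdivlMr// ge_min lexx orbT.
have [d d0 dH] := C01_eps cv x01 h0; have [d' d'0 d'H] := C01_eps cw y01 h0.
exists (Num.min d d'); first by rewrite lt_min d0.
move=> s t s01 t01; rewrite !lt_min => /andP[sd _] /andP[_ td].
have lvs := C01_mem cv s01; have lvx := C01_mem cv x01.
have lwt := C01_mem cw t01; have lwy := C01_mem cw y01.
have lv := L2B lvs lvx; have lw := L2B lwt lwy.
have -> : ip (v s) (w t) - ip (v x) (w y) =
    ip (v s \- v x) (w t \- w y) + ip (v x) (w t \- w y) + ip (v s \- v x) (w y).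
  rewrite (ipBl lvs lvx lw) (ipBr lwt lwy lvs) (ipBr lwt lwy lvx) (ipBl lvs lvx lwy).
  by move: (ip _ (w t)) (ip _ (w t)) (ip _ (w y)) (ip _ (w y)) => a b c c'; ring.
have := ip_CS lv lw; have := ip_CS lvx lw; have := ip_CS lv lwy.
have := dH s s01 sd; have := d'H t t01 td.
have := normL2_ge0 (v s \- v x); have := normL2_ge0 (w t \- w y).
rewrite -/A -/B.
move: (normL2 (v s \- v x)) (normL2 (w t \- w y)) => a b a0 b0 ah bh i1 i2 i3.
apply: le_lt_trans (ler_normD _ _) _.
apply: le_lt_trans (lerD (ler_normD _ _) (lexx _)) _.
apply: le_lt_trans (lerD (lerD i3 i2) i1) _; apply: lt_le_trans he.
have ab : a * b < h by apply: le_lt_trans bh; rewrite ler_piMr// (le_trans (ltW ah)).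
have Ab : A * b <= A * h by rewrite ler_wpM2l// ltW.
have aB : a * B <= h * B by rewrite ler_wpM2r// ltW.
by rewrite !mulrDr mulr1 [h * A]mulrC; rewrite ltr_leD// ltr_leD.
Qed.

Lemma continuous_ip v w : C01 L2 normL2 v -> C01 L2 normL2 w ->
  {within cI01, continuous (fun x => ip (v x) (w x))}.
Proof.
move=> cv cw; apply/within_cI01_continuousP => x x01 e e0.
have [d d0 dH] := ip_joint cv cw x01 x01 e0.
by exists d => // z z01 zx; exact: dH.
Qed.

Lemma within_continuousS (a : R) f g : {within cI01, continuous f} ->
  {within cI01, continuous g} -> {within cI01, continuous (fun x => a * f x + g x)}.
Proof.
move=> /subspace_continuousP cf /subspace_continuousP cg.
apply/subspace_continuousP => x x01; apply: cvgD (cg x x01); apply: cvgM (cf x x01).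
exact: cvg_cst.
Qed.

Lemma within_continuousN f : {within cI01, continuous f} ->
  {within cI01, continuous (fun x => - f x)}.
Proof.
move=> cf; rewrite (_ : (fun x => _) = (fun x => -2 * f x + f x)).
  exact: within_continuousS.
by apply/funext => x; ring.
Qed.

Lemma continuous_ip_cst v psi : C01 L2 normL2 v -> L2 psi ->
  {within cI01, continuous (fun x => ip (v x) psi)}.
Proof. by move=> cv lp; exact: continuous_ip cv (C01_cst lp). Qed.

Lemma C01_bounded v : C01 L2 normL2 v ->
  exists2 M, 0 <= M & forall x : R, 0 <= x <= 1 -> normL2 (v x) <= M.
Proof.
move=> cv; have [C [C0 CH]] := continuous_I01_bounded (continuous_ip cv cv).
exists (Num.sqrt C) => [|x x01]; first exact: sqrtr_ge0.
rewrite (normL2E (C01_mem cv x01)) ler_sqrt//; apply: le_trans (ler_norm _) _.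
by apply: CH; rewrite cI01_itv.
Qed.

Lemma C01_eqae v w : C01 L2 normL2 v -> (forall x : R, 0 <= x <= 1 -> L2 (w x)) ->
  (forall x : R, 0 <= x <= 1 -> eqae (w x) (v x)) -> C01 L2 normL2 w.
Proof.
move=> cv lw wv; apply: C01I => // x x01 e e0.
have [d d0 dH] := C01_eps cv x01 e0; exists d => // z z01 zx.
rewrite (_ : normL2 _ = normL2 (v z \- v x)); first exact: dH.
apply: normL2_eqae; first exact: L2B (lw _ z01) (lw _ x01).
  exact: L2B (C01_mem cv z01) (C01_mem cv x01).
have := wv _ x01; apply: filterS2 (wv _ z01) => y h1 h2 Iy /=.
by rewrite h1// h2.
Qed.

Lemma is_dx_cI01P v (x : R) f : 0 <= x <= 1 -> is_dx v x f <-> L2 f /\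
  forall e : R, 0 < e -> exists2 d : R, 0 < d & forall z : R, 0 <= z <= 1 -> z != x ->
    `|z - x| < d -> normL2 (fun y => (v z y - v x y) / (z - x) - f y) < e.
Proof.
move=> x01; split=> [[lf /cvgrPdist_lt cf]|[lf H]]; split => //.
  move=> e e0; have /nbhs_ballP [d d0 dH] := cf e e0; exists d => // z z01 zx zd.
  have := dH z; rewrite -ball_normE /= distrC cI01_itv => /(_ zd zx z01).
  by rewrite sub0r normrN; apply: le_lt_trans; exact: ler_norm.
apply/cvgrPdist_lt => e e0; have [d d0 dH] := H e e0; apply/nbhs_ballP; exists d => // z.
rewrite -ball_normE /= distrC cI01_itv => zd zx z01.
rewrite sub0r normrN ger0_norm; last exact: normL2_ge0.
exact: dH.
Qed.

Lemma near_point_cI01 (x d : R) : 0 <= x <= 1 -> 0 < d ->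
  exists z, [/\ 0 <= z <= 1, z != x & `|z - x| < d].
Proof.
move=> /andP[x0 x1] d0; have [x2|x2] := leP x 2^-1.
  exists (x + Num.min (d / 2) 2^-1).
  have m0 : 0 < Num.min (d / 2) 2^-1 by rewrite lt_min divr_gt0//= invr_gt0.
  have : Num.min (d / 2) 2^-1 <= d / 2 by rewrite ge_min lexx.
  have : Num.min (d / 2) 2^-1 <= 2^-1 by rewrite ge_min lexx orbT.
  move: m0; move: (Num.min _ _) => m m0 m1 m2; split; [by lra| |].
    by rewrite -subr_eq0 addrAC subrr add0r gt_eqF.
  by rewrite addrAC subrr add0r gtr0_norm//; lra.
exists (x - Num.min (d / 2) 2^-1).
have m0 : 0 < Num.min (d / 2) 2^-1 by rewrite lt_min divr_gt0//= invr_gt0.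
have : Num.min (d / 2) 2^-1 <= d / 2 by rewrite ge_min lexx.
have : Num.min (d / 2) 2^-1 <= 2^-1 by rewrite ge_min lexx orbT.
move: m0; move: (Num.min _ _) => m m0 m1 m2; split; [by lra| |].
  by rewrite -subr_eq0 addrAC subrr add0r oppr_eq0 gt_eqF.
by rewrite addrAC subrr add0r normrN gtr0_norm//; lra.
Qed.

Lemma L2_quotient f g (z x : R) : L2 f -> L2 g -> L2 (fun y => (f y - g y) / (z - x)).
Proof.
move=> lf lg; rewrite (_ : (fun y => _) = (fun y => (z - x)^-1 * (f \- g) y)).
  exact: L2Z (L2B lf lg).
by apply/funext => y; rewrite mulrC.
Qed.

Lemma is_dx_unique v (x : R) f g : 0 <= x <= 1 ->
  (forall z : R, 0 <= z <= 1 -> L2 (v z)) -> is_dx v x f -> is_dx v x g -> eqae f g.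
Proof.
move=> x01 lv /(is_dx_cI01P _ _ x01)[lf fH] /(is_dx_cI01P _ _ x01)[lg gH].
have lB := L2B lf lg.
apply: eqae_subr0; apply: normL2_eq0 => //.
rewrite -[normL2 _]subr0; apply/eqP; rewrite subr_eq0; apply/eqP.
apply: L2_le_eps => e e0; rewrite subr0 ger0_norm ?normL2_ge0//.
have e2 : 0 < e / 2 by rewrite divr_gt0.
have [d d0 dH] := fH _ e2; have [d' d'0 d'H] := gH _ e2.
have m0 : 0 < Num.min d d' by rewrite lt_min d0.
have [z [z01 zx]] := near_point_cI01 x01 m0; rewrite lt_min => /andP[zd zd'].
have lq := L2_quotient z x (lv _ z01) (lv _ x01).
apply: ltW; have -> : normL2 (f \- g) = normL2 (((fun y => (v z y - v x y) / (z - x)) \- g)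
    \- ((fun y => (v z y - v x y) / (z - x)) \- f)).
  apply: eq_normL2 => y _ /=.
  by move: (f y) (g y) (_ / _) => a b c; ring.
apply: le_lt_trans (normL2B (L2B lq lg) (L2B lq lf)) _.
by rewrite (splitr e) ltrD// ?dH// d'H.
Qed.

Lemma dx_is_dx v (x : R) f : is_dx v x f -> is_dx v x (dx v x).
Proof. by move=> h; rewrite /dx; case: xgetP => [g -> //|/(_ f)]. Qed.

End continuous_families.

(** * Regularity of the exact solution and its equation at every $x$ *)

Section exact_solution.
Context {R : realType}.
Notation mu := (@lebesgue_measure R).
Notation T := (measurableTypeR R).
Notation mu2 := (mu \x mu)%E.
Implicit Types (f g h psi : R -> R) (v w : R -> R -> R) (F G : R * R -> R).
Opaque L2 normL2 ip prim trace row wderiv derive wpartial normH1.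

Lemma ae_imp2 (P Q D : R -> Prop) : {ae mu, forall x, P x} ->
  {ae mu, forall x, Q x} -> (forall x, P x -> Q x -> D x) -> {ae mu, forall x, D x}.
Proof.
move=> p q PQ; apply: negligibleS (negligibleU p q) => x /= nD.
by apply: contrapT => /not_orP[/contrapT Px /contrapT Qx]; exact/nD/PQ.
Qed.

Lemma C01_trace F G : L2Sq F -> L2Sq G -> is_wpartial e_x F G ->
  C01 L2 normL2 (trace F G).
Proof.
move=> LF LG FG; have lt x := L2_trace x LF LG.
apply: C01I => [f|x _|x x01 e e0]; [exact: normL2_ge0|exact: lt|].
set M : R := \int[mu2]_(z in Sq) G z ^+ 2.
have M1 : 0 < `|M| + 1 by rewrite ltr_wpDl.
have e2 : 0 < e ^+ 2 by rewrite exprn_gt0.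
exists (e ^+ 2 / (`|M| + 1)); first exact: divr_gt0.
have D (a b : R) : 0 <= b <= a -> a <= 1 -> a - b < e ^+ 2 / (`|M| + 1) ->
    normL2 (trace F G a \- trace F G b) < e.
  move=> ba a1 ab; have := trace_increment LF LG FG ba a1; rewrite -/M => h.
  rewrite -(@ltr_pXn2r _ 2)// ?nnegrE ?normL2_ge0 ?(ltW e0)//.
  apply: le_lt_trans h _; have ba0 : 0 <= a - b by rewrite subr_ge0; case/andP: ba.
  apply: le_lt_trans (_ : (a - b) * (`|M| + 1) < _).
    by rewrite ler_wpM2l// (le_trans (ler_norm _))// lerDl.
  by rewrite -ltr_pdivlMr.
move=> z /andP[z0 z1] zx; case/andP: x01 => x0 x1; have [xz|zx'] := leP x z.
  by apply: D; rewrite ?x0// (le_lt_trans (ler_norm _)).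
rewrite normL2C//; apply: D; rewrite ?z0 ?(ltW zx')//.
by rewrite (le_lt_trans (ler_norm _))// distrC.
Qed.

Section strong.
Variables (u0 : R -> R) (u : R -> R -> R).
Hypothesis S : strong_solution u0 u.

Let U : R * R -> R := fun z => u z.1 z.2.
Let Ux := wpartial e_x U.
Let Uy := wpartial e_y U.
Let Uxx := wpartial e_x Ux.
Let Uyx := wpartial e_x Uy.
Let Uyy := wpartial e_y Uy.

Let L2U : L2Sq U. Proof. by have [[]] := ss_H2 S. Qed.

Let dUx : L2Sq Ux /\ is_wpartial e_x U Ux.
Proof. by have [h _ _] := ss_H2 S; apply: H1Sq_wpartial h _; left. Qed.

Let dUy : L2Sq Uy /\ is_wpartial e_y U Uy.
Proof. by have [h _ _] := ss_H2 S; apply: H1Sq_wpartial h _; right. Qed.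

Let dUxx : L2Sq Uxx /\ is_wpartial e_x Ux Uxx.
Proof. by have [_ h _] := ss_H2 S; apply: H1Sq_wpartial h _; left. Qed.

Let dUyx : L2Sq Uyx /\ is_wpartial e_x Uy Uyx.
Proof. by have [_ _ h] := ss_H2 S; apply: H1Sq_wpartial h _; left. Qed.

Let dUyy : L2Sq Uyy /\ is_wpartial e_y Uy Uyy.
Proof. by have [_ _ h] := ss_H2 S; apply: H1Sq_wpartial h _; right. Qed.

(* The values in [L^2] of u_x and u_y at every x. *)
Let V := trace Ux Uxx.
Let Y := trace Uy Uyx.

Let CV : C01 L2 normL2 V.
Proof. by have [? _] := dUx; have [? ?] := dUxx; exact: C01_trace. Qed.

Let CY : C01 L2 normL2 Y.
Proof. by have [? _] := dUy; have [? ?] := dUyx; exact: C01_trace. Qed.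

Let cont (x y e : R) : 0 <= x <= 1 -> 0 <= y <= 1 -> 0 < e -> exists2 d : R, 0 < d &
  forall s t : R, 0 <= s <= 1 -> 0 <= t <= 1 -> `|s - x| < d -> `|t - y| < d ->
    `|u s t - u x y| < e.
Proof.
move=> x01 y01 e0.
have /subspace_continuousP /(_ (x, y)) := ss_cont S.
rewrite /setX /= !cI01_itv => /(_ (conj x01 y01)) /cvgrPdist_lt /(_ e e0).
move=> /nbhs_ballP [d d0 dH]; exists d => // s t s01 t01 sx ty.
rewrite distrC; apply: (dH (s, t)); last by rewrite /= !cI01_itv.
by split; rewrite -ball_normE /= distrC.
Qed.

Let u_bounded : exists C, forall x y : R, 0 <= x <= 1 -> 0 <= y <= 1 -> `|u x y| <= C.
Proof.
have cp : compact (cI01 `*` cI01 : set (R * R)).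
  by apply: compact_setX; exact: segment_compact.
have /compact_bounded [M [_ MH]] := continuous_compact (ss_cont S) cp.
exists (M + 1) => x y x01 y01; apply: (MH (M + 1)); first by rewrite ltrDl.
by exists (x, y) => //; split; rewrite /= cI01_itv.
Qed.

Let u_slice (x : R) : 0 <= x <= 1 -> {within cI01, continuous (u x)}.
Proof.
move=> x01; apply/within_cI01_continuousP => y y01 e e0.
have [d d0 dH] := cont x01 y01 e0; exists d => // z z01 zy; apply: dH => //.
by rewrite subrr normr0.
Qed.

Let L2u (x : R) : 0 <= x <= 1 -> L2 (u x).
Proof. by move=> /u_slice; exact: L2_continuous. Qed.

Let Cu : C01 L2 normL2 u.
Proof.
apply: C01I => [f|x|x x01 e e0]; [exact: normL2_ge0|exact: L2u|].
(* By contradiction, because dominated convergence concerns sequences: points [z n] tending to $x$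
   along which the norm stays at least $e$. *)
apply: contrapT => H.
have {}H n : exists z : R, [/\ 0 <= z <= 1, `|z - x| < n.+1%:R^-1 &
    e <= normL2 (u z \- u x)].
  apply: contrapT => H'; apply: H; exists n.+1%:R^-1; first by rewrite invr_gt0.
  move=> z z01 zx; rewrite ltNge; apply/negP => h; apply: H'.
  by exists z; split.
have /boolp.choice [z zH] := H; have [C CH] := u_bounded.
have lz n : L2 (u (z n)) by have [h _ _] := zH n; exact: L2u.
have lC : L2 (fun=> C : R) by exact: L2_cst.
have b n y : I01 y -> `|u (z n) y| <= C.
  by rewrite I01_itv => /andP[y0 y1]; have [h _ _] := zH n; rewrite CH// !ltW.
have cvg y : I01 y -> u (z n) y @[n --> \oo] --> u x y.
  rewrite I01_itv => /andP[y0 y1]; apply/cvgrPdist_lt => a a0.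
  have y01 : 0 <= y <= 1 by rewrite !ltW.
  have [d d0 dH] := cont x01 y01 a0; near=> n; rewrite distrC.
  have [z01 zx _] := zH n; apply: dH => //; last by rewrite subrr normr0.
  apply: lt_trans zx _; near: n.
  by have := near_infty_natSinv_lt (PosNum d0).
have [n] := L2_dominated_cvg lC (L2u x01) lz b cvg e0.
have [_ _ eh] := zH n; rewrite normL2C//; last exact: L2u.
by rewrite ltNge eh.
Unshelve. all: by end_near. Qed.

Let ip_u psi (x : R) : test_fun I01 psi -> 0 <= x <= 1 ->
  ip (u x) psi = ip (u 0) psi + prim (fun s => ip (V s) psi) x.
Proof.
move=> tpsi x01; have lpsi := L2_test tpsi.
have [LUx UUx] := dUx; have [LUxx UUxx] := dUxx.
have [c Vc _] := ip_trace LUx LUxx UUxx tpsi.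
have h := is_wderiv_eqae (eqae_refl _) Vc (row_wpartial_x tpsi L2U LUx UUx).
exact: (wderiv_continuous (continuous_ip_cst Cu lpsi) (continuous_ip_cst CV lpsi) h).
Qed.

(** Paired with a test function, the difference quotient is the mean of $\langle V(s),\psi\rangle$
    over the interval, close to $\langle V(x),\psi\rangle$ uniformly relative to $\|\psi\|$.
    [normL2_by_tests] turns this into convergence in norm. *)
Let dx_trace (x : R) : 0 <= x <= 1 -> is_dx u x (V x).
Proof.
move=> x01; have lV (z : R) : 0 <= z <= 1 -> L2 (V z) by exact: (C01_mem CV).
apply/(is_dx_cI01P _ _ x01); split; first exact: lV.
move=> e e0; have e2 : 0 < e / 2 by rewrite divr_gt0.
have [d d0 dH] := C01_eps CV x01 e2; exists d => // z z01 zx zd.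
have lq := L2_quotient z x (L2u z01) (L2u x01).
apply: le_lt_trans (_ : e / 2 < e); last by rewrite gtr_pMr// invf_lt1// ltr1n.
apply: normL2_by_tests (ltW e2); first exact: L2B lq (lV _ x01).
move=> psi tpsi; have lpsi := L2_test tpsi.
have lg : L2 (fun s => ip (V s) psi).
  exact: L2_continuous (continuous_ip_cst CV lpsi).
rewrite (ipBl lq (lV _ x01) lpsi).
have -> : ip (fun y => (u z y - u x y) / (z - x)) psi =
    (prim (fun s => ip (V s) psi) z - prim (fun s => ip (V s) psi) x) / (z - x).
  rewrite (_ : (fun y => _) = (fun y => (z - x)^-1 * (u z \- u x) y)); last first.
    by apply/funext => y; rewrite mulrC.
  rewrite (ipZl _ (L2B (L2u z01) (L2u x01)) lpsi) (ipBl (L2u z01) (L2u x01) lpsi).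
  rewrite (ip_u tpsi z01) (ip_u tpsi x01) mulrC.
  move: (ip _ _) (prim _ z) (prim _ x) => a b c.
  by rewrite opprD addrACA subrr add0r.
(* Stated for ordered ends, since $x$ may be the left or the right one. *)
have key (a b : R) : 0 <= b <= a -> a <= 1 -> b < a -> (forall s, b <= s <= a -> `|s - x| < d) ->
    `|(prim (fun s => ip (V s) psi) a - prim (fun s => ip (V s) psi) b) / (a - b) -
      ip (V x) psi| <= e / 2 * normL2 psi.
  move=> ba a1 lba sH; have ab0 : 0 < a - b by rewrite subr_gt0.
  have near s : 0 < s < 1 -> b <= s < a -> `|ip (V s) psi - ip (V x) psi| <= e / 2 * normL2 psi.
    move=> /andP[s0 s1] /andP[bs sa]; have s01 : 0 <= s <= 1 by rewrite !ltW.
    rewrite -(ipBl (lV _ s01) (lV _ x01) lpsi).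
    apply: le_trans (ip_CS (L2B (lV _ s01) (lV _ x01)) lpsi) _.
    rewrite ler_wpM2r ?normL2_ge0//; apply: ltW; apply: dH => //; apply: sH.
    by rewrite bs ltW.
  have := prim_increment lg ba a1 near.
  rewrite -(ler_pM2r (x := (a - b)^-1)) ?invr_gt0// mulfK ?gt_eqF//.
  rewrite -[X in _ * X <= _](gtr0_norm (x := (a - b)^-1)) ?invr_gt0// -normrM mulrBl.
  by rewrite mulfK ?gt_eqF.
case/andP: (x01) => x0 x1; case/andP: (z01) => z0 z1.
have [xz|zx'|E] := ltgtP x z; last by rewrite E eqxx in zx.
  apply: key => //; first by rewrite x0 ltW.
  move=> s /andP[xs sz]; rewrite ger0_norm ?subr_ge0//; apply: le_lt_trans zd.
  by apply: le_trans (ler_norm _); rewrite lerD2r.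
rewrite -[z - x]opprB invrN mulrN -mulNr opprB.
apply: key => //; first by rewrite z0 ltW.
move=> s /andP[zs sx]; rewrite distrC ger0_norm ?subr_ge0//; apply: le_lt_trans zd.
by rewrite distrC; apply: le_trans (ler_norm _); rewrite lerD2l lerN2.
Qed.

Let dx_V (x : R) : 0 <= x <= 1 -> is_dx u x (dx u x) /\ eqae (dx u x) (V x).
Proof.
move=> x01; have h := dx_trace x01; have h' := dx_is_dx h; split => //.
exact: is_dx_unique x01 (fun z => @L2u z) h' h.
Qed.

Lemma exact_is_dx (x : R) : 0 <= x <= 1 -> is_dx u x (dx u x).
Proof. by case/dx_V. Qed.

Lemma exact_dx_C01 : C01 L2 normL2 (dx u).
Proof.
apply: C01_eqae CV _ _ => x x01; have [h1 h2] := dx_V x01; last exact: h2.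
by case: h1.
Qed.

Lemma exact_dx_init : eqae (dx u 0) (fun=> 0).
Proof.
have z01 : 0 <= (0 : R) <= 1 by rewrite lexx ler01.
have [h _] := dx_V z01.
exact: is_dx_unique z01 (fun z => @L2u z) h (ss_init_dx S).
Qed.

Let Y_row psi : test_fun I01 psi -> eqae (row psi Uy) (fun s => ip (Y s) psi).
Proof.
move=> tpsi; have [LUy _] := dUy; have [LUyx UUyx] := dUyx.
by have [c h _] := ip_trace LUy LUyx UUyx tpsi.
Qed.

(** For each test function the two sides are continuous in $x$ and agree almost everywhere; the null
    set depends on the test function, but continuity removes it. *)
Let wderiv_u (x : R) : 0 <= x <= 1 -> is_wderiv (u x) (Y x).
Proof.
move=> x01 psi tpsi; have [LUy UUy] := dUy.
have lpsi := L2_test tpsi; have ldpsi := L2_test_derive tpsi.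
have E : eqae (fun s => ip (u s) ('D_1 psi)) (fun s => - ip (Y s) psi).
  have := Y_row tpsi; apply: filterS2 (row_wpartial_y tpsi L2U LUy UUy).
  by move=> s h1 h2 Is; have := h1 Is; rewrite rowE /= h2.
have c2 : {within cI01, continuous (fun s => - ip (Y s) psi)}.
  exact: within_continuousN (continuous_ip_cst CY lpsi).
apply: (eqae_continuous (continuous_ip_cst Cu ldpsi) c2 E).
by rewrite cI01_itv.
Qed.

Let H1u (x : R) : 0 <= x <= 1 -> H1 (u x) /\ eqae (wderiv (u x)) (Y x).
Proof. by move=> x01; exact: H1I (L2u x01) (C01_mem CY x01) (wderiv_u x01). Qed.

Lemma exact_wderiv_C01 : C01 L2 normL2 (fun x => wderiv (u x)).
Proof.
apply: C01_eqae CY _ _ => x /H1u [h1 h2]; last exact: h2.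
by have [] := H1_wderiv h1.
Qed.

Lemma exact_C01 : C01 H10 normH1 u.
Proof.
apply: C01I => [f|x x01|x x01 e e0]; first exact: normH1_ge0.
  have [h _] := H1u x01; have [| z o] := ss_lateral S (x := x); first by rewrite cI01_itv.
  exact: H10_boundary h (u_slice x01) z o.
have e2 : 0 < e / 2 by rewrite divr_gt0.
have [d d0 dH] := C01_eps Cu x01 e2.
have [d' d'0 d'H] := C01_eps exact_wderiv_C01 x01 e2.
exists (Num.min d d'); first by rewrite lt_min d0.
move=> z z01; rewrite lt_min => /andP[zd zd'].
have [hz _] := H1u z01; have [hx _] := H1u x01; have [hB wB] := H1B hz hx.
apply: le_lt_trans (normH1_le _) _; rewrite (splitr e); apply: ltrD; first exact: dH.
rewrite (normL2_eqae _ _ wB); first exact: d'H.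
  by have [] := H1_wderiv hB.
have [? _] := H1_wderiv hz; have [? _] := H1_wderiv hx.
exact: L2B.
Qed.

Let laplace_row psi : test_fun I01 psi -> eqae (row psi Uxx) (\- row psi Uyy).
Proof.
move=> tpsi; have [LUxx _] := dUxx; have [LUyy _] := dUyy.
have l1 := L2_row tpsi LUxx; have l2 := L2_row tpsi LUyy.
apply: eqae_subr0; apply: test_orth; first exact: L2B l1 (L2N l2).
move=> phi tphi; have lphi := L2_test tphi.
rewrite (ipBl l1 (L2N l2) lphi) (ipNl l2 lphi) opprK.
apply: etrans (esym (congr2 +%R (row_tensor tphi tpsi LUxx) (row_tensor tphi tpsi LUyy))) _.
have [C phiC] := test_bounded tphi; have [C' psiC] := test_bounded tpsi.
have [s1 _ _] := tphi; have [s2 _ _] := tpsi.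
have st : sqint mu2 Sq (tensor phi psi).
  apply: (@sqint_bounded_Sq _ _ (C * C')).
    apply: measurable_funM; [apply: measurable_fst_comp|apply: measurable_snd_comp];
      exact: smooth_measurable.
  by move=> z; rewrite normrM; apply: ler_pM.
have i1 := integrable_sqintM (@measurable_Sq R) ((L2Sq_sqint _).1 LUxx) st.
have i2 := integrable_sqintM (@measurable_Sq R) ((L2Sq_sqint _).1 LUyy) st.
apply: etrans (esym (RintegralD (@measurable_Sq R) i1 i2)) _.
rewrite (@ae_eq_Rintegral _ _ _ mu2 Sq _ (fun=> 0)).
  by rewrite /Rintegral integral0.
have := ss_laplace S; apply: filterS => z /[apply] /= E.
by rewrite -mulrDl E mul0r.
Qed.

(** $\langle u_{xx},\psi\rangle=-\langle u_{yy},\psi\rangle=\langle u_y,\psi'\rangle$ for almost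
    every $x$. *)
Let Uxx_row psi : test_fun I01 psi ->
  eqae (row psi Uxx) (fun s => ip (Y s) ('D_1 psi)).
Proof.
move=> tpsi; have [LUy _] := dUy; have [LUyy UUyy] := dUyy.
apply: eqae_trans (laplace_row tpsi) _.
apply: eqae_trans (Y_row (test_derive tpsi)).
exact: eqae_sym (row_wpartial_y tpsi LUy LUyy UUyy).
Qed.

Let V0 psi : ip (V 0) psi = 0.
Proof.
have z01 : 0 <= (0 : R) <= 1 by rewrite lexx ler01.
have [_ h] := dx_V z01.
by rewrite -(ip_eqae _ h) (ip_eqae _ exact_dx_init) ip0l.
Qed.

Let evolution_test psi (x : R) : test_fun I01 psi -> 0 <= x <= 1 ->
  ip (V x) psi = prim (fun s => ip (Y s) ('D_1 psi)) x.
Proof.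
move=> tpsi x01; have [LUx _] := dUx; have [LUxx UUxx] := dUxx.
have [c _ E] := ip_trace LUx LUxx UUxx tpsi.
have c0 : c = 0 by have := E 0; rewrite V0 prim_le0// addr0.
by rewrite [LHS]E c0 add0r; exact: prim_eqae (Uxx_row tpsi).
Qed.

(** The integrated form of $u_{xx}=-u_{yy}$, with $u_x(0)=0$. It is known for test functions and
    passes to $H^1_0$ by density, since $\|u_x\|$ and $\|u_y\|$ are bounded uniformly in $x$. *)
Lemma exact_evolution psi (x : R) : H10 psi -> 0 <= x <= 1 ->
  ip (dx u x) psi = prim (fun s => ip (wderiv (u s)) (wderiv psi)) x.
Proof.
move=> hpsi x01; have hpsi1 := H10_H1 hpsi; have [lw _] := H1_wderiv hpsi1.
have [_ h] := dx_V x01; rewrite (ip_eqae _ h).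
have lpsi := H1_L2 hpsi1.
have -> : prim (fun s => ip (wderiv (u s)) (wderiv psi)) x =
    prim (fun s => ip (Y s) (wderiv psi)) x.
  apply: prim_eqae; apply: aeW => s; rewrite I01_itv => /andP[s0 s1].
  by apply: ip_eqae; apply: (H1u _).2; rewrite !ltW.
have [M M0 MV] := C01_bounded CV; have [K K0 KY] := C01_bounded CY.
apply: L2_le_eps => e e0.
have MK : 0 < M + K + 1 by rewrite ltr_wpDl// addr_ge0.
have [phi [tphi hphi]] := hpsi.2 _ (divr_gt0 e0 MK).
have lphi := L2_test tphi; have ldphi := L2_test_derive tphi.
have [hphi1 wphi] := H1_test tphi.
have lg : L2 (fun s => ip (Y s) (wderiv psi)).
  exact: L2_continuous (continuous_ip_cst CY lw).
have lg' : L2 (fun s => ip (Y s) ('D_1 phi)).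
  exact: L2_continuous (continuous_ip_cst CY ldphi).
have -> : ip (V x) psi - prim (fun s => ip (Y s) (wderiv psi)) x =
    ip (V x) (psi \- phi) -
    prim ((fun s => ip (Y s) (wderiv psi)) \- (fun s => ip (Y s) ('D_1 phi))) x.
  have arith (a b c d p q : R) : p = a - b -> q = c - d -> b = d -> a - c = p - q.
    by move=> -> -> ->; ring.
  exact: arith (ipBr lpsi lphi (C01_mem CV x01)) (primB x lg lg') (evolution_test tphi x01).
apply: le_trans (ler_normB _ _) _.
have b1 : `|ip (V x) (psi \- phi)| <= M * normH1 (psi \- phi).
  apply: le_trans (ip_CS (C01_mem CV x01) (L2B lpsi lphi)) _.
  by apply: ler_pM; rewrite ?normL2_ge0 ?MV ?normL2_le_H1.
have b2 : `|prim ((fun s => ip (Y s) (wderiv psi)) \- (fun s => ip (Y s) ('D_1 phi))) x|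
    <= K * normH1 (psi \- phi).
  apply: le_trans (prim_bound _ (L2B lg lg')) _.
  apply: normL2_le_sup; [exact: L2B|by rewrite mulr_ge0 ?normH1_ge0|].
  move=> s; rewrite I01_itv => /andP[s0 s1]; have s01 : 0 <= s <= 1 by rewrite !ltW.
  have lY := C01_mem CY s01.
  rewrite -[_ s]/(ip (Y s) (wderiv psi) - ip (Y s) ('D_1 phi)).
  rewrite -(ip_eqaer _ wphi); have [lwphi _] := H1_wderiv hphi1.
  rewrite -(ipBr lw lwphi lY); apply: le_trans (ip_CS lY (L2B lw lwphi)) _.
  by apply: ler_pM; rewrite ?normL2_ge0 ?KY//; exact: normL2_wderivB.
apply: le_trans (lerD b1 b2) _; rewrite -mulrDl.
move/ltW: hphi; rewrite ler_pdivlMr// mulrC; apply: le_trans.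
by rewrite ler_wpM2r ?normH1_ge0// lerDl.
Qed.

(** Here no continuity in $x$ is available for $u_{yy}$, so one null set must serve all test
    functions: the countable family accepted by [wderiv_prim] makes this possible. *)
Let H2u : {ae mu, forall x, I01 x -> H2 (u x)}.
Proof.
have [LUy UUy] := dUy; have [LUyy UUyy] := dUyy.
have ts (i : rat * rat * nat) : 0 < ratr i.1.1 :> R -> ratr i.1.2 < 1 :> R ->
    test_fun I01 (J (@cbump R i.1.1 i.1.2 i.2)).
  exact: test_J_cbump.
have A (i : rat * rat * nat) : {ae mu, forall x, I01 x ->
    0 < ratr i.1.1 :> R -> ratr i.1.2 < 1 :> R ->
    ip (Y x) ('D_1 (J (cbump i.1.1 i.1.2 i.2))) =
    - ip (fun y => Uyy (x, y)) (J (cbump i.1.1 i.1.2 i.2))}.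
  have [h1|h1] := boolP (0 < ratr i.1.1 :> R); last first.
    by apply: aeW => x _ h; case/negP: h1.
  have [h2|h2] := boolP (ratr i.1.2 < 1 :> R); last first.
    by apply: aeW => x _ _ h; case/negP: h2.
  have t := ts i h1 h2.
  have := row_wpartial_y t LUy LUyy UUyy; apply: filterS2 (Y_row (test_derive t)).
  by move=> x e1 e2 Ix _ _; rewrite -[LHS](e1 Ix) (e2 Ix).
(* The triples $(q,r,n)$ are enumerated by natural numbers, so that a countable union of null sets
   applies. *)
have B : {ae mu, forall x, forall n, if unpickle n is Some i then
    I01 x -> 0 < ratr (i : rat * rat * nat).1.1 :> R -> ratr i.1.2 < 1 :> R ->
    ip (Y x) ('D_1 (J (cbump i.1.1 i.1.2 i.2))) =
    - ip (fun y => Uyy (x, y)) (J (cbump i.1.1 i.1.2 i.2)) else True}.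
  apply: ae_foralln => n; case: (unpickle n) => [i|]; [exact: A|exact: aeW].
have sl : {ae mu, forall x, I01 x -> L2 (fun y => Uyy (x, y))}.
  exact: slice_L2 (L2Sq_swap LUyy).
apply: ae_imp2 B sl _ => x h l Ix.
have x01 : 0 <= x <= 1 by move: Ix; rewrite I01_itv => /andP[? ?]; rewrite !ltW.
have {}l := l Ix.
have [|c Yc] := wderiv_prim (C01_mem CY x01) l.
  by move=> q r n h1 h2; have := h (pickle (q, r, n)); rewrite pickleK => hh; exact: hh Ix h1 h2.
have [h1 h2] := H1u x01; split => //.
have hw : is_wderiv (Y x) (fun y => Uyy (x, y)).
  exact: is_wderiv_eqae (eqae_sym Yc) (eqae_refl _) (is_wderiv_prim c l).
have [hY _] := H1I (C01_mem CY x01) l hw.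
have [lw _] := H1_wderiv h1.
exact: H1_eqae lw (eqae_sym h2) hY.
Qed.

(** The relation between $P$ and $Q$ applies where $u(x)\in H^2$, that is for almost every $x$.
    After integration by parts in $y$ both sides are continuous in $x$, which gives every $x$. *)
Lemma exact_stab_pert P Q psi (x : R) : stab_pert_rel P Q ->
  C01 L2 normL2 (fun x => P (u x)) -> C01 L2 normL2 (fun x => Q (u x)) ->
  H10 psi -> 0 <= x <= 1 ->
  ip (P (u x)) psi = ip (Q (u x)) psi - 2 * ip (wderiv (u x)) (wderiv psi).
Proof.
move=> PQ CP CQ hpsi x01; have hpsi1 := H10_H1 hpsi.
have lpsi := H1_L2 hpsi1; have [lw _] := H1_wderiv hpsi1.
pose f x := ip (P (u x)) psi.
pose g x := -2 * ip (wderiv (u x)) (wderiv psi) + ip (Q (u x)) psi.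
suff : f x = g x by rewrite /f /g => ->; rewrite addrC mulNr.
have cf : {within cI01, continuous f} := continuous_ip_cst CP lpsi.
have cg : {within cI01, continuous g}.
  exact: within_continuousS (continuous_ip_cst exact_wderiv_C01 lw) (continuous_ip_cst CQ lpsi).
apply: (eqae_continuous cf cg); last by rewrite cI01_itv.
apply: ae_imp H2u _ => s h Is.
have s01 : 0 <= s <= 1 by move: Is; rewrite I01_itv => /andP[? ?]; rewrite !ltW.
have [h1 h2] := h Is; have [lww _] := H1_wderiv h2.
rewrite /f (ip_eqae _ (PQ _ (h Is) (C01_mem exact_C01 s01))).
have lQ := C01_mem CQ s01.
rewrite (_ : (fun y => _) = fun y => 2 * wderiv (wderiv (u s)) y + Q (u s) y); last first.
  by apply/funext => y; rewrite addrC.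
by rewrite (ipSl 2 lww lQ lpsi) (ip_wderiv h2 hpsi) /g mulrN mulNr.
Qed.

End strong.

End exact_solution.

(** * The energy identity *)

Section energy_identity.
Context {R : realType}.
Implicit Types (f df : R -> R) (x d e : R).

Lemma is_derive_eps f x d : is_derive x 1 f d <->
  forall e : R, 0 < e -> exists2 r : R, 0 < r &
    forall z, `|z - x| < r -> `|f z - f x - d * (z - x)| <= e * `|z - x|.
Proof.
split=> [fd e e0|H].
  have [/cvg_ex[/= l]] := fd; move=> /[dup] hl /cvg_lim; rewrite -/(derive f x 1) => E dl.
  have {E} ld : l = d by rewrite -dl E.
  move: hl; rewrite ld => /cvgrPdist_lt /(_ e e0) /nbhs_ballP[r r0 rH].
  exists r => // z zx; have [->|zx0] := eqVneq z x.
    by rewrite !subrr mulr0 subr0 normr0 mulr0.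
  have zx1 : z - x != 0 by rewrite subr_eq0.
  have := rH (z - x); rewrite -ball_normE /= sub0r normrN => /(_ zx zx1) /ltW.
  rewrite [_ *: 1]mulr1 subrK => h.
  rewrite -ler_pdivrMr ?normr_gt0// -normfV -normrM mulrBl mulfK// distrC.
  by rewrite [_ / _]mulrC.
apply: is_derive_quotient; apply/cvgrPdist_le => e e0; have [r r0 rH] := H e e0.
apply/nbhs_ballP; exists r => // k; rewrite -ball_normE /= sub0r normrN => kr k0.
have := rH (k + x); rewrite addrK => /(_ kr).
rewrite -ler_pdivrMr ?normr_gt0// -normfV -normrM mulrBl mulfK// distrC.
by rewrite [_ / _]mulrC.
Qed.

Lemma is_derive_cont f x d : is_derive x 1 f d -> {for x, continuous f}.
Proof. by move=> [fd _]; exact/differentiable_continuous/derivable1_diffP. Qed.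

Lemma is_derive_shift f x d (h : R) : is_derive (x + h) 1 f d ->
  is_derive x 1 (fun x => f (x + h)) d.
Proof.
move=> /is_derive_eps H; apply/is_derive_eps => e /H[r r0 rH]; exists r => // z zx.
by have := rH (z + h); rewrite opprD addrACA subrr addr0; apply.
Qed.

Lemma mvt f df (a b : R) : a < b -> (forall x, a <= x <= b -> is_derive x 1 f (df x)) ->
  exists2 c, a < c < b & f b - f a = df c * (b - a).
Proof.
move=> ab fd; have [|c|c] := @MVT R f df a b ab.
- by move=> x; rewrite in_itv /= => /andP[ax xb]; apply: fd; rewrite !ltW.
- apply: continuous_in_subspaceT => x; rewrite inE /= in_itv /= => xab.
  exact: is_derive_cont (fd x xab).
- by rewrite in_itv /= => cab e; exists c.
Qed.

(* Used with [J s t = <w_x s, w t>], [A s t = <w_x s, w_x t>],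
   [D s t = A s t - <w_y s, w_y t>], [K s t = <F s, w t>] and
   [Phi s t = <F s, w_x t>], where [w_xx = w_yy + F] weakly: then [2 A - D] on the
   diagonal is the energy, although [w_x] cannot be used as a test function. *)
Section symmetric_difference.
Variables (J A K Phi D : R -> R -> R).
Local Notation I x := (0 < x < 1).
Hypothesis D_sym : forall s t, D s t = D t s.
Hypothesis J_shift : forall x h, I x -> I (x + h) ->
  is_derive x 1 (fun x => J x (x + h)) (D x (x + h) + K x (x + h)).
Hypothesis J_diag : forall x, I x -> is_derive x 1 (J x) (A x x).
Hypothesis K_snd : forall s t : R, I s -> I t -> is_derive t 1 (K s) (Phi s t).
Hypothesis D_cont : forall x e, I x -> 0 < e -> exists2 r : R, 0 < r &
  forall s t : R, I s -> I t -> `|s - x| < r -> `|t - x| < r -> `|D s t - D x x| < e.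
Hypothesis Phi_cont : forall x e, I x -> 0 < e -> exists2 r : R, 0 < r &
  forall s t : R, I s -> I t -> `|s - x| < r -> `|t - x| < r -> `|Phi s t - Phi x x| < e.
Hypothesis D_prim : forall h, exists Th : R -> R,
  forall x, I x -> I (x + h) -> is_derive x 1 Th (D x (x + h)).

Let Th h := sval (cid (D_prim h)).
Let ThP h x : I x -> I (x + h) -> is_derive x 1 (Th h) (D x (x + h)).
Proof. by move: x; exact: svalP (cid (D_prim h)). Qed.

(* [G h] tends to the diagonal of [2 A - D] as h tends to 0; in its derivative the
   terms in [D] cancel by symmetry, which leaves a difference of [K]. *)
Let G h x := (J x (x + h) - J x (x - h)) / h - (Th h x - Th h (x - h)) / h.

Let dG h x : 0 < h -> I (x - h) -> I x -> I (x + h) ->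
  is_derive x 1 (G h) ((K x (x + h) - K x (x - h)) / h).
Proof.
move=> h0 h1 h2 h3; have d1 := J_shift h2 h3; have d2 := J_shift h2 h1.
have d3 := ThP h2 h3; have h2' : I (x - h + h) by rewrite subrK.
have d4 := ThP h1 h2'.
have d5 : is_derive x 1 (fun x => Th h (x - h)) (D (x - h) (x - h + h)).
  exact: is_derive_shift d4.
have dd := is_derive_lin h^-1 (is_derive_lin (-1) d2 d1)
  (is_derive_lin (- h^-1) (is_derive_lin (-1) d5 d3) (is_derive_cst (0 : R) x 1)).
have -> : G h = fun x => h^-1 * (-1 * J x (x - h) + J x (x + h)) +
    (- h^-1 * (-1 * Th h (x - h) + Th h x) + 0).
  by apply/funext => z; rewrite /G; ring.
by apply: (is_derive_eq dd); rewrite subrK (D_sym (x - h)); ring.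
Qed.

(** The first quotient is a central difference of [J x] at $x$, over a step $2h$ but divided by $h$,
    and tends to $2A(x,x)$. By the mean value theorem the second is some $D(y,y+h)$ with $y$ near
    $x$. *)
Let limG x e : I x -> 0 < e -> exists2 r : R, 0 < r &
  forall h, 0 < h < r -> `|G h x - (2 * A x x - D x x)| <= e.
Proof.
move=> Ix e0; have e4 : 0 < e / 4 by rewrite divr_gt0.
have [r1 r10 H1] := (is_derive_eps _ _ _).1 (J_diag Ix) _ e4.
have [r2 r20 H2] := D_cont Ix e4.
have /andP[x0 x1] : I x := Ix.
exists (Num.min (Num.min r1 r2) (Num.min x (1 - x))).
  by rewrite !lt_min r10 r20 x0 subr_gt0.
move=> h /andP[h0]; rewrite !lt_min => /andP[/andP[hr1 hr2] /andP[hx hx1]].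
have lt : x - h < x by rewrite ltrBlDr ltrDl.
have [y yP]: exists2 y, x - h < y < x & (Th h x - Th h (x - h)) / h = D y (y + h).
  have [z zx|y yP E] := @mvt (Th h) (fun y => D y (y + h)) _ _ lt.
    by apply: ThP; lra.
  by exists y => //; rewrite E opprB addrCA subrr addr0 mulfK// gt_eqF.
move=> E; rewrite /G E.
have b1 : `|D y (y + h) - D x x| <= e / 4.
  apply: ltW; apply: H2; [lra|lra| |].
    by rewrite ltr_norml; lra.
  by rewrite ltr_norml; lra.
have b2 : `|J x (x + h) - J x x - A x x * h| <= e / 4 * h.
  have := H1 (x + h); rewrite addrAC subrr add0r gtr0_norm//; exact.
have b3 : `|J x (x - h) - J x x + A x x * h| <= e / 4 * h.
  have := H1 (x - h); rewrite addrAC subrr add0r normrN gtr0_norm// mulrN opprK; exact.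
have -> : (J x (x + h) - J x (x - h)) / h - D y (y + h) - (2 * A x x - D x x) =
  ((J x (x + h) - J x x - A x x * h) - (J x (x - h) - J x x + A x x * h)) / h -
  (D y (y + h) - D x x).
  by field; rewrite gt_eqF.
apply: le_trans (ler_normB _ _) _; rewrite normrM normfV (gtr0_norm h0).
have : `|J x (x + h) - J x x - A x x * h - (J x (x - h) - J x x + A x x * h)| / h <= e / 2.
  rewrite ler_pdivrMr//; apply: le_trans (ler_normB _ _) _.
  by apply: le_trans (lerD b2 b3) _; lra.
by move: b1; lra.
Qed.

(** The increments of [G h] are estimated uniformly in $h$ by two uses of the mean value theorem, in
    $x$ for [G h] and in the second argument for [K]; the estimate then passes to the limit in
    $h$. *)
Lemma symmetric_difference_derive x : I x ->
  is_derive x 1 (fun x => 2 * A x x - D x x) (2 * Phi x x).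
Proof.
move=> Ix; apply/is_derive_eps => e e0; have e2 : 0 < e / 2 by rewrite divr_gt0.
have [r0 r00 H] := Phi_cont Ix e2; have /andP[x0 x1] : I x := Ix.
(* Half the available room: later $h<r$, so points within $r$ of $x$, shifted by at most $h$, remain
   in $(0,1)$ and within [r0] of $x$. *)
pose r := Num.min r0 (Num.min x (1 - x)) / 2.
have rgt0 : 0 < r by rewrite divr_gt0// !lt_min r00 x0 subr_gt0.
have r2 : 2 * r = Num.min r0 (Num.min x (1 - x)) by rewrite /r; field.
have : 2 * r <= r0 by rewrite r2 ge_min lexx.
have : 2 * r <= x by rewrite r2 !ge_min lexx !orbT.
have : 2 * r <= 1 - x by rewrite r2 !ge_min lexx !orbT.
move: {r2} r rgt0 => r rgt0 rx1 rx rr0; exists r => // z zx.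
have zx' := zx; rewrite ltr_norml in zx'.
have Iz : I z by lra.
(* With $z$ fixed, $h$ is taken so small that [G h] is within $a/2$ of its limit at both $x$ and
   $z$; $a$ is arbitrary. *)
apply/ler_addgt0Pr => a a0; have a2 : 0 < a / 2 by rewrite divr_gt0.
have [s1 s10 L1] := limG Ix a2; have [s2 s20 L2] := limG Iz a2.
pose h := Num.min r (Num.min s1 s2) / 2.
have hm : 0 < Num.min r (Num.min s1 s2) by rewrite !lt_min rgt0 s10.
have h0 : 0 < h by rewrite divr_gt0.
have hlt : h < Num.min r (Num.min s1 s2) by rewrite /h ltr_pdivrMr// ltr_pMr// ltr1n.
move: hlt; rewrite !lt_min => /andP[hr /andP[h1 h2]].
have {}L1 := L1 h; have {}L2 := L2 h; rewrite h0 in L1 L2.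
have {}L1 := L1 h1; have {}L2 := L2 h2; move: {hm} h h0 hr h1 h2 L1 L2 => h h0 hr _ _ L1 L2.
have key c d : `|c - x| < r -> `|d - x| < r -> c < d ->
    `|G h d - G h c - 2 * Phi x x * (d - c)| <= e * (d - c).
  rewrite !ltr_norml => cx dx cd.
  have [y ycd|y ycd ->] := @mvt (G h) (fun x => (K x (x + h) - K x (x - h)) / h) c d cd.
    by apply: dG => //; lra.
  have hh : y - h < y + h by lra.
  have [t t1|t tP ->] := @mvt (K y) (Phi y) _ _ hh.
    by apply: K_snd; lra.
  (* The interval from $y-h$ to $y+h$ has length $2h$: this is the origin of the factor 2. *)
  have -> : Phi y t * (y + h - (y - h)) / h = 2 * Phi y t.
    by field; rewrite gt_eqF.
  have dc0 : 0 < d - c by rewrite subr_gt0.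
  rewrite -mulrBl -mulrBr !normrM (gtr0_norm dc0) (ler_pM2r dc0) ger0_norm//.
  have Iy : I y by lra.
  have It : I t by lra.
  have : `|y - x| < r0 by rewrite ltr_norml; lra.
  have : `|t - x| < r0 by rewrite ltr_norml; lra.
  by move=> tx yx; have := H y t Iy It yx tx; lra.
have {}key : `|G h z - G h x - 2 * Phi x x * (z - x)| <= e * `|z - x|.
  have xx : `|x - x| < r by rewrite subrr normr0.
  have [xz|zlx|E] := ltgtP x z; last by rewrite E !subrr mulr0 subr0 normr0 mulr0.
    by rewrite [X in _ <= _ * X]gtr0_norm ?subr_gt0//; exact: key.
  rewrite [X in _ <= _ * X]distrC [X in _ <= _ * X]gtr0_norm ?subr_gt0//.
  have := key z x zx xx zlx; rewrite -normrN; congr (_ <= _); congr (`|_|); ring.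
move: key L1 L2; move: (G h z) (G h x) (2 * A z z - D z z) (2 * A x x - D x x) => g1 g2 b1 b2.
move: (e * _) (2 * _ * _) => c1 c2; rewrite !ler_norml; lra.
Qed.

End symmetric_difference.
End energy_identity.

(** * Energy inequality and Gronwall's lemma *)

Section energy_estimate.
Context {R : realType}.
Implicit Types (f g h psi : R -> R) (v w z : R -> R -> R) (x : R).
Opaque L2 normL2 ip prim wderiv normH1.

Lemma C01_H10_L2 w : C01 H10 normH1 w -> C01 L2 normL2 w.
Proof.
move=> cw; apply: C01I => [f|x x01|x x01 e e0]; first exact: normL2_ge0.
  exact: H1_L2 (H10_H1 (C01_mem cw x01)).
have [d d0 dH] := C01_eps cw x01 e0; exists d => // z z01 zx.
exact: le_lt_trans (normL2_le_H1 _) (dH z z01 zx).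
Qed.

Lemma C01_H10_wderiv w : C01 H10 normH1 w -> C01 L2 normL2 (fun x => wderiv (w x)).
Proof.
move=> cw; apply: C01I => [f|x x01|x x01 e e0]; first exact: normL2_ge0.
  by have [] := H1_wderiv (H10_H1 (C01_mem cw x01)).
have [d d0 dH] := C01_eps cw x01 e0; exists d => // z z01 zx.
apply: le_lt_trans (normL2_wderivB _ _) (dH z z01 zx).
  exact: H10_H1 (C01_mem cw z01).
exact: H10_H1 (C01_mem cw x01).
Qed.

Lemma within_continuous_at f x : {within cI01, continuous f} -> 0 < x < 1 ->
  {for x, continuous f}.
Proof.
move=> /within_cI01_continuousP cf /andP[x0 x1]; apply/cvgrPdist_lt => e e0.
have x01 : 0 <= x <= 1 by rewrite !ltW.
have [d d0 dH] := cf x x01 e e0.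
have m0 : 0 < Num.min d (Num.min x (1 - x)) by rewrite !lt_min d0 x0 subr_gt0.
apply/nbhs_ballP; exists (Num.min d (Num.min x (1 - x))) => // z.
rewrite /= !lt_min distrC => /andP[zd /andP[zx z1]].
rewrite distrC; apply: dH zd; move: zx z1; rewrite !ltr_norml; lra.
Qed.

Lemma is_derive_cI01 f g x d : (forall x, 0 <= x <= 1 -> f x = g x) -> 0 < x < 1 ->
  is_derive x 1 g d -> is_derive x 1 f d.
Proof.
move=> fg /andP[x0 x1] /is_derive_eps H; apply/is_derive_eps => e /H[r r0 rH].
exists (Num.min r (Num.min x (1 - x))); first by rewrite !lt_min r0 x0 subr_gt0.
move=> z; rewrite !lt_min => /andP[zr /andP[zx z1]].
rewrite !fg; first exact: rH.
  by rewrite !ltW.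
by move: zx z1; rewrite !ltr_norml; lra.
Qed.

(** The curve [v], later $w_x$, is differentiated only after pairing with the fixed vector
    [z (x + h)]. The difference quotient of [z] converges in norm, and boundedness and continuity of
    [v] control the rest. *)
Lemma ip_product_rule v z (z1 : R -> R) x (h d : R) : C01 L2 normL2 v ->
  (forall x, 0 <= x <= 1 -> L2 (z x)) -> 0 < x < 1 -> 0 < x + h < 1 ->
  is_dx z (x + h) z1 -> is_derive x 1 (fun s => ip (v s) (z (x + h))) d ->
  is_derive x 1 (fun s => ip (v s) (z (s + h))) (d + ip (v x) z1).
Proof.
move=> cv lz xI /andP[y0 y1] dz /is_derive_eps dv; apply/is_derive_eps => e e0.
have /andP[x0 x1] := xI.
have x01 : 0 <= x <= 1 by rewrite !ltW.
have y01 : 0 <= x + h <= 1 by rewrite !ltW.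
have [M M0 vM] := C01_bounded cv.
have [lz1 {}dz] := (is_dx_cI01P _ _ y01).1 dz.
have e2 : 0 < e / 2 by rewrite divr_gt0.
have n0 := normL2_ge0 z1.
have N0 : 0 < M + normL2 z1 + 1 by rewrite ltr_wpDl// addr_ge0.
have eta0 : 0 < e / 2 / (M + normL2 z1 + 1) by rewrite divr_gt0.
set eta := _ / _ in eta0; have etaE : eta * (M + normL2 z1 + 1) = e / 2.
  by rewrite /eta divfK// gt_eqF.
have [r1 r10 H1] := dv _ e2; have [r2 r20 H2] := dz _ eta0.
have [r3 r30 H3] := C01_eps cv x01 eta0.
pose m := Num.min (Num.min x (1 - x)) (Num.min (x + h) (1 - (x + h))).
have m0 : 0 < m by rewrite !lt_min x0 y0 !subr_gt0 x1.
exists (Num.min (Num.min r1 r2) (Num.min r3 m)).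
  by rewrite (lt_min _ (Num.min r1 r2)) (lt_min _ r1) (lt_min _ r3) r10 r20 r30.
move=> s; rewrite !lt_min => /andP[/andP[s1 s2] /andP[s3 /andP[/andP[s4 s5] /andP[s6 s7]]]].
have [->|sx] := eqVneq s x; first by rewrite !subrr mulr0 subr0 normr0 mulr0.
have s01 : 0 <= s <= 1 by move: s4 s5; rewrite !ltr_norml; lra.
have t01 : 0 <= s + h <= 1 by move: s6 s7; rewrite !ltr_norml; lra.
have ts : s + h - (x + h) = s - x by rewrite opprD addrACA subrr addr0.
have sx0 : s - x != 0 by rewrite subr_eq0.
have {}H2 : normL2 (fun y => (z (s + h) y - z (x + h) y) / (s - x) - z1 y) < eta.
  rewrite -ts; apply: H2 => //; last by rewrite ts.
  by rewrite -subr_eq0 ts.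
have {}H1 := H1 s s1; have {}H3 := H3 s s01 s3; have vs := vM s s01.
have lvs := C01_mem cv s01; have lvx := C01_mem cv x01.
have lq : L2 (fun y => (z (s + h) y - z (x + h) y) / (s - x)).
  exact: L2_quotient (lz _ t01) (lz _ y01).
have qE : ip (v s) (fun y => (z (s + h) y - z (x + h) y) / (s - x)) * (s - x) =
    ip (v s) (z (s + h)) - ip (v s) (z (x + h)).
  rewrite (_ : (fun y => _) = (fun y => (s - x)^-1 * (z (s + h) \- z (x + h)) y)).
    rewrite (ipZr _ lvs (L2B (lz _ t01) (lz _ y01))) (ipBr (lz _ t01) (lz _ y01) lvs).
    by rewrite mulrC mulVKf.
  by apply/funext => y; rewrite mulrC.
have b1 := ip_CS lvs (L2B lq lz1); rewrite (ipBr lq lz1 lvs) in b1.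
have b2 := ip_CS (L2B lvs lvx) lz1; rewrite (ipBl lvs lvx lz1) in b2.
move: H1 qE b1 b2.
move: (ip (v s) (fun y => (z (s + h) y - z (x + h) y) / (s - x))) => q.
move: (ip (v s) (z (s + h))) (ip (v x) (z (x + h))) (ip (v s) (z (x + h))) => p1 p2 p3.
move: (ip (v s) z1) (ip (v x) z1) => p4 p5 H1 qE b1 b2.
have c1 : `|q - p4| <= M * eta.
  by apply: le_trans b1 _; apply: ler_pM; rewrite ?normL2_ge0// ltW.
have c2 : `|p4 - p5| <= eta * normL2 z1.
  by apply: le_trans b2 _; apply: ler_pM; rewrite ?normL2_ge0// ltW.
have -> : p1 - p2 - (d + p5) * (s - x) =
    (p3 - p2 - d * (s - x)) + ((q - p4) + (p4 - p5)) * (s - x).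
  by rewrite -[p1](subrK p3) -qE; ring.
apply: le_trans (ler_normD _ _) _; rewrite normrM [e](splitr e) mulrDl.
apply: lerD H1 _; rewrite ler_wpM2r//; apply: le_trans (ler_normD _ _) _.
apply: le_trans (lerD c1 c2) _; rewrite -etaE.
by rewrite !mulrDr mulr1 [M * _]mulrC lerDl ltW.
Qed.

Lemma ip_dx f z (z1 : R -> R) x : L2 f -> (forall x, 0 <= x <= 1 -> L2 (z x)) -> 0 < x < 1 ->
  is_dx z x z1 -> is_derive x 1 (fun s => ip f (z s)) (ip f z1).
Proof.
move=> lf lz x01 dz.
have x01' : 0 < x + 0 < 1 by rewrite addr0.
have dz' : is_dx z (x + 0) z1 by rewrite addr0.
have := ip_product_rule (C01_cst lf) lz x01 x01' dz' (is_derive_cst _ x 1).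
by under eq_fun do rewrite addr0; rewrite add0r.
Qed.

(** The projection onto $[0,1]$. It extends $s\mapsto D(s,s+h)$ continuously to the whole interval,
    so that a primitive exists. *)
Definition clip (t : R) : R := Num.max 0 (Num.min t 1).

Lemma clip01 t : 0 <= clip t <= 1.
Proof. by rewrite /clip le_max lexx /= ge_max ler01 ge_min lexx orbT. Qed.

Lemma clip_id t : 0 <= t <= 1 -> clip t = t.
Proof. by move=> /andP[t0 t1]; rewrite /clip min_l// max_r. Qed.

Lemma clip_lip s t : `|clip s - clip t| <= `|s - t|.
Proof.
wlog st : s t / s <= t.
  by move=> H; have [/H//|/ltW/H] := leP s t; rewrite distrC [X in _ <= X]distrC.
have [c1 c2] : clip s <= clip t /\ clip t - clip s <= t - s.
  rewrite /clip !maxEle !minEle; case: (leP s 1) => ?; case: (leP t 1) => ?;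
    case: (leP 0 s) => ?; case: (leP 0 t) => ?; rewrite ?ler01; split; lra.
by rewrite distrC [X in _ <= X]distrC !ger0_norm ?subr_ge0.
Qed.

Lemma C01_clip v (h : R) : C01 L2 normL2 v -> C01 L2 normL2 (fun s => v (clip (s + h))).
Proof.
move=> cv; apply: C01I => [f|x x01|x x01 e e0]; first exact: normL2_ge0.
  exact: C01_mem cv (clip01 _).
have [d d0 dH] := C01_eps cv (clip01 (x + h)) e0; exists d => // z z01 zx.
apply: dH (clip01 _) _; apply: le_lt_trans (clip_lip _ _) _.
by rewrite opprD addrACA subrr addr0.
Qed.

Section energy.
Variables w w1 F : R -> R -> R.
Hypothesis Cw : C01 H10 normH1 w.
Hypothesis dw : forall x, 0 <= x <= 1 -> is_dx w x (w1 x).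
Hypothesis Cw1 : C01 L2 normL2 w1.
Hypothesis CF : C01 L2 normL2 F.
Hypothesis evolution : forall psi x, H10 psi -> 0 <= x <= 1 ->
  ip (w1 x) psi = ip (w1 0) psi +
    prim (fun s => - ip (wderiv (w s)) (wderiv psi) + ip (F s) psi) x.

Let wd x := wderiv (w x).
Let Cwd : C01 L2 normL2 wd := C01_H10_wderiv Cw.
Let CwL : C01 L2 normL2 w := C01_H10_L2 Cw.

Let dw1 psi x : H10 psi -> 0 < x < 1 ->
  is_derive x 1 (fun s => ip (w1 s) psi) (- ip (wd x) (wderiv psi) + ip (F x) psi).
Proof.
move=> hpsi x01; have lpsi := H1_L2 (H10_H1 hpsi).
have [lwpsi _] := H1_wderiv (H10_H1 hpsi).
pose g s := - ip (wd s) (wderiv psi) + ip (F s) psi.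
have cg : {within cI01, continuous g}.
  rewrite (_ : g = fun s => -1 * ip (wd s) (wderiv psi) + ip (F s) psi); last first.
    by apply/funext => s; rewrite mulN1r.
  exact: within_continuousS (continuous_ip_cst Cwd lwpsi) (continuous_ip_cst CF lpsi).
have dg := is_derive_prim (L2_continuous cg) x01 (within_continuous_at cg x01).
apply: (is_derive_cI01 (g := fun s => ip (w1 0) psi + prim g s)) x01 _.
  by move=> s s01; rewrite (evolution hpsi s01).
by rewrite -[X in is_derive _ _ _ X]add0r; exact: (is_deriveD (is_derive_cst _ x 1) dg).
Qed.

Let A s t := ip (w1 s) (w1 t).
Let D s t := A s t - ip (wd s) (wd t).

Let D_cont x (e : R) : 0 < x < 1 -> 0 < e -> exists2 r : R, 0 < r &
  forall s t, 0 < s < 1 -> 0 < t < 1 -> `|s - x| < r -> `|t - x| < r ->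
    `|D s t - D x x| < e.
Proof.
move=> /andP[x0 x1] e0; have x01 : 0 <= x <= 1 by rewrite !ltW.
have e2 : 0 < e / 2 by rewrite divr_gt0.
have [d d0 dH] := ip_joint Cw1 Cw1 x01 x01 e2.
have [d' d'0 d'H] := ip_joint Cwd Cwd x01 x01 e2.
exists (Num.min d d'); first by rewrite lt_min d0.
move=> s t /andP[s0 s1] /andP[t0 t1]; rewrite !lt_min => /andP[sd sd'] /andP[td td'].
have s01 : 0 <= s <= 1 by rewrite !ltW.
have t01 : 0 <= t <= 1 by rewrite !ltW.
have := dH s t s01 t01 sd td; have := d'H s t s01 t01 sd' td'.
rewrite /D /A; move: (ip _ (wd t)) (ip _ (wd x)) (ip _ (w1 t)) (ip _ (w1 x)) => a b c c'.
by rewrite !ltr_norml; lra.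
Qed.

Let D_prim (h : R) : exists Th : R -> R,
  forall x, 0 < x < 1 -> 0 < x + h < 1 -> is_derive x 1 Th (D x (x + h)).
Proof.
pose g s := D s (clip (s + h)).
have cg : {within cI01, continuous g}.
  rewrite (_ : g = fun s => -1 * ip (wd s) (wd (clip (s + h))) +
      ip (w1 s) (w1 (clip (s + h)))); last first.
    by apply/funext => s; rewrite /g /D mulN1r addrC.
  exact: within_continuousS (continuous_ip Cwd (C01_clip h Cwd))
    (continuous_ip Cw1 (C01_clip h Cw1)).
exists (prim g) => x x01 /andP[h0 h1].
have := is_derive_prim (L2_continuous cg) x01 (within_continuous_at cg x01).
by rewrite /g clip_id// !ltW.
Qed.

Let main_derive x : 0 < x < 1 ->
  is_derive x 1 (fun x => 2 * A x x - D x x) (2 * ip (F x) (w1 x)).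
Proof.
have lw s : 0 <= s <= 1 -> L2 (w s) by exact: (C01_mem CwL).
have I01 (s : R) : 0 < s < 1 -> 0 <= s <= 1 by move=> /andP[? ?]; rewrite !ltW.
apply: (@symmetric_difference_derive _ (fun s t => ip (w1 s) (w t)) A
  (fun s t => ip (F s) (w t)) (fun s t => ip (F s) (w1 t)) D).
- by move=> s t; rewrite /D /A ipC [ip (wd s) _]ipC.
- move=> s h s01 sh01.
  have dd := ip_product_rule Cw1 lw s01 sh01 (dw (I01 _ sh01)) (dw1 (C01_mem Cw (I01 _ sh01)) s01).
  apply: (is_derive_eq dd); rewrite /D /A.
  by move: (ip _ _) (ip _ _) (ip _ _) => a b c; ring.
- by move=> s s01; exact: ip_dx (C01_mem Cw1 (I01 _ s01)) lw s01 (dw (I01 _ s01)).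
- move=> s t s01 t01.
  exact: ip_dx (C01_mem CF (I01 _ s01)) lw t01 (dw (I01 _ t01)).
- exact: D_cont.
- move=> s e s01 e0; have [d d0 dH] := ip_joint CF Cw1 (I01 _ s01) (I01 _ s01) e0.
  by exists d => // a b a01 b01; apply: dH; exact: I01.
- exact: D_prim.
Qed.

Let E x := normL2 (w1 x) ^+ 2 + normH1 (w x) ^+ 2.

Let EE x : 0 <= x <= 1 -> E x = ip (w x) (w x) + (2 * A x x - D x x).
Proof.
move=> x01; rewrite /E normH1_sqr (normL2_sqr (C01_mem Cw1 x01)).
rewrite (normL2_sqr (C01_mem CwL x01)) (normL2_sqr (C01_mem Cwd x01)) /D /A /wd.
by move: (ip (w1 x) (w1 x)) (ip (w x) (w x)) (ip (wderiv (w x)) (wderiv (w x))) => a b c; ring.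
Qed.

Let energy_derive x : 0 < x < 1 ->
  is_derive x 1 E (2 * ip (w x) (w1 x) + 2 * ip (F x) (w1 x)).
Proof.
move=> x01; have x01' : 0 <= x <= 1 by case/andP: x01 => ? ?; rewrite !ltW.
have lw s : 0 <= s <= 1 -> L2 (w s) by exact: (C01_mem CwL).
apply: (is_derive_cI01 EE x01); apply: is_deriveD (main_derive x01).
have d1 : is_derive x 1 (fun s => ip (w s) (w (x + 0))) (ip (w x) (w1 x)).
  rewrite addr0 (_ : (fun s => _) = fun s => ip (w x) (w s)).
    exact: ip_dx (lw _ x01') lw x01 (dw x01').
  by apply/funext => s; rewrite ipC.
have x01'' : 0 < x + 0 < 1 by rewrite addr0.
have dx' : is_dx w (x + 0) (w1 x) by rewrite addr0; exact: dw.
have := ip_product_rule CwL lw x01 x01'' dx' d1.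
under eq_fun do rewrite addr0.
move=> dd; apply: (is_derive_eq dd); by rewrite mulr_natl mulr2n.
Qed.

Let energy_continuous : {within cI01, continuous E}.
Proof.
have c : {within cI01, continuous (fun x => 1 * ip (w x) (w x) +
    (1 * ip (w1 x) (w1 x) + ip (wd x) (wd x)))}.
  apply: within_continuousS; first exact: continuous_ip.
  by apply: within_continuousS; exact: continuous_ip.
have e x : 0 <= x <= 1 -> E x = 1 * ip (w x) (w x) +
    (1 * ip (w1 x) (w1 x) + ip (wd x) (wd x)).
  move=> /EE ->; rewrite /D /A.
  by move: (ip (w1 x) (w1 x)) (ip (w x) (w x)) (ip (wd x) (wd x)) => a b b'; ring.
apply/within_cI01_continuousP => x x01 a a0.
have [d d0 dH] := (within_cI01_continuousP _).1 c x x01 a a0.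
by exists d => // z z01 zx; rewrite !e//; exact: dH.
Qed.

Variables a delta : R.
Hypotheses (a0 : 0 <= a) (delta0 : 0 <= delta).
Hypothesis F_bound : forall x, 0 <= x <= 1 ->
  normL2 (F x) <= a * normH1 (w x) + delta.

Let energy_ineq x : 0 < x < 1 ->
  2 * ip (w x) (w1 x) + 2 * ip (F x) (w1 x) <= (a + 2) * E x + delta ^+ 2.
Proof.
move=> /andP[x0 x1]; have x01 : 0 <= x <= 1 by rewrite !ltW.
have l1 := C01_mem Cw1 x01.
have := le_trans (ler_norm _) (ip_CS (C01_mem CwL x01) l1).
have := le_trans (ler_norm _) (ip_CS (C01_mem CF x01) l1).
have := F_bound x01; have := normL2_le_H1 (w x); have := normL2_ge0 (w1 x).
have := normL2_ge0 (w x); rewrite /E.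
move: (normL2 (w x)) (normL2 (w1 x)) (normL2 (F x)) (normH1 (w x)) => n n1 f N.
move: (ip _ _) (ip _ _) => i1 i2 n0 n10 nN fN h2 h1.
have k1 : i1 <= N * n1 by apply: le_trans h1 _; rewrite ler_wpM2r.
have k2 : i2 <= a * (N * n1) + delta * n1.
  by apply: le_trans h2 _; rewrite mulrA -mulrDl ler_wpM2r.
(* Three Young inequalities: $2aNn_1\le a(N^2+n_1^2)$, $2\delta n_1\le n_1^2+\delta^2$ and $2Nn_1\le
   N^2+n_1^2$. They account for the constant $a+2$. *)
have k3 : 0 <= a * (n1 - N) ^+ 2 by rewrite mulr_ge0// sqr_ge0.
have k4 := sqr_ge0 (n1 - delta); have k5 := sqr_ge0 (n1 - N).
have k6 := sqr_ge0 N; rewrite !expr2 in k3 k4 k5 k6 *; lra.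
Qed.

(** Gronwall's lemma: $(E+\delta^2)e^{-(a+2)x}$ is nonincreasing, the source being absorbed by
    $\delta^2\le(a+2)\delta^2$. *)
Lemma energy_estimate x : 0 <= x <= 1 ->
  normL2 (w1 x) ^+ 2 + normH1 (w x) ^+ 2 <=
  (normL2 (w1 0) ^+ 2 + normH1 (w 0) ^+ 2 + delta ^+ 2) * expR ((a + 2) * x).
Proof.
rewrite -/(E x) -/(E 0); move=> /andP[]; rewrite le_eqVlt => /predU1P[<- _|x0 x1].
  by rewrite mulr0 expR0 mulr1 lerDl sqr_ge0.
pose c := a + 2; pose g x := (E x + delta ^+ 2) * expR (- c * x).
pose g' y := (2 * ip (w y) (w1 y) + 2 * ip (F y) (w1 y) - c * (E y + delta ^+ 2)) *
  expR (- c * y).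
have dg (y : R) : 0 < y < 1 -> is_derive y 1 g (g' y).
  move=> y01; have dE := energy_derive y01.
  have dl : is_derive y 1 (fun y => - c * y + 0) (- c * 1 + 0).
    exact: is_derive_lin (is_derive_id _ _) (is_derive_cst (0 : R) y 1).
  have de : is_derive y 1 (fun y => expR (- c * y)) (- c * expR (- c * y)).
    have dc := is_derive1_comp (g := fun y : R => - c * y + 0) (is_derive_expR (- c * y + 0)) dl.
    rewrite (_ : (fun y => expR _) = expR \o (fun y => - c * y + 0)); last first.
      by apply/funext => t /=; rewrite addr0.
    by apply: (is_derive_eq dc); rewrite !addr0 mulr1 mulrC.
  have dEd := is_deriveD dE (is_derive_cst (delta ^+ 2) y (1 : R)).
  have dg := is_deriveM dEd de.
  apply: (is_derive_eq dg); rewrite /g' /GRing.scale /= addr0.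
  rewrite -[(_ + cst _) y]/(E y + delta ^+ 2).
  move: (expR _) (E y) (2 * _ + _) => p q r; ring.
have cg : {within `[0, x], continuous g}.
  have cE : {within `[0, x], continuous E}.
    apply: continuous_subspaceW energy_continuous => y /=.
    by rewrite /cI01 /= !in_itv /= => /andP[-> /le_trans ->].
  move/subspace_continuousP: cE => cE; apply/subspace_continuousP => y yx.
  apply: cvgM; first by apply: cvgD (cE y yx) _; exact: cvg_cst.
  apply: cvg_within_filter; apply: (@continuous_comp _ _ _ (fun y => - c * y)).
    by apply: cvgM; [exact: cvg_cst|exact: cvg_id].
  exact: continuous_expR.
have [y|y] := @MVT R g g' 0 x x0 _ cg.
  by rewrite in_itv /= => /andP[y0 yx]; apply: dg; rewrite y0 (lt_le_trans yx).
rewrite in_itv /= => /andP[y0 yx] e.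
have y01 : 0 < y < 1 by rewrite y0 (lt_le_trans yx).
have : g x <= g 0.
  rewrite -subr_le0 e subr0 pmulr_lle0// pmulr_lle0 ?expR_gt0//.
  have := energy_ineq y01; rewrite -/c => h; rewrite subr_le0; apply: le_trans h _.
  rewrite (mulrDr c (E y)) lerD2l ler_peMl ?sqr_ge0// /c; move: a0; lra.
rewrite /g mulr0 expR0 mulr1 mulNr expRN -/c ler_pdivrMr ?expR_gt0//.
by apply: le_trans; rewrite lerDl sqr_ge0.
Qed.

End energy.
End energy_estimate.

(** * The error estimate *)

Section error_estimate.
Context {R : realType}.
Implicit Types (f g h psi : R -> R) (v w z : R -> R -> R) (x : R).
Opaque L2 normL2 ip prim wderiv normH1 dx H10 H1.

Lemma linear_sub (D : set (R -> R)) T f g : is_linear D T -> D f -> D g ->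
  eqae (T (f \- g)) (T f \- T g).
Proof.
move=> [_ _ Tlin] Df Dg; have := Tlin (-1) g f Dg Df.
rewrite (_ : (fun y => -1 * g y + f y) = f \- g); last first.
  by apply/funext => y; rewrite mulN1r addrC.
rewrite (_ : (fun y => -1 * T g y + T f y) = T f \- T g)//.
by apply/funext => y; rewrite mulN1r addrC.
Qed.

(** Serves $P$ with the norm of $H^1$ and $Q$ with the norm of $W$; linearity reduces increments of
    [T (v x)] to [T] of increments. *)
Lemma C01_linear (D X : set (R -> R)) (N : (R -> R) -> R) T (K : R) v :
  is_linear D T -> (forall f g, D f -> D g -> D (f \- g)) -> 0 <= K ->
  C01 X N v -> (forall x, 0 <= x <= 1 -> D (v x)) ->
  (forall x y : R, 0 <= x <= 1 -> 0 <= y <= 1 ->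
    normL2 (T (v y \- v x)) <= K * N (v y \- v x)) ->
  C01 L2 normL2 (fun x => T (v x)).
Proof.
move=> Tlin Dsub K0 cv Dv TK; have [TL2 _ _] := Tlin.
apply: C01I => [f|x x01|x x01 e e0]; first exact: normL2_ge0.
  exact: TL2 _ (Dv _ x01).
have K1 : 0 < K + 1 by rewrite ltr_wpDl.
have [d d0 dH] := C01_eps cv x01 (divr_gt0 e0 K1); exists d => // s s01 sx.
have ls := TL2 _ (Dv _ s01); have lx := TL2 _ (Dv _ x01).
have lB := TL2 _ (Dsub _ _ (Dv _ s01) (Dv _ x01)).
rewrite -(normL2_eqae lB (L2B ls lx) (linear_sub Tlin (Dv _ s01) (Dv _ x01))).
apply: le_lt_trans (TK _ _ x01 s01) _.
apply: le_lt_trans (_ : K * (e / (K + 1)) < e).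
  by rewrite ler_wpM2l// ltW// dH.
by rewrite mulrCA gtr_pMr// ltr_pdivrMr// mul1r ltrDl.
Qed.

Lemma H1_sub f g : H1 f -> H1 g -> H1 (f \- g).
Proof. by move=> hf hg; have [] := H1B hf hg. Qed.

Lemma H10_sub f g : H10 f -> H10 g -> H10 (f \- g).
Proof.
move=> hf hg; rewrite (_ : f \- g = fun y => -1 * g y + f y); first exact: H10S.
by apply/funext => y; rewrite mulN1r addrC.
Qed.

Lemma C01_H10B v w : C01 H10 normH1 v -> C01 H10 normH1 w ->
  C01 H10 normH1 (fun x => v x \- w x).
Proof.
move=> cv cw; apply: C01I => [f|x x01|x x01 e e0]; first exact: normH1_ge0.
  exact: H10_sub (C01_mem cv x01) (C01_mem cw x01).
have e4 : 0 < e / 4 by rewrite divr_gt0.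
have [d d0 dH] := C01_eps cv x01 e4; have [d' d'0 d'H] := C01_eps cw x01 e4.
exists (Num.min d d'); first by rewrite lt_min d0.
move=> s s01; rewrite lt_min => /andP[sd sd'].
have hvs := H10_H1 (C01_mem cv s01); have hvx := H10_H1 (C01_mem cv x01).
have hws := H10_H1 (C01_mem cw s01); have hwx := H10_H1 (C01_mem cw x01).
have -> : (v s \- w s) \- (v x \- w x) = (v s \- v x) \- (w s \- w x).
  apply/funext => y /=.
  by move: (v s y) (w s y) (v x y) (w x y) => a b c c'; ring.
apply: le_lt_trans (normH1_triangle (H1_sub hvs hvx) (H1_sub hws hwx)) _.
by have := dH s s01 sd; have := d'H s s01 sd'; lra.
Qed.

Lemma is_dxB v w f g x : 0 <= x <= 1 ->
  (forall x, 0 <= x <= 1 -> L2 (v x)) -> (forall x, 0 <= x <= 1 -> L2 (w x)) ->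
  is_dx v x f -> is_dx w x g -> is_dx (fun x => v x \- w x) x (f \- g).
Proof.
move=> x01 lv lw /(is_dx_cI01P _ _ x01)[lf fH] /(is_dx_cI01P _ _ x01)[lg gH].
apply/(is_dx_cI01P _ _ x01); split; first exact: L2B.
move=> e e0; have e2 : 0 < e / 2 by rewrite divr_gt0.
have [d d0 dH] := fH _ e2; have [d' d'0 d'H] := gH _ e2.
exists (Num.min d d'); first by rewrite lt_min d0.
move=> s s01 sx; rewrite lt_min => /andP[sd sd'].
have lqv := L2_quotient s x (lv _ s01) (lv _ x01).
have lqw := L2_quotient s x (lw _ s01) (lw _ x01).
have := normL2B (L2B lqv lf) (L2B lqw lg).
rewrite (_ : (_ \- _) \- (_ \- _) = fun y =>
    ((v s \- w s) y - (v x \- w x) y) / (s - x) - (f \- g) y); last first.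
  apply/funext => y /=; rewrite -[in RHS](mulrC (s - x)^-1) -![in LHS](mulrC (s - x)^-1).
  move: (s - x)^-1 (v s y) (w s y) (v x y) (w x y) (f y) (g y) => q a b c c' p r.
  ring.
by move/le_lt_trans; apply; rewrite (splitr e) ltrD// ?dH// d'H.
Qed.

(** By the reverse triangle inequality the norm along the curve is a continuous function on a
    compact interval. *)
Lemma normed_space_bound (W : set (R -> R)) (N : (R -> R) -> R) v :
  normed_function_space W N -> C01 W N v ->
  exists2 M : R, 0 <= M & forall x, 0 <= x <= 1 -> N (v x) <= M.
Proof.
move=> WN cv.
have Wsub f g : W f -> W g -> W (f \- g).
  move=> Wf Wg; rewrite (_ : f \- g = fun y => -1 * g y + f y).
    exact: (nfs_lin WN).
  by apply/funext => y; rewrite mulN1r addrC.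
have tri f g : W f -> W g -> N f - N g <= N (f \- g).
  move=> Wf Wg; have := nfs_triangle WN (Wsub _ _ Wf Wg) Wg.
  rewrite (_ : (f \- g) \+ g = f) ?lerBlDr//.
  by apply/funext => y /=; rewrite subrK.
have sym f g : W f -> W g -> N (f \- g) = N (g \- f).
  move=> Wf Wg; have := nfs_homog WN (-1) (Wsub _ _ Wg Wf).
  rewrite normrN normr1 mul1r => <-; congr N.
  by apply/funext => y /=; rewrite mulN1r opprB.
have cN : {within cI01, continuous (fun x => N (v x))}.
  apply/within_cI01_continuousP => x x01 e e0.
  have [d d0 dH] := C01_eps cv x01 e0; exists d => // s s01 sx.
  have Ws := C01_mem cv s01; have Wx := C01_mem cv x01.
  apply: le_lt_trans (dH s s01 sx); rewrite ler_norml tri// andbT.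
  by rewrite lerNl opprB sym// tri.
have [M [M0 MH]] := continuous_I01_bounded cN; exists M => // x x01.
by apply: le_trans (ler_norm _) _; apply: MH; rewrite cI01_itv.
Qed.

Section weak_problem.
Variables (P : (R -> R) -> (R -> R)) (u0 : R -> R) (u : R -> R -> R).
Hypothesis S : weak_solution P u0 u.

(** The weak derivative of $\langle u_x,\psi\rangle$ agrees almost everywhere with a continuous
    function, so [wderiv_continuous] integrates the equation up to every $x$. *)
Lemma weak_evolution psi x : C01 L2 normL2 (fun x => P (u x)) ->
  H10 psi -> 0 <= x <= 1 ->
  ip (dx u x) psi = ip (dx u 0) psi +
    prim (fun s => - ip (wderiv (u s)) (wderiv psi) - ip (P (u s)) psi) x.
Proof.
move=> CP hpsi x01; have [v [_ vw veq]] := ws_dxx S.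
have lpsi := H1_L2 (H10_H1 hpsi); have [lw _] := H1_wderiv (H10_H1 hpsi).
pose m s := - ip (wderiv (u s)) (wderiv psi) - ip (P (u s)) psi.
have Cu := C01_H10_wderiv (ws_cont S).
have cm : {within cI01, continuous m}.
  rewrite (_ : m = fun s => -1 * ip (wderiv (u s)) (wderiv psi) - ip (P (u s)) psi).
    apply: within_continuousS (continuous_ip_cst Cu lw) _.
    exact: within_continuousN (continuous_ip_cst CP lpsi).
  by apply/funext => s; rewrite mulN1r.
have cdx := continuous_ip_cst (ws_dx_cont S) lpsi.
apply: (wderiv_continuous cdx cm _ x01) => phi tphi.
rewrite (vw phi psi tphi hpsi); congr (- _); apply: ip_eqae.
apply: ae_imp (veq psi hpsi) _ => s h Is.
by apply/eqP; rewrite /m -subr_eq0 !opprD !opprK addrA h.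
Qed.

End weak_problem.

Section fixed_parameter.
Variables (W : set (R -> R)) (N : (R -> R) -> R) (C0 C1 g M : R).
Hypotheses (WN : normed_function_space W N) (C00 : 0 < C0) (C10 : 0 < C1).
Hypothesis g1 : 1 <= g.
Variables (Q P : (R -> R) -> (R -> R)).
Hypotheses (Q_pert : perturbing W N C0 g Q) (P_stab : stabilized C1 g P).
Hypothesis PQ : stab_pert_rel P Q.
Variables (u0 u0e : R -> R) (u ue : R -> R -> R).
Hypotheses (Su : strong_solution u0 u) (uW : C01 W N u).
Hypothesis Sue : weak_solution P u0e ue.
Hypotheses (M0 : 0 <= M) (uM : forall x, 0 <= x <= 1 -> N (u x) <= M).
Hypotheses (u0_H1 : H1 u0) (u0e_H1 : H1 u0e).

Let g0 : 0 < g. Proof. exact: lt_le_trans g1. Qed.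
Let lng0 : 0 <= ln g. Proof. exact: ln_ge0. Qed.
Let a := C1 * ln g.
Let a0 : 0 <= a. Proof. by rewrite mulr_ge0// ltW. Qed.

Let C01_P v : C01 H10 normH1 v -> C01 L2 normL2 (fun x => P (v x)).
Proof.
move=> cv; have [Plin Pb] := P_stab; have H1v x : 0 <= x <= 1 -> H1 (v x).
  by move=> x01; exact: H10_H1 (C01_mem cv x01).
apply: (C01_linear Plin H1_sub a0 cv H1v) => x y x01 y01.
by apply: Pb; exact: H1_sub (H1v _ y01) (H1v _ x01).
Qed.

Let CPu := C01_P (exact_C01 Su).
Let CPue := C01_P (ws_cont Sue).

Let CQu : C01 L2 normL2 (fun x => Q (u x)).
Proof.
have [Qlin Qb] := Q_pert.
have K0 : 0 <= C0 / g by rewrite divr_ge0// ltW.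
apply: (C01_linear Qlin (@L2B R) K0 uW) => [x x01|x y x01 y01].
  exact: nfs_sub WN _ (C01_mem uW x01).
rewrite mulrAC; apply: Qb.
rewrite (_ : _ \- _ = fun s => -1 * u x s + u y s); last first.
  by apply/funext => s; rewrite mulN1r addrC.
exact: nfs_lin WN _ _ _ (C01_mem uW x01) (C01_mem uW y01).
Qed.

Let w x := ue x \- u x.
Let w1 x := dx ue x \- dx u x.
Let F x := (P (u x) \- P (ue x)) \- Q (u x).

Let evolution psi x : H10 psi -> 0 <= x <= 1 ->
  ip (w1 x) psi = ip (w1 0) psi +
    prim (fun s => - ip (wderiv (w s)) (wderiv psi) + ip (F s) psi) x.
Proof.
move=> hpsi x01; have lpsi := H1_L2 (H10_H1 hpsi).
have [lw _] := H1_wderiv (H10_H1 hpsi).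
have z01 : 0 <= (0 : R) <= 1 by rewrite lexx ler01.
have Cdu := exact_dx_C01 Su; have Cdue := ws_dx_cont Sue.
rewrite (ipBl (C01_mem Cdue x01) (C01_mem Cdu x01) lpsi).
rewrite (ipBl (C01_mem Cdue z01) (C01_mem Cdu z01) lpsi).
rewrite (weak_evolution Sue CPue hpsi x01) (exact_evolution Su hpsi x01).
rewrite (exact_evolution Su hpsi z01) (prim_le0 _ (lexx 0)) subr0 -addrA; congr (_ + _).
have Cwu := exact_wderiv_C01 Su; have Cwue := C01_H10_wderiv (ws_cont Sue).
have c1 := continuous_ip_cst Cwu lw; have c2 := continuous_ip_cst Cwue lw.
have c3 := continuous_ip_cst CPue lpsi.
have l2 : L2 (fun s => - ip (wderiv (ue s)) (wderiv psi) - ip (P (ue s)) psi).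
  exact: L2B (L2N (L2_continuous c2)) (L2_continuous c3).
rewrite -(primB _ l2 (L2_continuous c1)); apply: prim_eqae; apply: aeW => s.
rewrite I01_itv => /andP[s0 s1]; have s01 : 0 <= s <= 1 by rewrite !ltW.
have hu := H10_H1 (C01_mem (exact_C01 Su) s01).
have hue := H10_H1 (C01_mem (ws_cont Sue) s01).
have [_ wB] := H1B hue hu.
have lPu := C01_mem CPu s01; have lPue := C01_mem CPue s01; have lQu := C01_mem CQu s01.
have e1 : ip (wderiv (w s)) (wderiv psi) =
    ip (wderiv (ue s)) (wderiv psi) - ip (wderiv (u s)) (wderiv psi).
  by rewrite (ip_eqae _ wB) (ipBl (C01_mem Cwue s01) (C01_mem Cwu s01) lw).
have e2 : ip (F s) psi = ip (P (u s)) psi - ip (P (ue s)) psi - ip (Q (u s)) psi.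
  by rewrite (ipBl (L2B lPu lPue) lQu lpsi) (ipBl lPu lPue lpsi).
(* The gradient terms of the two equations have opposite signs, so their difference leaves an extra
   $-2\langle u_y,\psi_y\rangle$; [e3] identifies it with $\langle Pu-Qu,\psi\rangle$. *)
have e3 := exact_stab_pert Su PQ CPu CQu hpsi s01.
rewrite e1 e2 e3 /=.
move: (ip (wderiv (ue s)) _) (ip (wderiv (u s)) _) (ip (P (ue s)) _) (ip (Q (u s)) _).
by move=> b c d e; ring.
Qed.

Let F_bound x : 0 <= x <= 1 -> normL2 (F x) <= a * normH1 (w x) + C0 * M / g.
Proof.
move=> x01; have [Plin Pb] := P_stab; have [_ Qb] := Q_pert.
have lPu := C01_mem CPu x01; have lPue := C01_mem CPue x01; have lQu := C01_mem CQu x01.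
have hu := H10_H1 (C01_mem (exact_C01 Su) x01).
have hue := H10_H1 (C01_mem (ws_cont Sue) x01); have hw := H1_sub hue hu.
apply: le_trans (normL2B (L2B lPu lPue) lQu) _; apply: lerD.
  rewrite (normL2C lPu lPue); have [PL2 _ _] := Plin.
  rewrite -(normL2_eqae (PL2 _ hw) (L2B lPue lPu) (linear_sub Plin hue hu)).
  exact: Pb.
apply: le_trans (Qb _ (C01_mem uW x01)) _.
by rewrite ler_pM2r ?invr_gt0// ler_pM2l// uM.
Qed.

(** Gronwall's bound with $a=C_1\ln g$ and $\delta=C_0M/g$. Both $x$-derivatives vanish at $x=0$, so
    the initial energy is the squared $H^1$ distance of the data. *)
Lemma error_estimate x (eps : R) : 0 <= eps -> normH1 (u0e \- u0) <= eps ->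
  0 <= x <= 1 ->
  normL2 (dx ue x \- dx u x) ^+ 2 + normH1 (ue x \- u x) ^+ 2 <=
  (eps ^+ 2 + (C0 * M / g) ^+ 2) * expR ((C1 * ln g + 2) * x).
Proof.
move=> eps0 ueps x01.
have Cw : C01 H10 normH1 w := C01_H10B (ws_cont Sue) (exact_C01 Su).
have Cw1 : C01 L2 normL2 w1 := C01B (ws_dx_cont Sue) (exact_dx_C01 Su).
have CF : C01 L2 normL2 F := C01B (C01B CPu CPue) CQu.
have CLu := C01_H10_L2 (exact_C01 Su); have CLue := C01_H10_L2 (ws_cont Sue).
have dw y : 0 <= y <= 1 -> is_dx w y (w1 y).
  move=> y01; have due : is_dx ue y (dx ue y) by apply: (ws_dx Sue); rewrite cI01_itv.
  apply: (is_dxB y01 _ _ due (exact_is_dx Su y01)) => t t01.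
    exact: C01_mem CLue t01.
  exact: C01_mem CLu t01.
have d0 : 0 <= C0 * M / g by rewrite divr_ge0 ?mulr_ge0// ltW.
apply: le_trans (energy_estimate Cw dw Cw1 CF evolution a0 F_bound x01) _.
rewrite ler_pM2r ?expR_gt0// lerD2r.
have z01 : 0 <= (0 : R) <= 1 by rewrite lexx ler01.
have -> : normL2 (w1 0) = 0.
  rewrite -[RHS](@normL2_0 R); apply: normL2_eqae; [exact: C01_mem Cw1 z01|exact: L2_0|].
  have := exact_dx_init Su; apply: filterS2 (ws_init_dx Sue) => y h1 h2 Iy.
  by rewrite /w1 /= h1// h2// subrr.
have -> : normH1 (w 0) = normH1 (u0e \- u0).
  apply: normH1_eqae; first exact: L2B (C01_mem CLue z01) (C01_mem CLu z01).
    exact: L2B (H1_L2 u0e_H1) (H1_L2 u0_H1).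
  have := ss_init Su; apply: filterS2 (ws_init Sue) => y h1 h2 Iy.
  by rewrite /w /= h1// h2.
by rewrite expr0n/= add0r ler_pXn2r// nnegrE normH1_ge0.
Qed.

End fixed_parameter.
End error_estimate.

(** * From the exponential bound to a power of $\gamma$ *)

Section powers.
Context {R : realType}.
Opaque normL2 normH1 dx L2 H1.

(** The left side is $C\,e^{2x}g^{cx-2}$. As $g\ge1$ and $c,x\ge0$, the exponent $cx$ may be
    enlarged to $\frac73cx$, and $e^{2x}\le e^2$. *)
Lemma expR_le_powR (g C c x : R) : 1 <= g -> 0 <= c -> 0 <= C -> 0 <= x <= 1 ->
  C / g ^+ 2 * expR ((c * ln g + 2) * x) <=
  C * expR 2 * g `^ (7 * c * x / 3 - 2).
Proof.
move=> g1 c0 C0 /andP[x0 x1]; have g0 : 0 < g by exact: lt_le_trans g1.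
have L0 : 0 <= ln g by exact: ln_ge0.
rewrite /powR gt_eqF//= -(mulrA C (expR 2)) -(mulrA C) ler_wpM2l//.
have -> : (g ^+ 2)^-1 = expR (- 2 * ln g).
  by rewrite mulNr expRN expRM_natl lnK.
rewrite -!expRD ler_expR.
have : 0 <= c * ln g * x by rewrite !mulr_ge0.
have : 2 * x <= 2 by lra.
move: (ln g) L0 => L L0 k1 k2.
have -> : (7 * c * x / 3 - 2) * L = 7 / 3 * (c * L * x) - 2 * L by field.
have -> : (c * L + 2) * x = c * L * x + 2 * x by ring.
by move: (c * L * x) k1 k2 => p ? ?; lra.
Qed.

End powers.

Theorem theorem4p2 (R : realType)
  (gamma : R -> R)
  (gamma_ge1 : forall b : R, 0 < b < 1 -> 1 <= gamma b)
  (gamma_lim : gamma b @[b --> 0^'+] --> +oo)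
  (beta : R -> R)
  (beta_range : forall eps : R, 0 < eps < 1 -> 0 < beta eps < 1)
  (beta_lim : beta eps @[eps --> 0^'+] --> 0)
  (u0 : R -> R) (u0_H1 : H1 u0)
  (u0eps : R -> R -> R)
  (u0eps_H1 : forall eps : R, 0 < eps < 1 -> H1 (u0eps eps))
  (u0eps_close : forall eps : R, 0 < eps < 1 ->
     normH1 (u0eps eps \- u0) <= eps)
  (u0eps_bdry : forall eps : R, 0 < eps < 1 ->
     bvalue (u0eps eps) 0 0 /\ bvalue (u0eps eps) 1 0)
  (W : set (R -> R)) (normW : (R -> R) -> R)
  (W_space : normed_function_space W normW)
  (C0 C1 : R) (C0_gt0 : 0 < C0) (C1_gt0 : 0 < C1)
  (Q P : R -> R -> (R -> R) -> (R -> R))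
  (Q_pert : forall eps : R, 0 < eps < 1 ->
     perturbing W normW C0 (gamma (beta eps)) (Q eps (beta eps)))
  (P_stab : forall eps : R, 0 < eps < 1 ->
     stabilized C1 (gamma (beta eps)) (P eps (beta eps)))
  (P_rel : forall eps : R, 0 < eps < 1 ->
     stab_pert_rel (P eps (beta eps)) (Q eps (beta eps)))
  (u : R -> R -> R)
  (u_sol : strong_solution u0 u) (u_W : C01 W normW u)
  (ueps : R -> R -> R -> R)
  (ueps_sol : forall eps : R, 0 < eps < 1 ->
     weak_solution (P eps (beta eps)) (u0eps eps) (ueps eps))
  (C1_lt : C1 < 6 / 7) :
  (forall K1 : R, 0 < K1 ->
     eps * gamma (beta eps) * ln (gamma (beta eps)) @[eps --> 0^'+] --> K1 ->
     exists C : R, 0 <= C /\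
       \forall eps \near 0^'+, forall x : R, 0 <= x <= 1 ->
         normL2 (dx (ueps eps) x \- dx u x) ^+ 2
           + normH1 (ueps eps x \- u x) ^+ 2
         <= C * gamma (beta eps) `^ (7 * C1 * x / 3 - 2))
  /\
  (forall K2 : R, 0 < K2 ->
     eps * gamma (beta eps) @[eps --> 0^'+] --> K2 ->
     exists C : R, 0 <= C /\
       \forall eps \near 0^'+, forall x : R, 0 <= x <= 1 ->
         normL2 (ueps eps x \- u x) ^+ 2
         <= C * gamma (beta eps) `^ (7 * C1 * x / 3 - 2)).
Proof.
have [M M0 uM] := normed_space_bound W_space u_W.
have eps01 : \forall eps \near (0 : R)^'+, 0 < eps < 1.
  near=> eps; apply/andP; split; near: eps; first exact: nbhs_right_gt.
  exact: nbhs_right_lt.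
(* Both parts reduce to an upper bound $\varepsilon\gamma\le K$: then $\varepsilon^2\le
   K^2/\gamma^2$ has the same order as the square of $C_0M/\gamma$. *)
have main (K : R) : 0 <= K -> (\forall eps \near 0^'+, eps * gamma (beta eps) <= K) ->
    exists C : R, 0 <= C /\
      \forall eps \near 0^'+, forall x : R, 0 <= x <= 1 ->
        normL2 (dx (ueps eps) x \- dx u x) ^+ 2
          + normH1 (ueps eps x \- u x) ^+ 2
        <= C * gamma (beta eps) `^ (7 * C1 * x / 3 - 2).
  move=> K0 hK; exists ((K ^+ 2 + (C0 * M) ^+ 2) * expR 2); split.
    by rewrite mulr_ge0 ?expR_ge0// addr_ge0 ?sqr_ge0.
  apply: filterS2 eps01 hK => eps e01 eK x x01.
  have g1 := gamma_ge1 _ (beta_range _ e01); have g0 := lt_le_trans ltr01 g1.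
  have /andP[e0 _] := e01.
  apply: le_trans (error_estimate W_space C0_gt0 C1_gt0 g1 (Q_pert _ e01) (P_stab _ e01)
    (P_rel _ e01) u_sol u_W (ueps_sol _ e01) M0 uM u0_H1 (u0eps_H1 _ e01) (ltW e0)
    (u0eps_close _ e01) x01) _.
  have KM : 0 <= K ^+ 2 + (C0 * M) ^+ 2 by rewrite addr_ge0 ?sqr_ge0.
  apply: le_trans (expR_le_powR g1 (ltW C1_gt0) KM x01).
  rewrite ler_pM2r ?expR_gt0// mulrDl [(C0 * M / _) ^+ 2]exprMn exprVn lerD2r.
  rewrite ler_pdivlMr ?exprn_gt0// -exprMn ler_pXn2r// nnegrE mulr_ge0// ltW//.
split=> [K1 K10 lim|K2 K20 lim].
  apply: (main (K1 + 1)); first by rewrite addr_ge0// ltW.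
  (* The limit of [gamma] is one-sided, so [beta] has to approach 0 through positive values. *)
  have b0 : beta eps @[eps --> 0^'+] --> 0^'+.
    move=> A /= hA; have := beta_lim _ hA; apply: filterS2 eps01 => eps e01; apply.
    by have /andP[] := beta_range _ e01.
  have ln1 : \forall eps \near 0^'+, expR 1 <= gamma (beta eps).
    have /cvgryPge := cvg_comp _ _ b0 gamma_lim; exact.
  have ub : \forall eps \near 0^'+, eps * gamma (beta eps) * ln (gamma (beta eps)) <= K1 + 1.
    by apply: (cvgr_le K1) => //; rewrite ltrDl.
  near=> eps.
  have e01 : 0 < eps < 1 by near: eps; exact: eps01.
  have g1 := gamma_ge1 _ (beta_range _ e01); have g0 := lt_le_trans ltr01 g1.
  have /andP[e0 _] := e01.
  (* As $\gamma\ge e$ for small $\varepsilon$, the logarithm is at least 1, and the bound on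
     $\varepsilon\gamma\ln\gamma$ is one on $\varepsilon\gamma$. *)
  apply: le_trans (_ : eps * gamma (beta eps) * ln (gamma (beta eps)) <= _).
    rewrite ler_peMr ?mulr_ge0 ?(ltW e0) ?(ltW g0)//.
    rewrite -[1](expRK) ler_ln ?posrE ?expR_gt0//.
    by near: eps; exact: ln1.
  by near: eps; exact: ub.
have [|C [C_ge0 HC]] := main (K2 + 1) (addr_ge0 (ltW K20) ler01).
  by apply: (cvgr_le K2) => //; rewrite ltrDl.
exists C; split => //; apply: filterS HC => eps h x x01; apply: le_trans (h x x01).
have n := normL2_le_H1 (ueps eps x \- u x).
apply: le_trans (_ : normH1 (ueps eps x \- u x) ^+ 2 <= _).
  by rewrite ler_pXn2r ?nnegrE ?normL2_ge0 ?normH1_ge0.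
by rewrite lerDr sqr_ge0.
Unshelve. all: by end_near.
Qed.
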